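(* Let $\mathcal{Z}$ be a stationary point process on $\mathbb{R}$ satisfying the following properties (with asymptotic notation as $r\to\infty$ in (1), (2), (5), and as $R\to\infty$ in (3), (4)): (1) (Gap decay) $-\log G(r)/\log r\to\infty$. (2) (Regularity) $G$ is twice differentiable and convex, and $$\log(-G'(r))\sim\log G(r)\qquad\text{and}\qquad\log G''(r)\le\log G(r)\,(1+o(1)).$$ (3) (Splitting) For every $k,\delta>0$ there exists $\delta'>0$ such that, for every $r=R^{o(1)}$ and $s=R^{\delta+o(1)}$, $$\rho^k_{r,s}\le R^{-\delta'+o(1)}.$$ (4) (Clustered decoupling) For every $k,\delta>0$ there exists $c>0$ such that, for every $r=R^{o(1)}$, $s=R^{\delta+o(1)}$ and $\bar r\le s/c$, and every $(\mathcal{C}_\ell)_{\ell\ge1}\in\bar{\mathcal{Q}}^k_{r,\bar r,s}$, $$\mathbb{P}\big[\cap_i\mathcal{G}_{I_i}\big]\le R^{o(1)}\Big(\Big(\prod_{\ell\ge1}\mathbb{P}\big[\cap_{I_i\in\mathcal{C}_\ell}\mathcal{G}_{I_i}\big]\Big)^{1+o(1)}+R^{-k}\Big).$$ (5) (Absence of clustering) There exists $\eta>0$ such that $$\phi_r\le G(r)^{1+\eta+o(1)}.$$ Then, as $R\to\infty$, the point process $\Psi_R$ of rescaled gaps converges vaguely (in distribution) to a Poisson point process on $[0,1]\times(\mathbb{R}\cup\{\infty\})$ with intensity $dx\otimes e^{-y}\,dy$.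
   Context: For an interval $I$, $\mathcal{G}_I$ is the event that $I\cap\mathcal{Z}=\emptyset$; $G(r)=\mathbb{P}[\mathcal{G}_{[0,r]}]$ and $\theta(r)=-\log(-G'(r))$. Writing $(z_i)_{i\in\mathbb{Z}}=\mathcal{Z}$ for an increasing ordering of the points, for $R>1$ let $$\Psi_R=\sum_{i:\,z_i\in[0,R]}\delta_{\left(z_i/R,\ \theta(z_{i+1}-z_i)-\log R\right)}.$$ $\mathbb{R}\cup\{\infty\}$ is the compactification of $\mathbb{R}$ at $+\infty$ (so that sets $[a,\infty]$ are compact). In (3) and (4) $k$ is an integer ($k\ge2$ in (3)). $\mathcal{Q}^k_{r,s}$ is the set of collections of $k$ disjoint compact intervals $(I_i)_{i\le k}$, each of length at most $r$, pairwise separated by distance at least $s$, and $$\rho^k_{r,s}=\inf\Big\{\varepsilon\in[0,1]:\ \frac{\mathbb{P}[\cap_i\mathcal{G}_{I_i}]}{\prod_i\mathbb{P}[\mathcal{G}_{I_i}]}\in[1-\varepsilon,1/(1-\varepsilon)]\ \text{ for all }(I_i)_{i\le k}\in\mathcal{Q}^k_{r,s}\Big\},$$ with $1/0=\infty$. A clustering is a finite collection of clusters $(\mathcal{C}_\ell)_{1\le\ell\le m}$, each a finite set of bounded intervals, such that the closures of all the intervals $I_i\in\cup_\ell\mathcal{C}_\ell$ are mutually disjoint. $\bar{\mathcal{Q}}^k_{r,\bar r,s}$ is the set of clusterings, in which each cluster is a contiguous block of intervals in the left-to-right ordering, such that: there are at most $k$ intervals in total; every interval has length at most $r$; for every $\ell$,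 $\cup_{I_i\in\mathcal{C}_\ell}I_i$ is contained in an interval of length at most $\bar r$; and any two intervals belonging to different clusters are separated by distance at least $s$. $\phi_r=\sup\mathbb{P}[\mathcal{G}_{I_1}\cap\mathcal{G}_{I_2}]$, the supremum being over pairs of compact intervals $(I_1,I_2)$ such that $I_1\cap I_2$ contains at most one point and $|I_1|,|I_2|\ge r$. *)

(* Defs.v *)
From HB Require Import structures.
From mathcomp Require Import all_boot all_order all_algebra.
From mathcomp Require Import all_classical all_reals all_analysis.
From mathcomp Require Import measurable_realfun.
Set Implicit Arguments.
Unset Strict Implicit.
Unset Printing Implicit Defensive.
Import Order.TTheory GRing.Theory Num.Theory.
Import numFieldNormedType.Exports.
Local Open Scope classical_set_scope.
Local Open Scope ring_scope.

(* The real numbers are an arbitrary [R : realType]; the scale parameter that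
   tends to infinity (often called R in the literature) is written [L]. *)

Section point_process.
Context {R : realType} {d : measure_display} {Omega : measurableType d}.
Variables (P : probability Omega R) (Z : Omega -> set R).

(* Point processes are simple: a random locally finite subset of the line,
   measurable in the sense that all counting variables are measurable. *)
Definition point_process :=
  (forall w a b, finite_set (Z w `&` `[a, b])) /\
  (forall B : set R, measurable B ->
    measurable_fun setT (fun w => counting (Z w `&` B) : \bar R)).

Definition stationary :=
  forall (a : R) (n : nat) (B : 'I_n -> set R) (m : 'I_n -> nat),
    (forall i, measurable (B i)) ->
    P [set w | forall i,
         counting ([set z + a | z in Z w] `&` B i) = (m i)%:R%:E :> \bar R] =
    P [set w | forall i, counting (Z w `&` B i) = (m i)%:R%:E :> \bar R].

Definition pr (A : set Omega) : R := fine (P A).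

Definition gap_event (I : interval R) : set Omega :=
  [set w | [set` I] `&` Z w = set0].

Definition gap_prob (r : R) : R := pr (gap_event `[0, r]).

(* Extended-real logarithm, so that [theta r] is [+oo] where [G' r = 0]. *)
Definition theta (r : R) : \bar R := (- lne (- derive1 gap_prob r)%:E)%E.

Definition next_point (w : Omega) (z : R) : R := inf (Z w `&` `]z, +oo[).

Definition rescaled_gap (L : R) (w : Omega) (z : R) : R * \bar R :=
  (z / L, (theta (next_point w z - z) - (ln L)%:E)%E).

Definition Psi (L : R) (w : Omega) : {measure set (R * \bar R) -> \bar R} :=
  let s : seq R := finmap.enum_fset (fset_set (Z w `&` `[0, L])) in
  msum (fun i => dirac (rescaled_gap L w (nth 0 s i))) (size s).

End point_process.

Section intervals.
Context {R : realType}.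

Definition itv_length (I : interval R) : \bar R := lebesgue_measure [set` I].

Definition separated (s : R) (I J : interval R) :=
  forall x y, x \in I -> y \in J -> s <= `|x - y|.

Definition left_of (I J : interval R) :=
  forall x y, x \in I -> y \in J -> x < y.

Definition separated_family (k : nat) (r s : R) (I : 'I_k -> interval R) :=
  [/\ forall i, [set` I i] !=set0 /\ compact [set` I i],
      trivIset setT (fun i => [set` I i]),
      forall i, (itv_length (I i) <= r%:E)%E &
      forall i j, i != j -> separated s (I i) (I j)].

(* A clustering with [n] intervals and [m] clusters is encoded by the intervals
   [I i] and the index [c i] of the cluster containing [I i]. *)
Definition clustering (n m : nat) (I : 'I_n -> interval R) (c : 'I_n -> 'I_m) :=
  (forall i, [set` I i] !=set0 /\ bounded_set [set` I i]) /\
  trivIset setT (fun i => closure [set` I i]).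

Definition separated_clustering (k : nat) (r rbar s : R) (n m : nat)
    (I : 'I_n -> interval R) (c : 'I_n -> 'I_m) :=
  [/\ clustering I c,
      forall i j h, left_of (I i) (I h) -> left_of (I h) (I j) ->
        c i = c j -> c h = c i,
      (n <= k)%N,
      forall i, (itv_length (I i) <= r%:E)%E &
      (forall l, exists J : interval R, (itv_length J <= rbar%:E)%E /\
        \bigcup_(i in [set i | c i = l]) [set` I i] `<=` [set` J]) /\
      (forall i j, c i != c j -> separated s (I i) (I j))].

(* [f L = L ^ (a + o(1))] as [L] tends to infinity. *)
Definition power_asymptotic (a : R) (f : R -> R) :=
  exists e : R -> R, e L @[L --> +oo] --> (0 : R) /\
    \forall L \near +oo, f L = L `^ (a + e L).

End intervals.

Section assumptions.
Context {R : realType} {d : measure_display} {Omega : measurableType d}.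
Variables (P : probability Omega R) (Z : Omega -> set R).
Local Notation G := (gap_prob P Z).

Definition rho (k : nat) (r s : R) : R :=
  inf [set e : R | 0 <= e <= 1 /\
    forall I : 'I_k -> interval R, separated_family r s I ->
      let q := (pr P (\bigcap_i gap_event Z (I i)) /
                \prod_i pr P (gap_event Z (I i)))%:E in
      ((1 - e)%:E <= q /\ q <= ((1 - e)%:E)^-1)%E].

Definition phi (r : R) : R :=
  sup [set p : R | exists I J : interval R,
    [/\ compact [set` I] /\ compact [set` J],
        is_subset1 ([set` I] `&` [set` J]),
        (r%:E <= itv_length I)%E, (r%:E <= itv_length J)%E &
        p = pr P (gap_event Z I `&` gap_event Z J)]].

Definition gap_decay := - ln (G r) / ln r @[r --> +oo] --> +oo.

(* [G'] and [G''] are considered on the open half-line. The limit conditions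
   here and in [gap_decay] entail that [G] and [- G'] do not vanish (the real
   logarithm of the library is [0] there), whereas [G''] may vanish. *)
Definition regularity :=
  [/\ forall r : R, 0 < r -> derivable G r 1 /\ derivable (derive1 G) r 1,
      convex_function (`[0, +oo[%classic : set R) G,
      ln (- derive1 G r) / ln (G r) @[r --> +oo] --> (1 : R) &
      exists e : R -> R, e r @[r --> +oo] --> (0 : R) /\
        \forall r \near +oo,
          (lne (derive1n 2 G r)%:E <= (ln (G r) * (1 + e r))%:E)%E].

Definition splitting :=
  forall (k : nat) (delta : R), (2 <= k)%N -> 0 < delta ->
  exists delta' : R, 0 < delta' /\
  forall r s : R -> R, power_asymptotic 0 r -> power_asymptotic delta s ->
  exists e : R -> R, e L @[L --> +oo] --> (0 : R) /\
    \forall L \near +oo, rho k (r L) (s L) <= L `^ (- delta' + e L).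

Definition clustered_decoupling :=
  forall (k : nat) (delta : R), (0 < k)%N -> 0 < delta ->
  exists c : R, 0 < c /\
  forall r s : R -> R, power_asymptotic 0 r -> power_asymptotic delta s ->
  exists e1 e2 : R -> R,
    [/\ e1 L @[L --> +oo] --> (0 : R), e2 L @[L --> +oo] --> (0 : R) &
    \forall L \near +oo, forall rbar : R, rbar <= s L / c ->
    forall (n m : nat) (I : 'I_n -> interval R) (cl : 'I_n -> 'I_m),
      separated_clustering k (r L) rbar (s L) I cl ->
      pr P (\bigcap_i gap_event Z (I i)) <=
        L `^ (e1 L) *
        ((\prod_(l < m) pr P (\bigcap_(i in [set i | cl i = l])
                                 gap_event Z (I i))) `^ (1 + e2 L)
         + L `^ (- k%:R))].

Definition absence_of_clustering :=
  exists eta : R, 0 < eta /\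
  exists e : R -> R, e r @[r --> +oo] --> (0 : R) /\
    \forall r \near +oo, phi r <= G r `^ (1 + eta + e r).

End assumptions.

Section vague_convergence.
Context {R : realType}.
Local Notation T := (R * \bar R)%type.
Local Notation measureT := {measure set T -> \bar R}.

(* The space [0,1] x (R U {+oo}). Measures on it are represented by measures on
   R x \bar R, only their restriction to [state_space] being relevant. *)
Definition state_space : set T := `[0, 1]%classic `*` [set y | y != -oo%E].

Definition locally_finite (mu : measureT) :=
  forall K, compact K -> K `<=` state_space -> (mu K < +oo)%E.

Definition test_function (f : T -> R) :=
  {within state_space, continuous f} /\
  exists K, [/\ compact K, K `<=` state_space &
    forall p, state_space p -> ~ K p -> f p = 0].

(* Continuity on the space of locally finite measures for the vague topology,
   the coarsest one making the maps [mu |-> \int f dmu] continuous. *)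
Definition vaguely_continuous (F : measureT -> R) :=
  forall mu, locally_finite mu -> forall eps : R, 0 < eps ->
  exists (n : nat) (f : 'I_n -> T -> R) (eta : R),
    [/\ forall i, test_function (f i), 0 < eta &
      forall nu, locally_finite nu ->
        (forall i, `|\int[nu]_(p in state_space) f i p -
                     \int[mu]_(p in state_space) f i p| < eta) ->
        `|F nu - F mu| < eps].

(* Convergence in distribution of random locally finite measures, with respect
   to the vague topology. *)
Definition cvg_vaguely_in_distribution
    d (Omega : measurableType d) (P : probability Omega R)
    (X : R -> Omega -> measureT)
    d' (Omega' : measurableType d') (P' : probability Omega' R)
    (Y : Omega' -> measureT) :=
  forall F : measureT -> R, vaguely_continuous F ->
  (exists C : R, forall mu, locally_finite mu -> `|F mu| <= C) ->
  ('E_P[fun w => F (X L w)])%E @[L --> +oo] --> ('E_P'[fun w => F (Y w)])%E.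

(* The measure dx (x) e^{-y} dy, which does not charge y = +oo. *)
Definition intensity (B : set T) : \bar R :=
  (\int[lebesgue_measure \x lebesgue_measure]_(p in
      [set p : R * R | (0 <= p.1 <= 1)%R /\ B (p.1, p.2%:E)])
    (expR (- p.2))%:E)%E.

(* The probability mass function is written out because [poisson_pmf] is [1]
   at rate [0]. *)
Definition poisson_point_process d (Omega : measurableType d)
    (P : probability Omega R) (X : Omega -> measureT) :=
  [/\ forall w, locally_finite (X w),
      forall B, measurable B -> B `<=` state_space ->
        measurable_fun setT (fun w => X w B) &
      forall (n : nat) (B : 'I_n -> set T) (m : 'I_n -> nat),
        (forall i, [/\ measurable (B i), B i `<=` state_space &
                       (intensity (B i) < +oo)%E]) ->
        trivIset setT B ->
        P [set w | forall i, X w (B i) = (m i)%:R%:E] =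
        (\prod_i (let lam := fine (intensity (B i)) in
                  expR (- lam) * lam ^+ m i / (m i)`!%:R))%:E].

End vague_convergence.

(* Main.v *)
(* Replace the points of [Z] in [[0, L]] by a grid of mesh [h], with [L / h] a
   power of [L] slightly larger than [L]. A cell hit by [Z] and followed by an empty
   interval of length [r] is a difference of two gap events. Choosing [r] with
   [- G' r = u / L] makes the expected number of such cells tend to [u], and the
   bound on [G''] makes the grid see exactly the gaps of [Psi], up to an event of
   small probability.

   The generating function of the joint counts is expanded by the Bonferroni
   inequalities into elementary symmetric polynomials in the indicators. By absence
   of clustering only well separated families of cells matter, and for those the
   splitting hypothesis replaces the probability of an intersection by the product
   of the probabilities. Hence the generating function converges to that of
   independent Poisson variables, and the laws of the counts converge.

   It remains to pass from counts to vaguely continuous functionals. On measures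
   whose counts in all dyadic cells (dyadic in the coordinates [x] and
   [contract y]) are integers bounded level by level, a vaguely continuous
   functional is determined up to [eps] by the counts of a single level: otherwise,
   listing representatives of the cells by decreasing height and taking limits along
   an ultrafilter yields a point measure at which the functional is not continuous.
   Both processes satisfy such bounds with probability close to [1]. *)

Require Import Defs.
From mathcomp Require Import finmap.
From mathcomp Require Import all_boot all_order all_algebra.
From mathcomp Require Import all_classical all_reals all_analysis.
From mathcomp Require Import measurable_realfun.
From mathcomp Require Import ring lra zify.
Set Implicit Arguments.
Unset Strict Implicit.
Unset Printing Implicit Defensive.
Import Order.TTheory GRing.Theory Num.Theory.
Import numFieldNormedType.Exports.
Local Open Scope classical_set_scope.
Local Open Scope ring_scope.

(** * Elementary symmetric polynomials and Bonferroni inequalities *)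

(** Splitting only speaks of gap events, and a hit cell is far rarer (about u / T for T cells) than
    the two gap events whose difference it is (about 1 / L, up to L ^ o(1)). The splitting error is
    therefore measured against powers of T * G, which is bounded only by a small power of L, and it
    has to be paid for by the rate L ^ (- delta'). For this reason the mesh exponent is chosen after
    the number K of Bonferroni terms and after delta'. Near pairs of cells are the second obstacle.
    The event that two near cells are both hit is rare, but the truncated Bonferroni sums are
    unbounded on it. They are dominated there by moments of the number of gap events, which grow
    like a power of L kept below the decay of that event. In the last step, continuity is only given
    at each locally finite measure through finitely many test functions. No metric on measures is
    used; one ultrafilter supplies the limits of all atoms at once. *)

Section elementary_symmetric.
Context {R : realFieldType} {I : finType}.
Implicit Types (Y a : I -> R) (A B : {set I}).

Definition elem_sym Y B m : R :=
  \sum_(A : {set I} | (A \subset B) && (#|A| == m)) \prod_(i in A) Y i.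

Lemma elem_sym0 Y B : elem_sym Y B 0 = 1.
Proof.
rewrite /elem_sym (big_pred1 finset.set0) ?big_set0// => A /=.
by rewrite cards_eq0; case: eqP => [->|]; rewrite ?finset.sub0set ?andbT ?andbF.
Qed.

(** Splits the index sets by membership of [x]. The bounds below are inductions along this
    recursion. *)
Lemma elem_symU1 Y x B m : x \notin B ->
  elem_sym Y (x |: B) m.+1 = elem_sym Y B m.+1 + Y x * elem_sym Y B m.
Proof.
move=> xB; rewrite /elem_sym (bigID (fun A : {set I} => x \in A)) /= addrC.
congr (_ + _).
  apply: eq_bigl => A; apply/idP/idP.
    move=> /andP[/andP[AB ->] xA]; rewrite andbT.
    apply/fintype.subsetP => y yA; move/fintype.subsetP : AB => /(_ y yA).
    by rewrite !inE => /orP[/eqP yx|//]; rewrite yx in yA; rewrite yA in xA.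
  move=> /andP[AB ->]; rewrite (fintype.subset_trans AB (finset.subsetUr _ _)) /=.
  by apply: contra xB => /(fintype.subsetP AB).
rewrite big_distrr /=.
rewrite (reindex_onto (fun A => x |: A) (fun A => A :\ x)) /=; last first.
  by move=> A /andP[_ xA]; rewrite finset.setD1K.
apply: eq_big => [A|A].
  apply/idP/idP.
    move=> /andP[/andP[/andP[AB cA] _] /eqP e].
    have xA : x \notin A by rewrite -e !inE eqxx.
    move: cA; rewrite cardsU1 xA add1n eqSS => ->; rewrite andbT.
    apply/fintype.subsetP => y yA; move/fintype.subsetP : AB => /(_ y).
    rewrite !inE yA orbT => /(_ isT) /orP[/eqP yx|//].
    by rewrite yx in yA; rewrite yA in xA.
  move=> /andP[AB cA].
  have xA : x \notin A by apply: contra xB => /(fintype.subsetP AB).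
  by rewrite finset.setUS// cardsU1 xA add1n eqSS cA finset.setU11 finset.setU1K ?eqxx.
move=> /andP[/andP[/andP[AB cA] _] /eqP e].
have xA : x \notin A by rewrite -e !inE eqxx.
by rewrite big_setU1.
Qed.

Lemma elem_sym_set0 Y m : elem_sym Y finset.set0 m.+1 = 0.
Proof.
rewrite /elem_sym big_pred0// => A; rewrite finset.subset0.
by case: eqP => [->|//]; rewrite cards0.
Qed.

Lemma finset_ind (Q : {set I} -> Prop) : Q finset.set0 ->
  (forall x B, x \notin B -> Q B -> Q (x |: B)) -> forall B, Q B.
Proof.
move=> Q0 QS B; have [n] := ubnP #|B|; elim: n B => // n ih B.
have [->//|[x xB]] := finset.set_0Vmem B.
rewrite (cardsD1 x) xB add1n !ltnS => Bn; rewrite -(finset.setD1K xB).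
by apply: QS; [rewrite !inE eqxx|exact: ih].
Qed.

(* The induction goes through because the remainder [r K B] satisfies the same
   recursion as [elem_sym Y B K]. *)
Lemma bonferroni Y B K : (forall i, 0 <= Y i <= 1) ->
  0 <= (-1) ^+ K * (\prod_(i in B) (1 - Y i) -
                    \sum_(m < K) (-1) ^+ m * elem_sym Y B m) <= elem_sym Y B K.
Proof.
move=> Y01; elim/finset_ind: B K => [|x B xB ih] [|K].
- by rewrite big_set0 big_ord0 elem_sym0 expr0 mul1r subr0 lexx ler01.
- rewrite big_set0 big_ord_recl /= elem_sym0 expr0 mul1r big1 ?addr0 ?subrr ?mulr0.
    by rewrite elem_sym_set0 lexx.
  by move=> i _; rewrite elem_sym_set0 mulr0.
- rewrite expr0 mul1r big_ord0 subr0 elem_sym0; apply/andP; split.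
    by apply: prodr_ge0 => i _; rewrite subr_ge0; case/andP: (Y01 i).
  apply: prodr_ile1 => i _; case/andP: (Y01 i) => *.
  by rewrite subr_ge0 gerBl; apply/andP.
have /andP[Yx0 Yx1] := Y01 x.
rewrite elem_symU1// big_setU1//= big_ord_recl /= elem_sym0.
under [\sum_(i < K) _]eq_bigr do rewrite /bump leq0n add1n elem_symU1// mulrDr exprS.
rewrite big_split /=.
have := ih K.+1; rewrite big_ord_recl /= elem_sym0.
under [\sum_(i < K) _]eq_bigr do rewrite /bump leq0n add1n exprS.
have := ih K.
have -> : \sum_(i < K) -1 * (-1) ^+ i * (Y x * elem_sym Y B i) =
    - (Y x * \sum_(i < K) (-1) ^+ i * elem_sym Y B i).
  rewrite mulr_sumr -sumrN; apply: eq_bigr => i _.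
  by rewrite mulN1r mulNr mulrCA.
set S := \sum_(i < K) _; set S' := \sum_(i < K) _; set p := \prod_(i in B) _.
set e := elem_sym _ _ _; set e' := elem_sym _ _ _; rewrite exprS expr0.
move=> /andP[h1 h2] /andP[h3 h4].
set s := (-1) ^+ K in h1 h2 h3 h4 *.
have -> : -1 * s * ((1 - Y x) * p - (1 * 1 + (S' - Y x * S))) =
  -1 * s * (p - (1 * 1 + S')) + Y x * (s * (p - S)) by ring.
by apply/andP; split; [rewrite addr_ge0// mulr_ge0|rewrite lerD// ler_wpM2l].
Qed.

(** The expansion of the power contains each product over an m-set m! times, and all its other terms
    are nonnegative. The induction keeps only the first two binomial terms. *)
Lemma elem_sym_le_sum_pow Y B m : (forall i, 0 <= Y i) ->
  elem_sym Y B m <= (\sum_(i in B) Y i) ^+ m / m`!%:R.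
Proof.
move=> Y0; elim/finset_ind: B m => [|x B xB ih] [|m].
- by rewrite elem_sym0 expr0 fact0 invr1 mul1r.
- by rewrite elem_sym_set0 big_set0 expr0n /= mul0r.
- by rewrite elem_sym0 expr0 fact0 invr1 mul1r.
rewrite elem_symU1// big_setU1//=.
set S := \sum_(i in B) Y i.
have S0 : 0 <= S by apply: sumr_ge0.
have f0 : 0 < m`!%:R :> R by rewrite ltr0n fact_gt0.
have f1 : 0 < m.+1%:R :> R by rewrite ltr0n.
apply: (@le_trans _ _ (S ^+ m.+1 / m.+1`!%:R + Y x * (S ^+ m / m`!%:R))).
  by rewrite lerD// ler_wpM2l.
have -> : S ^+ m.+1 / m.+1`!%:R + Y x * (S ^+ m / m`!%:R) =
   (S ^+ m.+1 + Y x * S ^+ m *+ m.+1) / m.+1`!%:R.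
  rewrite factS natrM -[_ *+ m.+1]mulr_natr; field.
  by rewrite !gt_eqF//= -natr1 addrC natr1 gt_eqF.
rewrite ler_pM2r ?invr_gt0 ?ltr0n ?fact_gt0//.
rewrite addrC exprDn big_ord_recl big_ord_recl /= !subn0 ?lift0 /= expr0 mulr1.
rewrite bin0 mulr1n subSS subn0 expr1 bin1 [S ^+ m * _]mulrC.
rewrite addrA lerDl.
by apply: sumr_ge0 => i _; rewrite mulrn_wge0// mulr_ge0// exprn_ge0.
Qed.

End elementary_symmetric.

(** * Expectations of bounded measurable functions *)

Section expectation_of_bounded_functions.
Context d (Om : measurableType d) {R : realType} (P : probability Om R).
Implicit Types (f g : Om -> R) (A B : set Om).

(** Bounded functions are integrable for a probability, and the class is stable under the sums,
    products and powers used below, so that integrability never has to be checked separately. *)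
Definition bmeas f := measurable_fun setT f /\ exists M, forall w, `|f w| <= M.

Definition Ex f : R := \int[P]_w f w.

Lemma bmeas_integrable f : bmeas f -> P.-integrable setT (EFin \o f).
Proof.
move=> [mf [M fM]]; apply: measurable_bounded_integrable => //.
  exact: fin_num_fun_lty.
exists M; split; first by rewrite num_real.
by move=> x Mx y _ /=; rewrite (le_trans (fM y))// ltW.
Qed.

Lemma bmeas_cst (c : R) : bmeas (fun=> c).
Proof. by split; [exact: measurable_cst|exists `|c|]. Qed.

Lemma bmeasD f g : bmeas f -> bmeas g -> bmeas (fun w => f w + g w).
Proof.
move=> [mf [M fM]] [mg [N gN]]; split; first exact: measurable_funD.
by exists (M + N) => w; rewrite (le_trans (ler_normD _ _))// lerD.
Qed.

Lemma bmeasM f g : bmeas f -> bmeas g -> bmeas (fun w => f w * g w).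
Proof.
move=> [mf [M fM]] [mg [N gN]]; split; first exact: measurable_funM.
by exists (M * N) => w; rewrite normrM ler_pM.
Qed.

Lemma bmeasZ (c : R) f : bmeas f -> bmeas (fun w => c * f w).
Proof. by move=> bf; apply: bmeasM => //; exact: bmeas_cst. Qed.

Lemma bmeasN f : bmeas f -> bmeas (fun w => - f w).
Proof.
move=> /(@bmeasZ (-1)) [m [M fM]]; split; last first.
  by exists M => w; rewrite -mulN1r.
by apply: eq_measurable_fun m => w _; rewrite mulN1r.
Qed.

Lemma bmeasB f g : bmeas f -> bmeas g -> bmeas (fun w => f w - g w).
Proof. by move=> bf bg; apply: bmeasD => //; exact: bmeasN. Qed.

Lemma bmeas_sum (I : Type) (s : seq I) (p : pred I) (F : I -> Om -> R) :
  (forall i, p i -> bmeas (F i)) -> bmeas (fun w => \sum_(i <- s | p i) F i w).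
Proof.
move=> bF; elim: s => [|x s ih].
  by under eq_fun do rewrite big_nil; exact: bmeas_cst.
under eq_fun do rewrite big_cons.
by have [px|//] := boolP (p x); apply: bmeasD => //; exact: bF.
Qed.

Lemma bmeas_prod (I : Type) (s : seq I) (p : pred I) (F : I -> Om -> R) :
  (forall i, p i -> bmeas (F i)) -> bmeas (fun w => \prod_(i <- s | p i) F i w).
Proof.
move=> bF; elim: s => [|x s ih].
  by under eq_fun do rewrite big_nil; exact: bmeas_cst.
under eq_fun do rewrite big_cons.
by have [px|//] := boolP (p x); apply: bmeasM => //; exact: bF.
Qed.

Lemma bmeasX f n : bmeas f -> bmeas (fun w => f w ^+ n).
Proof.
move=> bf; elim: n => [|n ih]; first exact: bmeas_cst.
by under eq_fun do rewrite exprS; exact: bmeasM.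
Qed.

Lemma bmeas_indic A : measurable A -> bmeas (\1_A).
Proof.
move=> mA; split; first exact: measurable_indic.
by exists 1 => w; rewrite indicE; case: (_ \in _); rewrite ?normr0 ?normr1.
Qed.

Lemma Ex_cst (c : R) : Ex (fun=> c) = c.
Proof. by rewrite /Ex Rintegral_cst// [X in fine X](@probability_setT _ _ _ P) mulr1. Qed.

Lemma ExD f g : bmeas f -> bmeas g -> Ex (fun w => f w + g w) = Ex f + Ex g.
Proof. by move=> /bmeas_integrable ? /bmeas_integrable ?; exact: RintegralD. Qed.

Lemma ExB f g : bmeas f -> bmeas g -> Ex (fun w => f w - g w) = Ex f - Ex g.
Proof. by move=> /bmeas_integrable ? /bmeas_integrable ?; exact: RintegralB. Qed.

Lemma ExZ (c : R) f : bmeas f -> Ex (fun w => c * f w) = c * Ex f.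
Proof. by move=> /bmeas_integrable ?; exact: RintegralZl. Qed.

Lemma Ex_sum (I : Type) (s : seq I) (p : pred I) (F : I -> Om -> R) :
  (forall i, p i -> bmeas (F i)) ->
  Ex (fun w => \sum_(i <- s | p i) F i w) = \sum_(i <- s | p i) Ex (F i).
Proof.
move=> bF; elim: s => [|x s ih].
  by under eq_fun do rewrite big_nil; rewrite big_nil Ex_cst.
under eq_fun do rewrite big_cons.
rewrite big_cons; have [px|//] := boolP (p x).
by rewrite ExD ?ih//; [exact: bF|exact: bmeas_sum].
Qed.

Lemma le_Ex f g : bmeas f -> bmeas g -> (forall w, f w <= g w) -> Ex f <= Ex g.
Proof.
move=> /bmeas_integrable bf /bmeas_integrable bg fg.
by apply: le_Rintegral => // w _.
Qed.

Lemma Ex_ge0 f : (forall w, 0 <= f w) -> 0 <= Ex f.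
Proof. by move=> f0; apply: Rintegral_ge0. Qed.

Lemma Ex_norm f : bmeas f -> `|Ex f| <= Ex (fun w => `|f w|).
Proof. by move=> /bmeas_integrable bf; exact: le_normr_Rintegral. Qed.

Lemma bmeas_norm f : bmeas f -> bmeas (fun w => `|f w|).
Proof.
move=> [mf [M fM]]; split; first exact: measurableT_comp.
by exists M => w; rewrite normr_id.
Qed.

Lemma Ex_indic A : measurable A -> Ex (\1_A) = pr P A.
Proof. by move=> mA; rewrite /Ex /Rintegral integral_indic// setIT. Qed.

Lemma pr_ge0 A : 0 <= pr P A.
Proof. by rewrite /pr fine_ge0. Qed.

Lemma prE A : measurable A -> P A = (pr P A)%:E.
Proof. by move=> mA; rewrite /pr fineK// fin_num_measure. Qed.

Lemma pr_le A B : measurable A -> measurable B -> A `<=` B -> pr P A <= pr P B.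
Proof.
move=> mA mB AB; rewrite -lee_fin -!prE//.
by apply: le_measure => //; rewrite inE.
Qed.

Lemma pr_le1 A : measurable A -> pr P A <= 1.
Proof. by move=> mA; rewrite -lee_fin -prE// probability_le1. Qed.

Lemma pr_setC A : measurable A -> pr P (~` A) = 1 - pr P A.
Proof.
move=> mA; apply: EFin_inj; rewrite EFinB -!prE//; last exact: measurableC.
by rewrite probability_setC.
Qed.

Lemma pr_setD A B : measurable A -> measurable B -> B `<=` A ->
  pr P (A `\` B) = pr P A - pr P B.
Proof.
move=> mA mB BA; rewrite -!Ex_indic//; last exact: measurableD.
rewrite -ExB; [|exact: bmeas_indic..].
congr Ex; apply/funext => w; rewrite !indicE in_setD.
have [wB|wB] := boolP (w \in B); last by rewrite andbT subr0.
by rewrite andbF (_ : w \in A) ?subrr//; rewrite !inE in wB *; exact: BA.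
Qed.

Lemma pr_setU A B : measurable A -> measurable B ->
  pr P (A `|` B) <= pr P A + pr P B.
Proof.
move=> mA mB; rewrite -lee_fin EFinD -!prE//; last exact: measurableU.
exact: measureU2.
Qed.

Lemma pr_bigcup (I : choiceType) (s : seq I) (F : I -> set Om) :
  (forall i, measurable (F i)) ->
  measurable (\big[setU/set0]_(i <- s) F i) /\
  pr P (\big[setU/set0]_(i <- s) F i) <= \sum_(i <- s) pr P (F i).
Proof.
move=> mF; elim: s => [|x s [ms ih]]; first by rewrite !big_nil /pr measure0.
rewrite !big_cons; split; first exact: measurableU.
by rewrite (le_trans (pr_setU _ _))// lerD2l.
Qed.

End expectation_of_bounded_functions.

(** * Separated families of events *)

Section separated_comparison.
Context d (Om : measurableType d) {R : realType} (P : probability Om R).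
Context {I : finType} (near : rel I).
Implicit Types A : {set I}.
Hypotheses (near_refl : reflexive near) (near_sym : symmetric near).

Definition sepset (A : {set I}) :=
  [forall x in A, forall y in A, (x != y) ==> ~~ near x y].

Lemma sepsetP A : reflect
  (forall x y, x \in A -> y \in A -> x != y -> ~~ near x y) (sepset A).
Proof.
apply: (iffP forall_inP) => [h x y xA yA xy|h x xA].
  by have /forall_inP/(_ _ yA)/implyP := h _ xA; exact.
by apply/forall_inP => y yA; apply/implyP; exact: h.
Qed.

Lemma sepsetU1 x A : sepset A -> (forall y, y \in A -> ~~ near y x) ->
  sepset (x |: A).
Proof.
move=> /sepsetP sA xA; apply/sepsetP => y z; rewrite !inE.
move=> /orP[/eqP->|yA] /orP[/eqP->|zA]; first by rewrite eqxx.
- by move=> _; rewrite near_sym; exact: xA.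
- by move=> _; exact: xA.
- exact: sA.
Qed.

Variables (W : nat) (Gev : I -> set Om) (Y : I -> Om -> R) (a : I -> R).
Hypothesis near_card : forall x, (#|[set y | near x y]%SET| <= W)%N.
Hypothesis mG : forall i, measurable (Gev i).

Let N w : R := \sum_i \1_(Gev i) w.

Let bN : bmeas N.
Proof. by apply: bmeas_sum => i _; exact: bmeas_indic. Qed.

Let N_ge0 w : 0 <= N w.
Proof. by apply: sumr_ge0 => i _; rewrite indicE. Qed.

Let ind_ge0 (A : {set I}) w : 0 <= \prod_(i in A) \1_(Gev i) w :> R.
Proof. by apply: prodr_ge0 => i _; rewrite indicE. Qed.

Let bind (A : {set I}) : bmeas (fun w => \prod_(i in A) \1_(Gev i) w : R).
Proof. by apply: bmeas_prod => i _; exact: bmeas_indic. Qed.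

(* An index close to [A] costs only the number [W * #|A|] of such indices; any
   other index extends [A] to a larger separated set. *)
Lemma separated_moment (k : nat) (g : R) : 0 <= g ->
  (forall A, sepset A -> (#|A| <= k)%N ->
     Ex P (fun w => \prod_(i in A) \1_(Gev i) w) <= 2 * g ^+ #|A|) ->
  forall p A, sepset A -> (#|A| + p <= k)%N ->
  Ex P (fun w => (\prod_(i in A) \1_(Gev i) w) * N w ^+ p) <=
    2 * (#|I|%:R * g + (k * W)%:R) ^+ p * g ^+ #|A|.
Proof.
move=> g0 hA; elim=> [|p ih] A sA Ap.
  under eq_fun do rewrite expr0 mulr1.
  by rewrite expr0 mulr1 hA// -[#|A|]addn0.
set M := _ + (k * W)%:R.
have M0 : 0 <= M by rewrite addr_ge0// mulr_ge0.
have -> : (fun w => (\prod_(i in A) \1_(Gev i) w) * N w ^+ p.+1 : R) =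
   (fun w => \sum_i (\1_(Gev i) w * ((\prod_(j in A) \1_(Gev j) w) * N w ^+ p))).
  by apply/funext => w; rewrite exprS mulrCA /N mulr_suml.
have bF i : bmeas (fun w => \1_(Gev i) w *
    ((\prod_(j in A) \1_(Gev j) w) * N w ^+ p) : R).
  by apply: bmeasM; [exact: bmeas_indic|apply: bmeasM => //; exact: bmeasX].
rewrite Ex_sum => [|i _]; last exact: bF.
have Ap' : (#|A| + p <= k)%N by rewrite (leq_trans _ Ap)// leq_add2l.
pose close := [set i | [exists j in A, near j i]]%SET.
rewrite (bigID (mem close))/=.
have -> : 2 * M ^+ p.+1 * g ^+ #|A| =
    (k * W)%:R * (2 * M ^+ p * g ^+ #|A|) +
    #|I|%:R * (2 * M ^+ p * g ^+ #|A|.+1).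
  by rewrite !exprS {1}/M; ring.
apply: lerD.
  apply: (@le_trans _ _ (\sum_(i in close) (2 * M ^+ p * g ^+ #|A|))).
    apply: ler_sum => i _; apply: le_trans (ih A sA Ap').
    apply: le_Ex => //; first by apply: bmeasM => //; exact: bmeasX.
    move=> w; apply: ler_piMl; first by rewrite mulr_ge0// exprn_ge0.
    by rewrite indicE; case: (_ \in _).
  rewrite sumr_const -[_ *+ _]mulr_natl.
  rewrite ler_wpM2r ?mulr_ge0 ?exprn_ge0// ler_nat.
  have sub : close \subset (\bigcup_(j in A) [set i | near j i])%SET.
    apply/fintype.subsetP => i; rewrite inE => /exists_inP[j jA ji].
    by apply/finset.bigcupP; exists j => //; rewrite inE.
  apply: (leq_trans (subset_leq_card sub)).
  apply: (@leq_trans (\sum_(j in A) #|[set i | near j i]%SET|)).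
    elim/big_ind2 : _ => [|x1 x2 y1 y2 h1 h2|//]; first by rewrite cards0.
    by rewrite (leq_trans (leq_card_setU _ _))// leq_add.
  apply: (@leq_trans (\sum_(j in A) W)); first by apply: leq_sum => j _.
  by rewrite sum_nat_const leq_mul// (leq_trans _ Ap')// leq_addr.
apply: (@le_trans _ _ (\sum_(i | i \notin close) (2 * M ^+ p * g ^+ #|A|.+1))).
  apply: ler_sum => i ic.
  have ci j : j \in A -> ~~ near j i.
    by move=> jA; apply: contra ic => ji; rewrite inE; apply/exists_inP; exists j.
  have iA : i \notin A by apply/negP => /ci; rewrite near_refl.
  have sA' : sepset (i |: A) by apply: sepsetU1.
  have cA' : #|i |: A| = #|A|.+1 by rewrite cardsU1 iA.
  have := ih _ sA'; rewrite cA' addSnnS => /(_ Ap).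
  by under eq_fun do rewrite big_setU1//= -mulrA.
rewrite sumr_const -[_ *+ _]mulr_natl.
rewrite ler_wpM2r ?mulr_ge0 ?exprn_ge0// ler_nat.
exact: max_card.
Qed.

Hypothesis bY : forall i, bmeas (Y i).
Hypothesis Y01 : forall i w, 0 <= Y i w <= \1_(Gev i) w.

(** The part of the elementary symmetric polynomial whose terms the splitting hypothesis can
    evaluate. *)
Definition sepsum (y : I -> R) m : R :=
  \sum_(A : {set I} | sepset A && (#|A| == m)) \prod_(i in A) y i.

Let elem_symTE (y : I -> R) m : elem_sym y finset.setT m =
  \sum_(A : {set I} | #|A| == m) \prod_(i in A) y i.
Proof. by apply: eq_bigl => A; rewrite finset.subsetT. Qed.

Lemma sepsum_le (y : I -> R) m : (forall i, 0 <= y i) ->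
  sepsum y m <= elem_sym y finset.setT m.
Proof.
move=> y0; rewrite elem_symTE [leRHS](bigID sepset)/= /sepsum.
under eq_bigl do rewrite andbC.
by rewrite lerDl sumr_ge0// => A _; exact: prodr_ge0.
Qed.

Lemma card_draws_le m : (#|[set A : {set I} | #|A| == m]%SET| <= #|I| ^ m)%N.
Proof.
rewrite card_draws; elim: m #|I| => [|m ih] n; first by rewrite bin0.
case: n => [|n]; first by rewrite bin0n.
rewrite -(leq_pmul2l (ltn0Sn m)) -mul_bin_diag /= expnS mulnCA leq_mul2l/=.
rewrite (leq_trans (ih n))//.
apply: (@leq_trans (n.+1 ^ m)); last exact: leq_pmull.
by case: m {ih} => // m; rewrite leq_exp2r.
Qed.

(** A set of size m that is not separated contains one of at most #|I| * W near pairs, and its m - 2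
    other elements can be chosen in at most #|I| ^ (m - 2) ways. The product of these numbers is W /
    #|I| times #|I| ^ m. *)
Lemma elem_sym_sub_sepsum (alpha : R) m : (0 < #|I|)%N ->
  (forall i, 0 <= a i <= alpha) ->
  elem_sym a finset.setT m - sepsum a m <=
    (W%:R / #|I|%:R) * (#|I|%:R * alpha) ^+ m.
Proof.
move=> I0 a01; have a0 i : 0 <= a i by case/andP: (a01 i).
have /card_gt0P[i0 _] := I0.
have al0 : 0 <= alpha by case/andP: (a01 i0) => /le_trans h /h.
rewrite elem_symTE (bigID sepset)/= /sepsum.
under [X in _ - X]eq_bigl do rewrite andbC.
rewrite addrAC subrr add0r.
pose B := [set A : {set I} | (#|A| == m) && ~~ sepset A]%SET.
apply: (@le_trans _ _ (\sum_(A in B) alpha ^+ m)).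
  rewrite (eq_bigl (fun A => A \in B)); last by move=> A; rewrite inE.
  apply: ler_sum => A; rewrite inE => /andP[/eqP <- _].
  rewrite -prodr_const; apply: ler_prod => i _; exact: a01.
rewrite sumr_const -[_ *+ _]mulr_natl exprMn mulrA.
apply: ler_wpM2r; first exact: exprn_ge0.
have n0 : 0 < #|I|%:R :> R by rewrite ltr0n.
(* Sets with at most one element are separated, so nothing is lost for m = 0 and m = 1. *)
case: m => [|[|m]] in B *.
- rewrite (_ : B = finset.set0) ?cards0; last first.
    apply/setP => A; rewrite !inE; apply/negP => /andP[].
    by rewrite cards_eq0 => /eqP -> /sepsetP[] x y; rewrite inE.
  by rewrite expr0 mulr1 divr_ge0.
- rewrite (_ : B = finset.set0) ?cards0; last first.
    apply/setP => A; rewrite !inE; apply/negP => /andP[].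
    move=> /cards1P[z ->] /sepsetP[] x y; rewrite !inE => /eqP -> /eqP ->.
    by rewrite eqxx.
  by rewrite expr1 divfK ?gt_eqF.
have -> : W%:R / #|I|%:R * #|I|%:R ^+ m.+2 = W%:R * (#|I|%:R * #|I|%:R ^+ m) :> R.
  by rewrite !exprS; field; rewrite gt_eqF.
rewrite -!natrX -!natrM ler_nat.
(* The size is now m.+2: a near pair and a set of m further elements, from which [f] rebuilds the
   whole set. *)
pose Q := [set q : (I * I) * {set I} |
  (q.1.2 \in [set y | near q.1.1 y]%SET) && (#|q.2| == m)]%SET.
pose f (q : (I * I) * {set I}) := q.1.1 |: (q.1.2 |: q.2).
have BQ : B \subset (f @: Q).
  apply/fintype.subsetP => A; rewrite inE => /andP[/eqP cA /forall_inPn[x xA]].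
  move=> /forall_inPn[y yA]; rewrite negb_imply negbK => /andP[xy nxy].
  apply/imsetP; exists ((x, y), (A :\ x) :\ y); last first.
    by rewrite /f /= finset.setD1K ?finset.setD1K// !inE eq_sym xy.
  rewrite !inE /= nxy /=; have := cardsD1 x A; rewrite cA xA add1n => -[].
  have yAx : y \in A :\ x by rewrite !inE eq_sym xy.
  by rewrite (cardsD1 y) yAx add1n => -[->].
apply: (leq_trans (subset_leq_card BQ)).
apply: (leq_trans (leq_imset_card _ _)).
have -> : #|Q| = (#|[set p : I * I | near p.1 p.2]%SET| *
                  #|[set A : {set I} | #|A| == m]%SET|)%N.
  rewrite -cardsX; apply: eq_card => -[[x y] A].
  by rewrite !inE /=.
rewrite mulnA leq_mul ?card_draws_le//.
have -> : #|[set p : I * I | near p.1 p.2]%SET| =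
    \sum_x #|[set y | near x y]%SET|.
  rewrite -sum1_card (eq_bigl (fun p : I * I => near p.1 p.2)); last first.
    by move=> p; rewrite inE.
  rewrite -(pair_big_dep predT (fun x y => near x y) (fun _ _ => 1%N))/=.
  by apply: eq_bigr => x _; rewrite -sum1_card; apply: eq_bigl => y; rewrite inE.
rewrite mulnC -sum_nat_const; exact: leq_sum.
Qed.

End separated_comparison.

Section separated_comparison_bound.
Context d (Om : measurableType d) {R : realType} (P : probability Om R).
Context {I : finType} (near : rel I).
Hypotheses (near_refl : reflexive near) (near_sym : symmetric near).
Variables (W : nat) (Gev : I -> set Om) (Y : I -> Om -> R) (a : I -> R).
Hypothesis near_card : forall x, (#|[set y | near x y]%SET| <= W)%N.
Hypothesis mG : forall i, measurable (Gev i).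
Hypothesis bY : forall i, bmeas (Y i).
Hypothesis Y01 : forall i w, 0 <= Y i w <= \1_(Gev i) w.
Implicit Types A : {set I}.

Let Y0 i w : 0 <= Y i w.
Proof. by case/andP: (Y01 i w). Qed.

Let Y1 i w : 0 <= Y i w <= 1.
Proof. by case/andP: (Y01 i w) => -> /le_trans ->. Qed.

Let N w : R := \sum_i \1_(Gev i) w.

Let N_ge0 w : 0 <= N w.
Proof. by apply: sumr_ge0 => i _; rewrite indicE. Qed.

Let bN : bmeas N.
Proof. by apply: bmeas_sum => i _; exact: bmeas_indic. Qed.

Let S m w := sepsum near (Y ^~ w) m.

Let bprodY A : bmeas (fun w => \prod_(i in A) Y i w).
Proof. by apply: bmeas_prod. Qed.

Let bS m : bmeas (S m).
Proof. by apply: bmeas_sum. Qed.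

Let S_ge0 m w : 0 <= S m w.
Proof. by apply: sumr_ge0 => A _; apply: prodr_ge0. Qed.

Let sepsum_pow m w : S m w <= N w ^+ m.
Proof.
apply: le_trans (sepsum_le _ _ _) _ => //.
apply: le_trans (elem_sym_le_sum_pow _ _ _) _ => //.
apply: (@le_trans _ _ ((\sum_(i in [set: I]%SET) Y i w) ^+ m)).
  rewrite ler_pdivrMr ?ltr0n ?fact_gt0// ler_peMr ?exprn_ge0 ?sumr_ge0//.
  by rewrite ler1n fact_gt0.
rewrite lerXn2r ?nnegrE ?sumr_ge0//.
rewrite (eq_bigl predT) => [|i]; last by rewrite finset.in_setT.
by apply: ler_sum => i _; case/andP: (Y01 i w).
Qed.

(** A weak form of the inequality between geometric and arithmetic means. Multiplied by the
    indicator of [bad], it bounds a moment on a rare event by b times the probability of the event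
    plus a full moment divided by b, in place of the Cauchy-Schwarz inequality. *)
Let pow_split (b x : R) m : 0 < b -> 0 <= x -> x ^+ m <= b + x ^+ (m + m) / b.
Proof.
move=> b0 x0; have xm : 0 <= x ^+ m by rewrite exprn_ge0.
rewrite exprD -[leLHS]mul1r -lerBlDl -subr_ge0.
have -> : x ^+ m * x ^+ m / b - (1 * x ^+ m - b) =
   ((x ^+ m - b) ^+ 2 + b * x ^+ m) / b.
  by field; rewrite gt_eqF.
apply: divr_ge0; last exact: ltW.
by rewrite addr_ge0 ?sqr_ge0// mulr_ge0// ltW.
Qed.

Variables (bad : set Om).
Hypothesis mbad : measurable bad.
Hypothesis badE : forall w i j, ~ bad w -> i != j -> near i j -> Y i w * Y j w = 0.

(** A set that is not separated contains a near pair, and off [bad] the product of the two factors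
    vanishes. *)
Let elem_sym_sepsum m w : ~ bad w -> elem_sym (Y ^~ w) finset.setT m = S m w.
Proof.
move=> bw; rewrite /elem_sym /S /sepsum (bigID (sepset near))/=.
rewrite [X in _ + X]big1 ?addr0.
  by apply: eq_bigl => A; rewrite finset.subsetT andbC.
move=> A /andP[_ /forall_inPn[i iA]].
move=> /forall_inPn[j jA]; rewrite negb_imply negbK => /andP[ij nij].
rewrite (bigD1 i)//= (bigD1 j)/=; last by rewrite jA eq_sym.
by rewrite mulrA badE// mul0r.
Qed.

Variables (K : nat) (r1 g alpha C beta b : R).
Hypothesis I0 : (0 < #|I|)%N.
Hypothesis g0 : 0 <= g.
Hypothesis b0 : 0 < b.
Hypothesis r10 : 0 <= r1.
Hypothesis H1 : forall A, sepset near A -> (#|A| <= K)%N ->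
  `|Ex P (fun w => \prod_(i in A) Y i w) - \prod_(i in A) a i| <= r1 * g ^+ #|A|.
Hypothesis H2 : forall A, sepset near A -> (#|A| <= K + K)%N ->
  Ex P (fun w => \prod_(i in A) \1_(Gev i) w) <= 2 * g ^+ #|A|.
Hypothesis a01 : forall i, 0 <= a i <= alpha.
Hypothesis alpha1 : alpha <= 1.
Hypothesis aC : #|I|%:R * alpha <= C.
Hypothesis C1 : 1 <= C.
Hypothesis pbad : pr P bad <= beta.

Let n0 : 0 < #|I|%:R :> R.
Proof. by rewrite ltr0n. Qed.

Let a0 i : 0 <= a i.
Proof. by case/andP: (a01 i). Qed.

Let a1 i : 0 <= a i <= 1.
Proof. by case/andP: (a01 i) => -> /le_trans ->. Qed.

Let sum_a : \sum_(i in [set: I]%SET) a i <= C.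
Proof.
apply: le_trans aC; rewrite (eq_bigl predT) => [|i]; last by rewrite finset.in_setT.
apply: (@le_trans _ _ (\sum_(i : I) alpha)).
  by apply: ler_sum => i _; case/andP: (a01 i).
by rewrite sumr_const mulr_natl.
Qed.

Let sum_a0 : 0 <= \sum_(i in [set: I]%SET) a i.
Proof. exact: sumr_ge0. Qed.

Let C0 : 0 <= C. Proof. exact: le_trans C1. Qed.

Let elem_sym_a : elem_sym a finset.setT K <= C ^+ K / K`!%:R.
Proof.
apply: le_trans (elem_sym_le_sum_pow _ _ _) _ => //.
by rewrite ler_pM2r ?invr_gt0 ?ltr0n ?fact_gt0// lerXn2r// ?nnegrE.
Qed.

Let M := #|I|%:R * g + ((K + K) * W)%:R.

Let M0 : 0 <= M.
Proof. by rewrite addr_ge0// mulr_ge0// ltW. Qed.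

Let Ex_S m : (m <= K)%N -> `|Ex P (S m) - sepsum near a m| <= (1 + #|I|%:R * g) ^+ K * r1.
Proof.
move=> mK; rewrite /S /sepsum Ex_sum// -sumrB.
apply: le_trans (ler_norm_sum _ _ _) _.
apply: (@le_trans _ _ (\sum_(A : {set I} | sepset near A && (#|A| == m)) (r1 * g ^+ m))).
  by apply: ler_sum => A /andP[sA /eqP cA]; rewrite -cA; apply: H1 => //; rewrite cA.
have r1g : 0 <= r1 * g ^+ m by rewrite mulr_ge0// exprn_ge0.
apply: (@le_trans _ _ (\sum_(A in [set A : {set I} | #|A| == m]%SET) (r1 * g ^+ m))).
  rewrite [leRHS](bigID (sepset near))/=.
  under [X in _ <= X + _]eq_bigl do rewrite inE andbC.
  by rewrite lerDl sumr_ge0.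
rewrite sumr_const -[leLHS]mulr_natl mulrCA mulrC ler_wpM2r//.
apply: (@le_trans _ _ ((#|I| ^ m)%:R * g ^+ m)).
  by rewrite ler_wpM2r ?exprn_ge0// ler_nat card_draws_le.
rewrite natrX -exprMn.
have ng0 : 0 <= #|I|%:R * g by rewrite mulr_ge0.
apply: (@le_trans _ _ ((1 + #|I|%:R * g) ^+ m)).
  by rewrite lerXn2r ?nnegrE ?addr_ge0// lerDr.
by rewrite ler_weXn2l// lerDl.
Qed.

Let sepsum_a m : (m <= K)%N ->
  `|sepsum near a m - elem_sym a finset.setT m| <= W%:R / #|I|%:R * C ^+ K.
Proof.
move=> mK; rewrite distrC ger0_norm ?subr_ge0 ?sepsum_le//.
apply: le_trans (elem_sym_sub_sepsum near_card _ I0 a01) _.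
apply: ler_wpM2l; first by apply: divr_ge0 => //; exact: ltW.
have al0 : 0 <= alpha.
  by have /card_gt0P[i0 _] := I0; case/andP: (a01 i0) => /le_trans h /h.
apply: (@le_trans _ _ (C ^+ m)); last exact: ler_weXn2l.
by rewrite lerXn2r// nnegrE// mulr_ge0// ltW.
Qed.

Let Ex_badN m : (m < K)%N ->
  Ex P (fun w => \1_bad w * N w ^+ m) <= b * beta + 2 * (1 + M) ^+ (K + K) / b.
Proof.
move=> mK; have bI := @bmeas_indic _ _ R _ mbad.
apply: (@le_trans _ _ (Ex P (fun w => b * \1_bad w + b^-1 * N w ^+ (m + m)))).
  apply: le_Ex; first by apply: bmeasM => //; exact: bmeasX.
    by apply: bmeasD; apply: bmeasZ => //; exact: bmeasX.
  move=> w; rewrite indicE; case: (_ \in _).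
    by rewrite mul1r mulr1 [_^-1 * _]mulrC pow_split.
  by rewrite mul0r mulr0 add0r mulr_ge0 ?exprn_ge0// invr_ge0 ltW.
rewrite ExD; [|by apply: bmeasZ => //; exact: bmeasX..].
rewrite !ExZ//; last exact: bmeasX.
rewrite Ex_indic// lerD//; first by rewrite ler_wpM2l// ltW.
rewrite mulrC ler_pM2r ?invr_gt0//.
have := separated_moment near_refl near_sym near_card mG g0 H2.
move=> /(_ (m + m)%N finset.set0).
have s0 : sepset near finset.set0 by apply/sepsetP => x y; rewrite inE.
rewrite cards0 add0n expr0 mulr1.
move=> /(_ s0); under eq_fun do rewrite big_set0 mul1r.
have mmK : (m + m <= K + K)%N by rewrite leq_add// ltnW.
move=> /(_ mmK) /le_trans; apply; rewrite ler_wpM2l// -/M.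
apply: (@le_trans _ _ ((1 + M) ^+ (m + m))).
  by rewrite lerXn2r ?nnegrE// ?lerDr// addr_ge0.
by rewrite ler_weXn2l// lerDl.
Qed.

(** The error terms are, in order: the Bonferroni remainders of both products; the splitting errors
    of the K + 1 separated sums; the sets that are not separated, on the side of the means; the
    truncated sums on [bad], through [pow_split]; and the product itself on [bad]. *)
Lemma separated_comparison :
  `|Ex P (fun w => \prod_i (1 - Y i w)) - \prod_i (1 - a i)| <=
    2 * (C ^+ K / K`!%:R) +
    K.+1%:R * ((1 + #|I|%:R * g) ^+ K * r1) +
    K%:R * (W%:R / #|I|%:R * C ^+ K) +
    K.+1%:R * (b * beta + 2 * (1 + M) ^+ (K + K) / b) + beta.
Proof.
have bI := @bmeas_indic _ _ R _ mbad.
have bpr : bmeas (fun w => \prod_i (1 - Y i w)).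
  by apply: bmeas_prod => i _; apply: bmeasB => //; exact: bmeas_cst.
pose T w := \sum_(m < K) (-1) ^+ m * S m w.
have bT : bmeas T by apply: bmeas_sum => m _; exact: bmeasZ.
(* Off [bad] the elementary symmetric polynomials are separated sums and the Bonferroni remainder is
   at most [S K]; on [bad] every term of the truncated sum is bounded by a power of [N]. *)
pose Q w := S K w + (\1_bad w + \sum_(m < K) \1_bad w * N w ^+ m).
have bQ2 : bmeas (fun w => \sum_(m < K) \1_bad w * N w ^+ m).
  by apply: bmeas_sum => m _; apply: bmeasM => //; exact: bmeasX.
have bQ : bmeas Q by apply: bmeasD => //; apply: bmeasD.
have point w : `|\prod_i (1 - Y i w) - T w| <= Q w.
  have [bw|bw] := pselect (bad w).
    rewrite /Q indicE mem_set// mulr1n.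
    have p01 : 0 <= \prod_i (1 - Y i w) <= 1.
      rewrite prodr_ge0 ?prodr_ile1// => i _; case/andP: (Y1 i w) => *.
        by rewrite subr_ge0 gerBl; apply/andP.
      by rewrite subr_ge0.
    rewrite (le_trans (ler_normB _ _))// -[leLHS]add0r lerD// lerD//.
      by rewrite ger0_norm; case/andP: p01.
    apply: le_trans (ler_norm_sum _ _ _) _; apply: ler_sum => m _.
    by rewrite normrMsign mul1r ger0_norm.
  rewrite /Q indicE memNset// mulr0n add0r.
  rewrite [X in _ <= _ + X]big1 ?addr0 => [|m _]; last by rewrite mul0r.
  rewrite /T.
  have -> : \sum_(m < K) (-1) ^+ m * S m w =
      \sum_(m < K) (-1) ^+ m * elem_sym (Y ^~ w) finset.setT m.
    by apply: eq_bigr => m _; rewrite elem_sym_sepsum.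
  rewrite -elem_sym_sepsum//.
  have := bonferroni finset.setT K (Y1 ^~ w).
  rewrite (eq_bigl predT) => [|i]; last by rewrite finset.in_setT.
  move=> /andP[h1 h2].
  by rewrite -(normrMsign K) ger0_norm.
have point_a : `|\prod_i (1 - a i) - \sum_(m < K) (-1) ^+ m * elem_sym a finset.setT m|
    <= C ^+ K / K`!%:R.
  apply: le_trans elem_sym_a.
  have := bonferroni finset.setT K a1.
  rewrite (eq_bigl predT) => [|i]; last by rewrite finset.in_setT.
  move=> /andP[h1 h2].
  by rewrite -(normrMsign K) ger0_norm.
have e1 : `|Ex P (fun w => \prod_i (1 - Y i w)) - Ex P T| <=
    C ^+ K / K`!%:R + (1 + #|I|%:R * g) ^+ K * r1 + (beta +
    K%:R * (b * beta + 2 * (1 + M) ^+ (K + K) / b)).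
  rewrite -ExB//; apply: le_trans (Ex_norm _ _) _; first exact: bmeasB.
  apply: (le_trans (le_Ex _ _ _ point)) => //.
    by apply: bmeas_norm; exact: bmeasB.
  rewrite ExD//; last exact: bmeasD.
  rewrite ExD// Ex_indic// lerD//; last first.
    rewrite lerD// Ex_sum; last first.
      by move=> m _; apply: bmeasM => //; exact: bmeasX.
    apply: (@le_trans _ _ (\sum_(m < K) (b * beta + 2 * (1 + M) ^+ (K + K) / b))).
      by apply: ler_sum => m _; exact: Ex_badN.
    by rewrite sumr_const card_ord -[leLHS]mulr_natl.
  have := Ex_S (leqnn K); rewrite ler_norml => /andP[_].
  rewrite lerBlDl => /le_trans; apply; rewrite lerD2r.
  by apply: le_trans elem_sym_a; exact: sepsum_le.
have e2 : `|Ex P T - \sum_(m < K) (-1) ^+ m * elem_sym a finset.setT m| <=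
    K%:R * ((1 + #|I|%:R * g) ^+ K * r1) + K%:R * (W%:R / #|I|%:R * C ^+ K).
  rewrite /T Ex_sum => [|m _]; last exact: bmeasZ.
  rewrite -sumrB; apply: le_trans (ler_norm_sum _ _ _) _.
  rewrite -mulrDr.
  apply: (@le_trans _ _ (\sum_(m < K)
    ((1 + #|I|%:R * g) ^+ K * r1 + (W%:R / #|I|%:R * C ^+ K)))).
    apply: ler_sum => m _; rewrite ExZ// -mulrBr normrMsign.
    rewrite (le_trans (ler_distD (sepsum near a m) _ _))//.
    by rewrite lerD ?Ex_S ?sepsum_a// ltnW.
  by rewrite sumr_const card_ord -[leLHS]mulr_natl.
have := ler_distD (Ex P T) (Ex P (fun w => \prod_i (1 - Y i w)))
  (\prod_i (1 - a i)).
have := ler_distD (\sum_(m < K) (-1) ^+ m * elem_sym a finset.setT m)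
  (Ex P T) (\prod_i (1 - a i)).
rewrite [X in _ <= _ + X]distrC.
have bb : 0 <= b * beta + 2 * (1 + M) ^+ (K + K) / b.
  have M1 : 0 <= 1 + M by rewrite addr_ge0.
  apply: addr_ge0; first apply: mulr_ge0; first exact: ltW.
    by apply: le_trans pbad; exact: pr_ge0.
  by apply: divr_ge0; [rewrite mulr_ge0// exprn_ge0|exact: ltW].
move=> t1 t2; rewrite -natr1 !mulrDl !mul1r; lra.
Qed.

End separated_comparison_bound.

(** * Gap events and the tail of the gap probability *)

Section gap_events.
Context {R : realType} {d : measure_display} {Omega : measurableType d}.
Variables (P : probability Omega R) (Z : Omega -> set R).
Hypotheses (hZ : point_process Z) (hstat : stationary P Z).
Local Notation G := (gap_prob P Z).

Lemma counting_eq0 (A : set R) : (counting A = 0%:R%:E :> \bar R) <-> A = set0.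
Proof.
rewrite /counting; split; last first.
  by move=> ->; rewrite asboolT// fset_set0 finmap.cardfs0.
case: asboolP => // fA [] /eqP; rewrite pnatr_eq0.
by rewrite finmap.cardfs_eq0 => /eqP /fset_set_set0; exact.
Qed.

Lemma gap_eventE (I : interval R) :
  gap_event Z I = [set w | counting (Z w `&` [set` I]) = 0%:R%:E :> \bar R].
Proof. by apply/seteqP; split=> w /=; rewrite counting_eq0 setIC. Qed.

Lemma measurable_gap_event (I : interval R) : measurable (gap_event Z I).
Proof.
have [_ mZ] := hZ; rewrite gap_eventE.
have := mZ _ (measurable_itv I) measurableT _ (emeasurable_set1 0%:R%:E).
by rewrite setTI; congr measurable.
Qed.

(** Stationarity for a single set with count 0, after translation by - x. *)
Lemma gap_prob_shift (x y r : R) : y = x + r ->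
  pr P (gap_event Z `[x, y]) = G r.
Proof.
move=> yE; rewrite /gap_prob !gap_eventE /pr; congr fine.
pose B (i : 'I_1) : set R := `[0, r]%classic.
have := @hstat (- x) 1 B (fun=> 0%N) (fun=> measurable_itv _).
have -> : [set w | forall i, counting (Z w `&` B i) = 0%:R%:E :> \bar R] =
    [set w | counting (Z w `&` [set` `[0, r]]) = 0%:R%:E :> \bar R].
  by apply/seteqP; split=> w /=; [move=> h; exact: (h ord0)|move=> h i; exact: h].
move=> <-; congr (P _); apply/seteqP; split=> w /=; rewrite !counting_eq0.
  move=> h i; rewrite counting_eq0. apply/seteqP; split=> // _ [[z zZ <-]].
  rewrite /B /= in_itv/= => /andP[z1 z2].
  suff : (Z w `&` [set` `[x, y]]) z by rewrite h.
  by split=> //=; rewrite in_itv/= yE; apply/andP; split; lra.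
move=> /(_ ord0); rewrite counting_eq0 => h.
apply/seteqP; split=> // z [zZ]; rewrite /= in_itv/= yE => /andP[z1 z2].
have : ([set z0 - x | z0 in Z w] `&` B ord0) (z - x).
  by split; [exists z|rewrite /B /= in_itv/=; apply/andP; split; lra].
by rewrite h.
Qed.

Lemma gap_event_sub (I J : interval R) : [set` I] `<=` [set` J] ->
  gap_event Z J `<=` gap_event Z I.
Proof.
move=> IJ w; rewrite /gap_event /= => h.
by apply/seteqP; split=> // z [/IJ zJ zZ]; rewrite -h.
Qed.

Lemma gap_prob_ge0 r : 0 <= G r.
Proof. exact: pr_ge0. Qed.

Lemma gap_prob_le1 r : G r <= 1.
Proof. exact/pr_le1/measurable_gap_event. Qed.

Lemma gap_prob_nincr r r' : r <= r' -> G r' <= G r.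
Proof.
move=> rr; apply: pr_le; [exact: measurable_gap_event..|].
apply: gap_event_sub => z /=; rewrite !in_itv/= => /andP[-> /le_trans]; exact.
Qed.

(* For nonnegative [h] and [r], [Z] hits [[x, x + h[] and misses
   [[x + h, x + h + r]]. *)
Definition exceed (x h r : R) : set Omega :=
  gap_event Z `[x + h, x + h + r] `\` gap_event Z `[x, x + h + r].

Lemma measurable_exceed x h r : measurable (exceed x h r).
Proof. by apply: measurableD; exact: measurable_gap_event. Qed.

Lemma exceedP x h r w : 0 <= h -> 0 <= r -> exceed x h r w <->
  (exists2 z, Z w z & x <= z < x + h) /\
  (forall z, Z w z -> x + h <= z -> x + h + r < z).
Proof.
move=> h0 r0; split.
  move=> [h1 /eqP/set0P[z []]]; rewrite /= in_itv/= => /andP[z1 z2] zZ.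
  have miss y : Z w y -> x + h <= y -> x + h + r < y.
    move=> yZ y1; rewrite ltNge; apply/negP => y2.
    suff : ([set` `[x + h, x + h + r]] `&` Z w) y by rewrite h1.
    by split=> //=; rewrite in_itv/= y1.
  split=> //; exists z => //; rewrite z1 /= ltNge; apply/negP => z3.
  by have := miss z zZ z3; rewrite ltNge z2.
move=> [[z zZ /andP[z1 z2]] miss]; split.
  apply/seteqP; split=> // y []; rewrite /= in_itv/= => /andP[y1 y2] yZ.
  by have := miss y yZ y1; rewrite ltNge y2.
apply/eqP/set0P; exists z; split=> //=; rewrite in_itv/= z1 /=.
by rewrite (le_trans (ltW z2))// lerDl.
Qed.

Lemma pr_exceed x h r : 0 <= h -> pr P (exceed x h r) = G r - G (h + r).
Proof.
move=> h0; rewrite pr_setD; [|exact: measurable_gap_event..|].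
  by congr (_ - _); apply: gap_prob_shift; lra.
apply: gap_event_sub => z /=; rewrite !in_itv/= => /andP[z1 ->].
by rewrite andbT (le_trans _ z1)// lerDl.
Qed.

Lemma exceed_sub x h r r' w : 0 <= h -> 0 <= r -> r <= r' ->
  exceed x h r' w -> exceed x h r w.
Proof.
move=> h0 r0 rr; have r'0 := le_trans r0 rr.
move=> /(exceedP _ _ h0 r'0)[hit miss]; apply/exceedP => //; split=> // z zZ z1.
by apply: le_lt_trans (miss z zZ z1); rewrite lerD2l.
Qed.

(** The second cell contains a point, which must lie beyond the empty stretch following the first
    cell. Two hit cells therefore carry disjoint gap intervals, as the definition of [phi]
    requires. *)
Lemma exceed_separated x x' h r w : 0 <= h -> 0 <= r -> x + h <= x' ->
  exceed x h r w -> exceed x' h r w -> x + r < x'.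
Proof.
move=> h0 r0 xx /(exceedP _ _ h0 r0)[_ miss] /(exceedP _ _ h0 r0)[[z zZ]].
move=> /andP[z1 z2] _; have := miss z zZ (le_trans xx z1); lra.
Qed.

End gap_events.

(** * Convexity: tangents, increments and levels of the density *)

Section convex_tail.
Context {R : realType}.
Variable G : R -> R.
Hypothesis dG : forall r, 0 < r -> derivable G r 1 /\ derivable (derive1 G) r 1.
Hypothesis cG : convex_function (`[0, +oo[%classic : set R) G.
Local Notation g := (fun r => - derive1 G r).

(** Convexity bounds the difference quotient at x in direction y - x for every step t in ]0, 1], and
    t tends to 0. The directional derivative treats both signs of y - x at once. *)
Lemma convex_tangent x y : 0 < x -> 0 <= y ->
  derive1 G x * (y - x) <= G y - G x.
Proof.
move=> x0 y0; pose v := y - x.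
have [d1 _] := dG x0.
have df : differentiable G x by apply/derivable1_diffP.
have -> : derive1 G x * (y - x) = 'D_v G x.
  rewrite derive1E' // deriveE// -[in RHS](mulr1 v) -[v * 1]/(v *: 1).
  by rewrite linearZ mulrC.
have dv : derivable G x v by exact: diff_derivable.
have cv : (fun h : R => h^-1 *: (G (h *: v + x) - G x)) @ 0^'+ --> 'D_v G x.
  exact: cvg_dnbhs_at_right dv.
apply: (cvgr_to_le cv); near=> t.
have t0 : 0 < t by [].
have t1 : t <= 1 by near: t; exact: nbhs_right_le.
have t01 : 0 <= t <= 1 by rewrite (ltW t0).
rewrite /GRing.scale/= mulrC ler_pdivrMr//.
have := cG (Itv01 (ltW t0) t1) (x := y) (y := x).
rewrite !inE/= !in_itv/= !andbT => /(_ y0 (ltW x0)).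
rewrite !convRE/= -[unstable.onem t]/(1 - t).
set c := conv _ _ _.
have -> : c = t * v + x.
  by rewrite -[LHS]/(t * y + (1 - t) * x) /v; ring.
rewrite -subr_ge0 => h; rewrite -subr_ge0; apply: le_trans h _.
by rewrite le_eqVlt; apply/orP; left; apply/eqP; ring.
Unshelve. all: by end_near.
Qed.

Lemma derive1_convex_nondecreasing x y : 0 < x -> x <= y ->
  derive1 G x <= derive1 G y.
Proof.
move=> x0; rewrite le_eqVlt => /predU1P[->//|xy].
have y0 := lt_trans x0 xy.
have h1 := convex_tangent x0 (ltW y0); have h2 := convex_tangent y0 (ltW x0).
rewrite -(@ler_pM2r _ (y - x)) ?subr_gt0//; lra.
Qed.

(** The tangents at both ends. By [pr_exceed] the middle term is the probability that a cell of mesh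
    h is hit. *)
Lemma increment_bounds x h : 0 < x -> 0 <= h ->
  h * g (x + h) <= G x - G (x + h) <= h * g x.
Proof.
move=> x0 h0; have xh0 : 0 < x + h by lra.
have h1 := convex_tangent x0 (ltW xh0); have h2 := convex_tangent xh0 (ltW x0).
apply/andP; split; nra.
Qed.

Lemma continuous_derive1 x : 0 < x -> {for x, continuous (derive1 G)}.
Proof.
move=> x0; apply: differentiable_continuous.
by apply/derivable1_diffP; have [] := dG x0.
Qed.

Lemma density_increment x y : 0 < x -> x < y ->
  exists2 c, x < c < y & g x - g y = derive1n 2 G c * (y - x).
Proof.
move=> x0 xy.
have [||c] := @MVT _ (derive1 G) (derive1n 2 G) x y xy.
- move=> z; rewrite in_itv/= => /andP[xz _].
  apply: DeriveDef; first by have [] := dG (lt_trans x0 xz).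
  by rewrite /derive1n/= derive1E.
- apply: derivable_within_continuous => z; rewrite in_itv/= => /andP[xz _].
  by have [] := dG (lt_le_trans x0 xz).
by rewrite in_itv/= => cxy e; exists c => //; rewrite -e; ring.
Qed.

Hypothesis g_gt0 : forall x, 0 < x -> 0 < g x.
Hypothesis g_cvg0 : g x @[x --> +oo] --> (0 : R).

(** The supremum of the points where g is at least v is the right end of a possible flat stretch.
    With this choice the comparison of g with v is equivalent to the comparison of x with r, which
    is what translates rescaled heights into gap lengths. *)
Lemma density_level v : 0 < v -> v <= g 1 ->
  exists r, [/\ 0 < r, g r = v & forall x, 0 < x -> (g x < v) = (r < x)].
Proof.
move=> v0 v1; pose S := [set x | 0 < x /\ v <= g x].
have S1 : S 1 by split.
have [B [_ HB]] : \forall x \near +oo, g x < v by apply: cvgr_lt g_cvg0 _ v0.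
have ubS : ubound S (Num.max B 1).
  move=> x [x0 vx]; rewrite leNgt; apply/negP; rewrite gt_max => /andP[Bx _].
  by have := HB x Bx; rewrite ltNge vx.
have supS : has_sup S by split; [exists 1|exists (Num.max B 1)].
pose r := sup S.
have r1 : 1 <= r by apply: ub_le_sup => //; exists (Num.max B 1).
have r0 : 0 < r by rewrite (lt_le_trans ltr01).
have Sle x : S x -> x <= r by move=> Sx; apply: ub_le_sup => //; exists (Num.max B 1).
have cg : {for r, continuous g} by apply: continuousN; exact: continuous_derive1.
have gr : g r = v.
  apply/eqP; rewrite eq_le; apply/andP; split; rewrite leNgt; apply/negP => h.
    have [e /= e0 He] : \forall z \near r, v < g z by exact: cvgr_gt cg _ h.
    have : S (r + e / 2).
      split; first lra.
      apply/ltW/He; rewrite /ball/= opprD addrA subrr sub0r normrN gtr0_norm; lra.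
    move/Sle; lra.
  have [e /= e0 He] : \forall z \near r, g z < v by exact: cvgr_lt cg _ h.
  have [x Sx rx] := sup_adherent e0 supS.
  have xr := Sle _ Sx; have [_] := Sx; rewrite leNgt => /negP; apply; apply: He.
  by rewrite /ball/= ger0_norm ?subr_ge0// ltrBlDr -ltrBlDl.
exists r; split=> // x x0; apply/idP/idP => [gx|rx].
  rewrite ltNge; apply/negP => xr; have := derive1_convex_nondecreasing x0 xr.
  move: gr; lra.
by rewrite ltNge; apply/negP => vx; have /Sle : S x by []; rewrite leNgt rx.
Qed.

End convex_tail.

Lemma near_ln_ge {R : realType} (A : R) : \forall L \near +oo, A <= ln L.
Proof.
near=> L.
have hL : expR A <= L by near: L; apply: nbhs_pinfty_ge; exact: num_real.
have L0 := lt_le_trans (expR_gt0 A) hL.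
by rewrite -[A]expRK ler_ln ?posrE ?expR_gt0.
Unshelve. all: by end_near.
Qed.

Lemma near_pinfty_and {R : realType} (Q : R -> Prop) :
  (\forall L \near +oo, Q L) -> exists B, forall L, B < L -> Q L.
Proof. by move=> [B [_ h]]; exists B. Qed.

(** * Asymptotics of G at the level where the density is u / L *)

Section tail_asymptotics.
Context {R : realType}.
Variable G : R -> R.
Hypothesis G01 : forall r, 0 <= G r <= 1.
Hypothesis G_nincr : forall r r', r <= r' -> G r' <= G r.
Hypothesis dG : forall r, 0 < r -> derivable G r 1 /\ derivable (derive1 G) r 1.
Hypothesis cG : convex_function (`[0, +oo[%classic : set R) G.
Local Notation g := (fun r => - derive1 G r).
Hypothesis hdecay : - ln (G r) / ln r @[r --> +oo] --> +oo.
Hypothesis hlog : ln (g r) / ln (G r) @[r --> +oo] --> (1 : R).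
Hypothesis hG2 : exists e : R -> R, e r @[r --> +oo] --> (0 : R) /\
  \forall r \near +oo,
    (lne (derive1n 2 G r)%:E <= (ln (G r) * (1 + e r))%:E)%E.

(** [ln] is 0 on nonpositive arguments, so the divergence of the quotient also forces G r to be
    positive. *)
Lemma ln_gap_prob_decay (A : R) : \forall r \near +oo,
  [/\ 1 < r, 0 < G r, ln (G r) < 0 & A * ln r <= - ln (G r)].
Proof.
near=> r.
have r1 : 1 < r by near: r; apply: nbhs_pinfty_gt; exact: num_real.
have lr : 0 < ln r by rewrite ln_gt0.
(* The maximum with 1 makes the logarithm of G r strictly negative whatever A is. *)
have : Num.max A 1 <= - ln (G r) / ln r.
  by near: r; move/cvgryPge : hdecay; apply.
rewrite ler_pdivlMr// => h.
have h1 : A * ln r <= - ln (G r).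
  by apply: le_trans h; rewrite ler_pM2r// le_max lexx.
have h2 : 1 * ln r <= - ln (G r).
  by apply: le_trans h; rewrite ler_pM2r// le_max lexx orbT.
have lG : ln (G r) < 0 by lra.
split=> //; rewrite ltNge; apply/negP => /ln0 h3; move: lG; rewrite h3; lra.
Unshelve. all: by end_near.
Qed.

Lemma gap_prob_cvg0 : G r @[r --> +oo] --> (0 : R).
Proof.
apply/cvgrPdist_le => e e0; near=> r; rewrite sub0r normrN.
have [r1 Gr _ h] : [/\ 1 < r, 0 < G r, ln (G r) < 0 & 1 * ln r <= - ln (G r)].
  by near: r; exact: ln_gap_prob_decay.
rewrite ger0_norm ?(ltW Gr)// -[G r]lnK ?posrE// -[e]lnK ?posrE// ler_expR.
have : - ln e <= ln r by near: r; exact: near_ln_ge.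
lra.
Unshelve. all: by end_near.
Qed.

Lemma ln_density (k : R) : 0 < k -> k < 1 -> \forall r \near +oo,
  0 < g r /\ (1 + k) * ln (G r) <= ln (g r) <= (1 - k) * ln (G r).
Proof.
move=> k0 k1; near=> r.
have [r1 Gr lG _] : [/\ 1 < r, 0 < G r, ln (G r) < 0 & 1 * ln r <= - ln (G r)].
  by near: r; exact: ln_gap_prob_decay.
have : `|1 - ln (g r) / ln (G r)| <= k.
  by near: r; move/cvgrPdist_le : hlog; apply.
rewrite ler_norml => /andP[h1 h2].
set q := ln (g r) / ln (G r) in h1 h2.
have lg : ln (g r) = q * ln (G r) by rewrite /q divfK// lt_eqF.
have b : (1 + k) * ln (G r) <= ln (g r) <= (1 - k) * ln (G r).
  by rewrite lg !ler_nM2r//; apply/andP; split; lra.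
split=> //; rewrite ltNge; apply/negP => /ln0 h3.
by move: b; rewrite h3 => /andP[_]; nra.
Unshelve. all: by end_near.
Qed.

(** Positivity for large arguments passes to smaller ones because the density is nonincreasing. *)
Lemma density_gt0 x : 0 < x -> 0 < g x.
Proof.
move=> x0.
have /near_pinfty_and[B hB] : \forall r \near +oo, 0 < g r.
  by near do apply: (proj1 _); apply: filterS (ln_density (k := 2^-1) _ _) => //;
    [move=> ? []|lra..].
pose y := Num.max x (B + 1).
have xy : x <= y by rewrite le_max lexx.
have /hB gy : B < y by rewrite lt_max; apply/orP; right; lra.
have := derive1_convex_nondecreasing dG cG x0 xy; move: gy; lra.
Unshelve. all: by end_near.
Qed.

(** Over a unit step the density at the right end is at most the decrease of G, hence at most G (x -
    1). *)
Lemma density_cvg0 : g x @[x --> +oo] --> (0 : R).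
Proof.
apply/cvgrPdist_le => e e0.
have /near_pinfty_and[B hB] : \forall r \near +oo, G r <= e.
  move/cvgrPdist_le : gap_prob_cvg0 => /(_ _ e0); apply: filterS => r.
  by rewrite sub0r normrN; apply: le_trans; exact: ler_norm.
near=> x; rewrite sub0r normrN.
have x1 : 1 < x by near: x; apply: nbhs_pinfty_gt; exact: num_real.
have x0 : 0 < x - 1 by lra.
rewrite gtr0_norm; last by apply: density_gt0; lra.
have := increment_bounds dG cG x0 (@ler01 R); rewrite subrK mul1r => /andP[h _].
apply: le_trans h _; have /andP[? _] := G01 x.
have : G (x - 1) <= e; last lra.
apply: hB; rewrite ltrBrDr; near: x; apply: nbhs_pinfty_gt; exact: num_real.
Unshelve. all: by end_near.
Qed.

Lemma second_derivative_bound (k : R) : 0 < k -> \forall r \near +oo,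
  derive1n 2 G r <= expR ((1 - k) * ln (G r)).
Proof.
move=> k0; have [e [e0 he]] := hG2; near=> r.
have [r1 Gr lG _] : [/\ 1 < r, 0 < G r, ln (G r) < 0 & 1 * ln r <= - ln (G r)].
  by near: r; exact: ln_gap_prob_decay.
have : `|0 - e r| <= k by near: r; move/cvgrPdist_le : e0; apply.
rewrite sub0r normrN ler_norml => /andP[ek _].
have : (lne (derive1n 2 G r)%:E <= (ln (G r) * (1 + e r))%:E)%E by near: r.
(* Where G'' is not positive its [lne] is -oo, and the bound is trivial. *)
rewrite /lne; case: ifPn => [le0 _|]; first by rewrite (le_trans le0)// expR_ge0.
rewrite -ltNge => gt0; rewrite lee_fin => h.
rewrite -[derive1n _ _ _]lnK ?posrE// ler_expR (le_trans h)//; nra.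
Unshelve. all: by end_near.
Qed.

(** The value 0 is a default for those L at which no such level exists; [gap_levelP] excludes it for
    large L. *)
Definition gap_level (u L : R) : R := xget 0 [set r : R | [/\ 0 < r, g r = u / L &
  forall x, 0 < x -> (g x < u / L) = (r < x)]].

Lemma gap_levelP u : 0 < u -> \forall L \near +oo, [/\ 0 < gap_level u L,
  g (gap_level u L) = u / L &
  forall x, 0 < x -> (g x < u / L) = (gap_level u L < x)].
Proof.
move=> u0; have g1 : 0 < - derive1 G 1 := density_gt0 (@ltr01 R); near=> L.
have L0 : 0 < L by near: L; apply: nbhs_pinfty_gt; exact: num_real.
have v1 : u / L <= g 1.
  by rewrite ler_pdivrMr// -ler_pdivrMl//.
have [r hr] := density_level dG cG density_cvg0 (divr_gt0 u0 L0) v1.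
rewrite /gap_level; case: xgetP => [y _ hy|none]; first exact: hy.
by exfalso; exact: (none r hr).
Unshelve. all: by end_near.
Qed.

(** The density at a fixed B is positive, hence at least u / L for large L, and then the level is at
    least B. *)
Lemma gap_level_cvg u : 0 < u -> gap_level u L @[L --> +oo] --> +oo.
Proof.
move=> u0; apply/cvgryPge => A; near=> L.
pose B := Num.max A 1.
have B0 : 0 < B by rewrite lt_max ltr01 orbT.
have L0 : 0 < L by near: L; apply: nbhs_pinfty_gt; exact: num_real.
have [_ _ h] : [/\ 0 < gap_level u L, g (gap_level u L) = u / L &
  forall x, 0 < x -> (g x < u / L) = (gap_level u L < x)].
  by near: L; exact: gap_levelP.
have AB : A <= B by rewrite le_max lexx.
have gB : 0 < - derive1 G B := density_gt0 B0.
apply: (le_trans AB); rewrite leNgt -h// -leNgt.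
by rewrite ler_pdivrMr// -ler_pdivrMl//.
Unshelve. all: by end_near.
Qed.

Lemma near_gap_level u (Q : R -> Prop) : 0 < u -> (\forall r \near +oo, Q r) ->
  \forall L \near +oo, Q (gap_level u L).
Proof. by move=> u0 hQ; exact: (gap_level_cvg u0 hQ). Qed.

(** The density at the level is u / L and its logarithm is equivalent to that of G, whence G = L ^
    (-1 + o(1)) there. The margin q = k / 4 absorbs both ln u and the relative error of the
    equivalence. *)
Lemma ln_gap_prob_level u (k : R) : 0 < u -> 0 < k -> k <= 1 ->
  \forall L \near +oo, 0 < G (gap_level u L) /\
   - ((1 + k) * ln L) <= ln (G (gap_level u L)) <= - ((1 - k) * ln L).
Proof.
move=> u0 k0 k1; pose q := k / 4.
have q0 : 0 < q by rewrite divr_gt0.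
near=> L.
have L0 : 0 < L by near: L; apply: nbhs_pinfty_gt; exact: num_real.
have [r1 Gr lG _] : [/\ 1 < gap_level u L, 0 < G (gap_level u L),
    ln (G (gap_level u L)) < 0 &
    1 * ln (gap_level u L) <= - ln (G (gap_level u L))].
  near: L; exact: (near_gap_level u0 (ln_gap_prob_decay 1)).
split=> //.
have [_ /andP[]] : 0 < g (gap_level u L) /\
    (1 + q) * ln (G (gap_level u L)) <= ln (g (gap_level u L)) <=
    (1 - q) * ln (G (gap_level u L)).
  near: L; have q1 : q < 1 by rewrite /q; lra.
  exact: (near_gap_level u0 (ln_density q0 q1)).
have [_ -> _] : [/\ 0 < gap_level u L, g (gap_level u L) = u / L &
  forall x, 0 < x -> (g x < u / L) = (gap_level u L < x)].
  by near: L; exact: gap_levelP.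
rewrite ln_div ?posrE//.
have : - ln u / q <= ln L by near: L; exact: near_ln_ge.
have : ln u / q <= ln L by near: L; exact: near_ln_ge.
rewrite !ler_pdivrMr//.
have -> : k = 4 * q by rewrite /q; field.
have : q <= 4^-1 by rewrite /q; lra.
have : 1 <= ln L by near: L; exact: near_ln_ge.
move: (ln L) (ln u) (ln (G _)) lG => l v y y0 l1 q4 hv1 hv2 h1 h2.
apply/andP; split; nra.
Unshelve. all: by end_near.
Qed.

(** G decays faster than any power of its argument, while at the level it is at least L ^ (-2):
    levels are L ^ o(1). *)
Lemma ln_gap_level u (k : R) : 0 < u -> 0 < k -> \forall L \near +oo,
  1 < gap_level u L /\ ln (gap_level u L) <= k * ln L.
Proof.
move=> u0 k0; near=> L.
have [r1 Gr lG h] : [/\ 1 < gap_level u L, 0 < G (gap_level u L),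
    ln (G (gap_level u L)) < 0 &
    2 / k * ln (gap_level u L) <= - ln (G (gap_level u L))].
  near: L; exact: (near_gap_level u0 (ln_gap_prob_decay (2 / k))).
split=> //.
have [_ /andP[h2 _]] : 0 < G (gap_level u L) /\
   - ((1 + 1) * ln L) <= ln (G (gap_level u L)) <= - ((1 - 1) * ln L).
  by near: L; apply: ln_gap_prob_level.
have : 2 / k * ln (gap_level u L) <= 2 * ln L by lra.
by rewrite mulrAC ler_pdivrMr// -mulrA ler_pM2l// mulrC.
Unshelve. all: by end_near.
Qed.

(** By the mean value theorem the difference is 2 * h * G'' (c), where G'' (c) is at most G (c) ^ (1
    - k) and thus nearly of order 1 / L. With k = eps / 8 the factor h, at most L ^ (- eps),
    outweighs all losses. This is what makes gaps within h of a level negligible. *)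
Lemma level_density_flat u (eps eta : R) : 0 < u -> 0 < eps -> eps <= 1 ->
  0 < eta -> \forall L \near +oo, forall h, 0 < h -> h <= L `^ (- eps) ->
  L * (g (gap_level u L - h) - g (gap_level u L + h)) <= eta.
Proof.
move=> u0 eps0 eps1 eta0; pose k := eps / 8.
have k0 : 0 < k by rewrite divr_gt0.
have k8 : k <= 8^-1 by rewrite /k; lra.
have [B hB] : exists B, forall r, B < r -> [/\ 1 < r, 0 < G r, ln (G r) < 0,
    0 < g r /\ ln (g r) <= (1 - k) * ln (G r) &
    derive1n 2 G r <= expR ((1 - k) * ln (G r))].
  apply: near_pinfty_and; near=> r.
  have [? ? ? _] : [/\ 1 < r, 0 < G r, ln (G r) < 0 & 1 * ln r <= - ln (G r)].
    by near: r; exact: ln_gap_prob_decay.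
  have [? /andP[_ ?]] : 0 < g r /\
      (1 + k) * ln (G r) <= ln (g r) <= (1 - k) * ln (G r).
    by near: r; apply: ln_density => //; lra.
  by split=> //; near: r; exact: second_derivative_bound.
near=> L => h h0 hL.
have L0 : 0 < L by near: L; apply: nbhs_pinfty_gt; exact: num_real.
have l1 : 1 <= ln L by near: L; exact: near_ln_ge.
set r := gap_level u L.
have hh : ln h <= - eps * ln L.
  by rewrite -ln_powR ler_ln ?posrE ?powR_gt0.
have h1 : h < 1.
  rewrite -(lnK h0) -expR0 ltr_expR (le_lt_trans hh)//; nra.
have rB : B + 1 < r.
  rewrite /r; near: L; apply: (near_gap_level u0 (Q := fun r => B + 1 < r)).
  by apply: nbhs_pinfty_gt; exact: num_real.
have [r1 Gr0 lGr [gr0 lgr] _] := hB r ltac:(lra).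
have [s1 Gs0 lGs [gs0 lgs] _] := hB (r - h) ltac:(lra).
have [_ /andP[lo hi]] : 0 < G r /\
   - ((1 + k) * ln L) <= ln (G r) <= - ((1 - k) * ln L).
  by rewrite /r; near: L; apply: ln_gap_prob_level => //; lra.
(* Otherwise G loses more than half of its value between r - h and r, so G (r - h) is less than 2 *
   h * g (r - h), hence at most 2 * h * G (r - h) ^ (1 - k). As G (r - h) is not much below 1 / L, h
   is too small for that. *)
have Gs2 : G (r - h) <= 2 * G r.
  rewrite leNgt; apply/negP => c.
  have c1 : G (r - h) < 2 * h * g (r - h).
    have := increment_bounds dG cG (x := r - h) (h := h) ltac:(lra) (ltW h0).
    rewrite subrK => /andP[_]; nra.
  have p1 : 0 < 2 * h * g (r - h) by rewrite !mulr_gt0.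
  have p2 : 0 < 2 * G r by rewrite mulr_gt0.
  have {}c : ln 2 + ln (G r) < ln (G (r - h)).
    by rewrite -lnM ?posrE// ltr_ln ?posrE.
  have {}c1 : ln (G (r - h)) < ln 2 + ln h + ln (g (r - h)).
    by rewrite -!lnM ?posrE ?mulr_gt0// ltr_ln ?posrE.
  have e8 : eps = 8 * k by rewrite /k; field.
  have : ln 2 / k <= ln L by near: L; exact: near_ln_ge.
  rewrite ler_pdivrMr//.
  move: c c1 hh lo lgs; rewrite e8.
  move: (ln L) l1 (ln h) (ln (G r)) (ln (G (r - h))) (ln (g (r - h))) (ln 2) => l l1 lh y x z t.
  clear - k0 k8 l1; nra.
have lGs2 : ln (G (r - h)) <= ln 2 + ln (G r).
  by rewrite -lnM ?posrE// ler_ln ?posrE ?mulr_gt0.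
have [c /andP[c1 c2] ->] := density_increment dG (x := r - h) (y := r + h) ltac:(lra) ltac:(lra).
have [c3 Gc0 lGc _ dc] := hB c ltac:(lra).
have lGcs : ln (G c) <= ln (G (r - h)).
  by rewrite ler_ln ?posrE//; apply: G_nincr; exact: ltW.
have dc2 : derive1n 2 G c <= expR ((1 - k) * ln (G (r - h))).
  by apply: le_trans dc _; rewrite ler_expR ler_pM2l//; lra.
apply: (@le_trans _ _ (L * (expR ((1 - k) * ln (G (r - h))) * (2 * h)))).
  rewrite ler_pM2l// (_ : r + h - (r - h) = 2 * h); last by ring.
  by rewrite ler_pM2r// mulr_gt0.
rewrite -[L in L * _](lnK (x := L))// -[h in 2 * h](lnK (x := h))//.
rewrite -[in 2 * _](lnK (x := 2)) ?posrE//.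
rewrite -!expRD -[eta]lnK ?posrE// ler_expR.
have : (ln 2 * 2 - ln eta) / k <= ln L by near: L; exact: near_ln_ge.
rewrite ler_pdivrMr//.
have ln20 : 0 <= ln (2 : R) by rewrite ln_ge0// ler1n.
have e8 : eps = 8 * k by rewrite /k; field.
move: hh hi lGs2 lGs ln20; rewrite e8; clear - k0 k8 l1.
move: (ln L) l1 (ln h) (ln (G r)) (ln (G (r - h))) (ln 2) (ln eta) => l l1 lh y x t e.
nra.
Unshelve. all: by end_near.
Qed.

End tail_asymptotics.

(** * Grid counts *)

Section splitting_products.
Context {R : realType} {d : measure_display} {Omega : measurableType d}.
Variables (P : probability Omega R) (Z : Omega -> set R).
Hypotheses (hZ : point_process Z).
Hypothesis h3 : splitting P Z.

(** Some admissible e lies below t because [rho] is an infimum. As t is at most 1 / 2, the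
    intersection has at most twice the probability of the product, which turns the two-sided ratio
    into an error 2 * t. *)
Lemma splitting_ratio k (r s t : R) (I : 'I_k -> interval R) :
  rho P Z k r s < t -> t <= 2^-1 -> separated_family r s I ->
  (forall i, 0 < pr P (gap_event Z (I i))) ->
  `|pr P (\bigcap_i gap_event Z (I i)) - \prod_i pr P (gap_event Z (I i))| <=
     2 * t * \prod_i pr P (gap_event Z (I i)).
Proof.
move=> rt t2 sI I0.
have prI0 : 0 < \prod_i pr P (gap_event Z (I i)) by apply: prodr_gt0.
have [|e [/andP[e0 e1] /(_ I sI)/= +] et] := inf_lt _ rt.
  (* e = 1 is always admissible: its upper bound is the inverse of 0, that is +oo. *)
  exists 1; split; first by rewrite ler01 lexx.
  move=> J sJ; rewrite /= subrr inve0 leey; split=> //.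
  by rewrite lee_fin divr_ge0 ?prodr_ge0 ?pr_ge0// => i _; exact: pr_ge0.
have f0 : 0 < 1 - e by lra.
set x := pr P _; set y := \prod_i _ in prI0 *.

rewrite inver gt_eqF// !lee_fin => -[].
rewrite ler_pdivlMr// => h1; rewrite ler_pdivrMr// ler_pdivlMl// => h3'.
have x0 : 0 <= x by exact: pr_ge0.
have te : 0 <= (t - e) * y by rewrite mulr_ge0 ?subr_ge0// ltW.
have ex2 : 0 <= (2^-1 - e) * x by rewrite mulr_ge0// subr_ge0; lra.
have x2y : x <= 2 * y by lra.
have ex : 0 <= e * (2 * y - x) by rewrite mulr_ge0// subr_ge0.
by rewrite ler_norml; apply/andP; split; nra.
Qed.

(** The hypothesis treats one size k >= 2 at a time. Taking minima of the exponents by induction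
    makes the rate uniform over the sizes up to K; sizes 0 and 1 are equalities. *)
Lemma splitting_products K (delta : R) : 0 < delta ->
  exists2 delta', 0 < delta' & forall r s : R -> R,
  power_asymptotic 0 r -> power_asymptotic delta s ->
  \forall L \near +oo, forall k (I : 'I_k -> interval R), (k <= K)%N ->
    separated_family (r L) (s L) I ->
    (forall i, 0 < pr P (gap_event Z (I i))) ->
    `|pr P (\bigcap_i gap_event Z (I i)) - \prod_i pr P (gap_event Z (I i))| <=
     L `^ (- delta') * \prod_i pr P (gap_event Z (I i)).
Proof.
move=> delta0; elim: K => [|K [dK dK0 hK]].
  exists 1 => // r s _ _; near=> L => k I; rewrite leqn0 => /eqP k0 _ _.
  move: I; rewrite k0 => I.
  rewrite big_ord0 (_ : \bigcap_i _ = setT); last first.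
    by apply/seteqP; split=> // w _ [].
  by rewrite /pr probability_setT subrr normr0 mulr1 powR_ge0.
have [K0|K0] := posnP K.
  exists 1 => // r s _ _; near=> L => k I.
  rewrite K0 leq_eqVlt ltnS leqn0 => /orP[] /eqP k0 _ _; move: I; rewrite k0 => I.
    rewrite big_ord_recl big_ord0 mulr1 (_ : \bigcap_i _ = gap_event Z (I ord0)).
      by rewrite subrr normr0 mulr_ge0 ?powR_ge0 ?pr_ge0.
    apply/seteqP; split=> [w|w h i _]; first by apply.
    by rewrite (ord1 i).
  rewrite big_ord0 (_ : \bigcap_i _ = setT); last first.
    by apply/seteqP; split=> // w _ [].
  by rewrite /pr probability_setT subrr normr0 mulr1 powR_ge0.
have [d1 [d10 h]] := h3 (K0 : (1 < K.+1)%N) delta0.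
exists (Num.min dK (d1 / 4)); first by rewrite lt_min dK0 divr_gt0.
move=> r s ar as_; have [e [e0 he]] := h r s ar as_.
near=> L => k I; rewrite leq_eqVlt => /orP[/eqP kE|kK] sI I0.
  move: I sI I0; rewrite kE => I sI I0.
  have L1 : 1 < L by near: L; apply: nbhs_pinfty_gt; exact: num_real.
  have L0 : 0 < L by lra.
  (* The factor 2 makes the bound on [rho] strict; passing from d1 / 2 to d1 / 4 then absorbs the
     constants. *)
  pose t := 2 * L `^ (- (d1 / 2)).
  have lnL : 4 * ln 4 / d1 <= ln L by near: L; exact: near_ln_ge.
  have t4 : 2 * t <= L `^ (- (d1 / 4)).
    rewrite /t mulrA (_ : 2 * 2 = 4 :> R); last by ring.
    rewrite -[X in X * _ <= _]lnK ?posrE// /powR gt_eqF// -expRD ler_expR.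
    move: lnL; rewrite ler_pdivrMr//=; nra.
  have p1 : L `^ (- (d1 / 4)) <= 1.
    by rewrite /powR gt_eqF// -expR0 ler_expR mulNr oppr_le0 mulr_ge0 ?ln_ge0 ?ltW// divr_gt0.
  have rt : rho P Z K.+1 (r L) (s L) < t.
    apply: (@le_lt_trans _ _ (L `^ (- d1 + e L))); first by near: L.
    apply: (@le_lt_trans _ _ (L `^ (- (d1 / 2)))).
      rewrite ler_powR ?(ltW L1)//.
      have : `|0 - e L| <= d1 / 2.
        by near: L; move/cvgrPdist_le : e0; apply; rewrite divr_gt0.
      rewrite sub0r normrN ler_norml => /andP[]; lra.
    by rewrite /t; have := powR_gt0 (- (d1 / 2)) L0; lra.
  apply: (le_trans (splitting_ratio rt _ sI I0)); first lra.
  rewrite ler_wpM2r ?prodr_ge0// => [i _|]; first exact: pr_ge0.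
  apply: (le_trans t4); rewrite ler_powR ?(ltW L1)// lerN2 ge_min lexx orbT//.
have L1 : 1 < L by near: L; apply: nbhs_pinfty_gt; exact: num_real.
have : `|pr P (\bigcap_i gap_event Z (I i)) - \prod_i pr P (gap_event Z (I i))| <=
     L `^ (- dK) * \prod_i pr P (gap_event Z (I i)).
  by move: k I kK sI I0; near: L; exact: hK.
move=> /le_trans; apply.
rewrite ler_wpM2r ?prodr_ge0// => [i _|]; first exact: pr_ge0.
by rewrite ler_powR ?(ltW L1)// lerN2 ge_min lexx.
Unshelve. all: by end_near.
Qed.

Lemma prod_indic_bigcap (J : finType) (A : {set J}) (F : J -> set Omega) w :
  \prod_(i in A) \1_(F i) w = \1_(\bigcap_(i in [set` A]) F i) w :> R.
Proof.
have [h|h] := pselect ((\bigcap_(i in [set` A]) F i) w).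
  rewrite [RHS]indicE mem_set// big1// => i iA.
  by rewrite indicE mem_set//; exact: h.
rewrite [RHS]indicE memNset//.
have [i iA Fi] : exists2 i, i \in A & ~ F i w.
  apply: contrapT => h'; apply: h => i iA; apply: contrapT => Fi.
  by apply: h'; exists i.
by rewrite (bigD1 i)//= indicE memNset// mul0r.
Qed.

Lemma measurable_bigcap_gap (J : finType) (A : {set J}) (I : J -> interval R) :
  measurable (\bigcap_(i in [set` A]) gap_event Z (I i)).
Proof.
apply: fin_bigcap_measurable => [|i _]; first exact: finite_finset.
exact: measurable_gap_event.
Qed.

(** Splitting speaks of intersections of gap events only. A product of linear combinations is
    distributed into #|E| ^ #|A| such intersections, with coefficients at most 1 in absolute
    value. *)
Lemma Ex_linear_products (J E : finType) (e0 : E) (A : {set J}) (c : J -> E -> R)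
    (I : J -> E -> interval R) (r : R) :
  (forall j e, `|c j e| <= 1) ->
  (forall f : {ffun J -> E},
     `|Ex P (fun w => \prod_(j in A) \1_(gap_event Z (I j (f j))) w) -
       \prod_(j in A) pr P (gap_event Z (I j (f j)))| <= r) ->
  `|Ex P (fun w => \prod_(j in A) \sum_e c j e * \1_(gap_event Z (I j e)) w) -
    \prod_(j in A) \sum_e c j e * pr P (gap_event Z (I j e))| <=
    #|E|%:R ^+ #|A| * r.
Proof.
move=> c1 hr.
under eq_fun do rewrite (big_distr_big e0)/=.
rewrite (big_distr_big e0)/= Ex_sum; last first.
  move=> f _; apply: bmeas_prod => j _; apply: bmeasZ; apply: bmeas_indic.
  exact: measurable_gap_event.
rewrite -sumrB; apply: le_trans (ler_norm_sum _ _ _) _.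
apply: (@le_trans _ _ (\sum_(f in pffun_on e0 (mem A) (mem E)) r)).
  apply: ler_sum => f _.
  under eq_fun do rewrite big_split/=.
  rewrite big_split/= ExZ; last first.
    by apply: bmeas_prod => j _; apply: bmeas_indic; exact: measurable_gap_event.
  rewrite -mulrBr normrM; apply: le_trans (hr f).
  rewrite ler_piMl// normr_prod; apply: prodr_ile1 => j _.
  by rewrite normr_ge0/=.
rewrite sumr_const card_pffun_on -[leLHS]mulr_natl natrX.
by rewrite (_ : #|mem E| = #|E|).
Qed.

End splitting_products.

(** * Hit cells on a finite grid *)

Section discretised_exceedances.
Context {R : realType} {d : measure_display} {Omega : measurableType d}.
Variables (P : probability Omega R) (Z : Omega -> set R).
Hypotheses (hZ : point_process Z) (hstat : stationary P Z).
Local Notation G := (gap_prob P Z).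
Hypothesis G_gt0 : forall r, 0 < G r.

Lemma phi_has_ub (r : R) : has_ubound [set p : R | exists I J : interval R,
    [/\ compact [set` I] /\ compact [set` J],
        is_subset1 ([set` I] `&` [set` J]),
        (r%:E <= itv_length I)%E, (r%:E <= itv_length J)%E &
        p = pr P (gap_event Z I `&` gap_event Z J)]].
Proof.
exists 1 => p [I [J [_ _ _ _ ->]]]; apply: pr_le1.
by apply: measurableI; exact: measurable_gap_event.
Qed.

Lemma phi_ge0 (r : R) : 0 <= phi P Z r.
Proof.
rewrite /phi; set S := [set p | _].
have [->|/set0P[x Sx]] := eqVneq S set0; first by rewrite sup0.
apply: le_trans (ub_le_sup (phi_has_ub r) Sx).
by case: Sx => I [J [_ _ _ _ ->]]; exact: pr_ge0.
Qed.

Lemma itv_length_cc (a b : R) : a <= b -> itv_length `[a, b] = (b - a)%:E.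
Proof.
move=> ab; rewrite /itv_length lebesgue_measure_itv/= lte_fin.
case: ltP => [//|ba]; have -> : a = b by apply/eqP; rewrite eq_le ab.
by rewrite subrr.
Qed.

Variables (T : nat) (h : R) (q : nat) (rho : nat -> R) (s : 'I_T -> nat -> R).
Hypothesis h0 : 0 < h.
Hypothesis q0 : (0 < q)%N.
Hypothesis rho0 : 0 < rho 0.
Hypothesis rho_nd : forall b c, (b <= c < q)%N -> rho b <= rho c.
Hypothesis s01 : forall J b, 0 <= s J b <= 1.

(** Index q plays the role of an infinite threshold: emptiness there lets the top class contain all
    larger gaps and ends the telescoping sums. *)
Definition grid_exceed (J b : nat) : set Omega :=
  if (b < q)%N then exceed Z (J%:R * h) h (rho b) else set0.

Definition level_cell (J b : nat) w : R :=
  \1_(grid_exceed J b) w - \1_(grid_exceed J b.+1) w.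

(** At most one class b is active in a cell. With weights s = 1 - z, the product over the cells of
    the factors one minus this variable is a product of powers of the z with the counts as
    exponents, for all heights simultaneously. *)
Definition weighted_exceed (J : 'I_T) w : R := \sum_(b < q) s J b * level_cell J b w.

Definition weighted_mean (J : 'I_T) : R :=
  \sum_(b < q) s J b * (pr P (grid_exceed J b) - pr P (grid_exceed J b.+1)).

Let hge0 := ltW h0.

Lemma rho_gt0 b : (b < q)%N -> 0 < rho b.
Proof. by move=> bq; rewrite (lt_le_trans rho0)// rho_nd. Qed.

Lemma measurable_grid_exceed J b : measurable (grid_exceed J b).
Proof. by rewrite /grid_exceed; case: ifP => // _; exact: measurable_exceed. Qed.

Lemma grid_exceed_sub J b c : (b <= c)%N -> grid_exceed J c `<=` grid_exceed J b.
Proof.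
move=> bc w; rewrite /grid_exceed; case: ifPn => // cq.
rewrite (leq_ltn_trans bc cq); apply: exceed_sub => //.
  by apply/ltW/rho_gt0; exact: leq_ltn_trans cq.
by apply: rho_nd; rewrite bc.
Qed.

Lemma level_cell01 J b w : 0 <= level_cell J b w <= 1.
Proof.
rewrite /level_cell !indicE.
have [h1|h1] := boolP (w \in grid_exceed J b.+1).
  rewrite mem_set ?subrr ?lexx ?ler01//.
  by rewrite inE in h1; exact: grid_exceed_sub h1.
by rewrite subr0; case: (_ \in _); rewrite ?lexx ?ler01.
Qed.

Lemma sum_level_cell J w : \sum_(b < q) level_cell J b w = \1_(grid_exceed J 0) w.
Proof.
rewrite -(big_mkord predT (fun b => level_cell J b w)) /level_cell.
rewrite (eq_bigr (fun b => - (\1_(grid_exceed J b.+1) w - \1_(grid_exceed J b) w))).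
  rewrite sumrN telescope_sumr// opprB.
  rewrite [X in _ - X](_ : _ = 0) ?subr0//.
  by rewrite /grid_exceed ltnn indicE memNset.
by move=> b _; rewrite opprB.
Qed.

Lemma weighted_exceed01 J w : 0 <= weighted_exceed J w <= \1_(grid_exceed J 0) w.
Proof.
apply/andP; split.
  apply: sumr_ge0 => b _; rewrite mulr_ge0//; first by case/andP: (s01 J b).
  by case/andP: (level_cell01 J b w).
rewrite -sum_level_cell; apply: ler_sum => b _.
by rewrite ler_piMl//; [case/andP: (level_cell01 J b w)|case/andP: (s01 J b)].
Qed.

Lemma pr_grid_exceed J b : (b < q)%N -> pr P (grid_exceed J b) = G (rho b) - G (h + rho b).
Proof. by move=> bq; rewrite /grid_exceed bq pr_exceed. Qed.

(* Summation by parts turns the weights into coefficients of gap events. *)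
Let dcoef (J : 'I_T) (b : nat) : R :=
  if b is b'.+1 then s J b'.+1 - s J b' else s J 0%N.

Let coef (J : 'I_T) (e : 'I_q * bool) : R :=
  dcoef J e.1 * (if e.2 then 1 else - 1).

Let gapI (J : 'I_T) (e : 'I_q * bool) : interval R :=
  if e.2 then `[J%:R * h + h, J%:R * h + h + rho e.1]
         else `[J%:R * h, J%:R * h + h + rho e.1].

Let by_parts J (D : nat -> R) n : \sum_(b < n) s J b * (D b - D b.+1) =
  \sum_(b < n) dcoef J b * D b
  - (if n is n'.+1 then s J n' else 0) * D n.
Proof.
elim: n => [|n ih]; first by rewrite !big_ord0 mul0r subr0.
rewrite !big_ord_recr/= ih /dcoef; case: n {ih} => [|n]; last by ring.
by rewrite !big_ord0; ring.
Qed.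

Let sum_coef J (F : 'I_q * bool -> R) :
  \sum_e coef J e * F e = \sum_(b < q)
   dcoef J b *
     (F (b, true) - F (b, false)).
Proof.
transitivity (\sum_(b < q) \sum_(e : bool) coef J (b, e) * F (b, e)).
  by rewrite pair_bigA; apply: eq_bigr => -[].
apply: eq_bigr => b _; rewrite big_bool/= /coef/=; ring.
Qed.

Let grid_exceed_q J : grid_exceed J q = set0.
Proof. by rewrite /grid_exceed ltnn. Qed.

Let gapI_sub (J : 'I_T) (b : 'I_q) :
  gap_event Z (gapI J (b, false)) `<=` gap_event Z (gapI J (b, true)).
Proof.
apply: gap_event_sub => z; rewrite /gapI/= !in_itv/= => /andP[z1 ->].
by rewrite andbT (le_trans _ z1)// lerDl.
Qed.

(** A hit cell is the difference of two nested gap events, so its indicator is the difference of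
    theirs. *)
Lemma weighted_exceedE J w :
  weighted_exceed J w = \sum_e coef J e * \1_(gap_event Z (gapI J e)) w.
Proof.
rewrite sum_coef /weighted_exceed /level_cell.
rewrite (by_parts J (fun b => \1_(grid_exceed J b) w)).
rewrite grid_exceed_q indicE memNset// mulr0 subr0.
apply: eq_bigr => b _; congr (_ * _).
rewrite /grid_exceed ltn_ord /exceed !indicE in_setD.
rewrite -[gap_event Z `[_ + h, _]]/(gap_event Z (gapI J (b, true))).
rewrite -[gap_event Z `[_ * h, _]]/(gap_event Z (gapI J (b, false))).
have [wB|wB] := boolP (w \in gap_event Z (gapI J (b, false))); last by rewrite andbT subr0.
rewrite andbF mem_set ?subrr//.
by rewrite inE in wB; exact: gapI_sub.
Qed.

Lemma weighted_meanE J :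
  weighted_mean J = \sum_e coef J e * pr P (gap_event Z (gapI J e)).
Proof.
rewrite sum_coef /weighted_mean (by_parts J (fun b => pr P (grid_exceed J b))).
rewrite grid_exceed_q {2}/pr measure0 mulr0 subr0.
apply: eq_bigr => b _; congr (_ * _).
rewrite /grid_exceed ltn_ord pr_setD//; [exact: measurable_gap_event..|].
exact: gapI_sub.
Qed.

Let coef1 J e : `|coef J e| <= 1.
Proof.
rewrite /coef /dcoef normrM; case: e => -[[|b] bq] e /=.
  rewrite (_ : `|if e then _ else _| = 1) ?mulr1.
    by case/andP: (s01 J 0) => *; rewrite ger0_norm.
  by case: e; rewrite ?normrN normr1.
rewrite (_ : `|if e then _ else _| = 1) ?mulr1.
  case/andP: (s01 J b) => ? ?; case/andP: (s01 J b.+1) => ? ?.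
  by rewrite ler_norml; apply/andP; split; lra.
by case: e; rewrite ?normrN normr1.
Qed.

Let gap_pr_le J e : 0 < pr P (gap_event Z (gapI J e)) <= G (rho 0).
Proof.
case: e => b [] /=; rewrite /gapI/=.
  rewrite (gap_prob_shift hstat (r := rho b)); last by ring.
  by rewrite G_gt0 gap_prob_nincr// rho_nd//= ltn_ord.
rewrite (gap_prob_shift hstat (r := h + rho b)); last by ring.
rewrite G_gt0 gap_prob_nincr//.
have : rho 0 <= rho b by rewrite rho_nd//= ltn_ord.
move: h0; lra.
Qed.

Variables (sep rmax : R) (w : nat).
Hypothesis sep0 : 0 < sep.
Hypothesis rho_rmax : forall b, (b < q)%N -> h + rho b <= rmax.
Hypothesis hw : sep + rmax <= w%:R * h.

(** The gap intervals attached to cell i all lie in [i h, i h + rmax], so cells that are not near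
    have intervals at distance at least [sep]. *)
Definition grid_near (i j : 'I_T) : bool := `|i%:R * h - j%:R * h| < sep + rmax.

Let rmax0 : 0 < rmax.
Proof. by have := rho_rmax q0; move: rho0 h0; lra. Qed.

Let near_refl : reflexive grid_near.
Proof. by move=> i; rewrite /grid_near subrr normr0; move: rmax0 sep0; lra. Qed.

Let near_sym : symmetric grid_near.
Proof. by move=> i j; rewrite /grid_near distrC. Qed.

Let near_card i : (#|[set j | grid_near i j]%SET| <= (w + w).+1)%N.
Proof.
rewrite cardE -(size_map val) -(size_iota (i - w) (w + w).+1).
apply: uniq_leq_size; first by rewrite map_inj_uniq ?enum_uniq//; exact: val_inj.
move=> _ /mapP[j + ->]; rewrite mem_enum inE /grid_near -mulrBl normrM (gtr0_norm h0).
move=> /lt_le_trans /(_ hw); rewrite ltr_pM2r// => ij.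
rewrite mem_iota; case: (leqP i j) => c.
  move: ij; rewrite distrC. rewrite -natrB// ger0_norm// ltr_nat /=; lia.
have ji := ltnW c; move: ij; rewrite -natrB// ger0_norm// ltr_nat /=; lia.
Qed.

Let gapI_hull J e z : z \in gapI J e -> J%:R * h <= z <= J%:R * h + rmax.
Proof.
have := rho_rmax (ltn_ord e.1); rewrite /gapI.
case: e => b [] /=; rewrite in_itv/= => hr /andP[z1 z2]; apply/andP; split; move: h0; lra.
Qed.

Variables (K : nat) (t : R).
Hypothesis t01 : 0 <= t <= 1.
Hypothesis hsplit : forall k (I : 'I_k -> interval R), (k <= K + K)%N ->
  separated_family rmax sep I -> (forall i, 0 < pr P (gap_event Z (I i))) ->
  `|pr P (\bigcap_i gap_event Z (I i)) - \prod_i pr P (gap_event Z (I i))| <=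
     t * \prod_i pr P (gap_event Z (I i)).

Let split_set (A : {set 'I_T}) (f : 'I_T -> 'I_q * bool) :
  sepset grid_near A -> (#|A| <= K + K)%N ->
  `|Ex P (fun w => \prod_(j in A) \1_(gap_event Z (gapI j (f j))) w) -
    \prod_(j in A) pr P (gap_event Z (gapI j (f j)))| <= t * G (rho 0) ^+ #|A|.
Proof.
move=> /sepsetP sA cA.
under eq_fun do rewrite prod_indic_bigcap.
rewrite Ex_indic; last exact: measurable_bigcap_gap.
pose I (i : 'I_#|A|) := gapI (enum_val i) (f (enum_val i)).
have -> : \bigcap_(j in [set` A]) gap_event Z (gapI j (f j)) =
    \bigcap_i gap_event Z (I i).
  apply/seteqP; split=> [v hv i _|v hv j jA]; first exact/hv/enum_valP.
  by have := hv (enum_rank_in jA j) Logic.I; rewrite /I enum_rankK_in.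
have -> : \prod_(j in A) pr P (gap_event Z (gapI j (f j))) =
    \prod_i pr P (gap_event Z (I i)).
  exact: big_enum_val.
apply: le_trans (hsplit _ _ _) _ => //; last first.
- rewrite ler_wpM2l//; first by case/andP: t01.
  have -> : G (rho 0) ^+ #|A| = \prod_(i < #|A|) G (rho 0).
    by rewrite prodr_const card_ord.
  by apply: ler_prod => i _; have /andP[/ltW -> ->] := gap_pr_le (enum_val i) (f (enum_val i)).
- by move=> i; have /andP[] := gap_pr_le (enum_val i) (f (enum_val i)).
have sepI i j : i != j -> Defs.separated sep (I i) (I j).
  move=> ij x y /gapI_hull/andP[x1 x2] /gapI_hull/andP[y1 y2].
  have /sA : enum_val i != enum_val j by rewrite (inj_eq enum_val_inj).
  move=> /(_ (enum_valP i) (enum_valP j)).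
  rewrite /grid_near -leNgt ler_normr => /orP[]; rewrite ler_normr => ij'; apply/orP.
    by left; lra.
  by right; lra.
split=> //.
- move=> i; rewrite /I /gapI; set e := f _.
  have := rho_gt0 (ltn_ord e.1) => re.
  case: e.2; split; try exact: segment_compact.
    by exists ((enum_val i)%:R * h + h); rewrite /= in_itv/= lexx lerDl ltW.
  by exists ((enum_val i)%:R * h); rewrite /= in_itv/= lexx; move: h0; lra.
- apply/trivIsetP => i j _ _ ij; rewrite -subset0 => z [z1 z2].
  by have := sepI i j ij z z z1 z2; rewrite subrr normr0 leNgt sep0.
- move=> i; rewrite /I /gapI; set e := f _.
  have := rho_gt0 (ltn_ord e.1) => re; have := rho_rmax (ltn_ord e.1) => rm.
  by case: e.2; rewrite itv_length_cc ?lee_fin; move: h0; lra.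
Qed.

Let exceed0_phi (i j : 'I_T) : (i < j)%N ->
  pr P (grid_exceed i 0 `&` grid_exceed j 0) <= phi P Z (rho 0).
Proof.
move=> ij; rewrite /grid_exceed q0.
set E := exceed Z (i%:R * h) _ _; set F := exceed Z (j%:R * h) _ _.
(* A common outcome of both events shows through [exceed_separated] that the two gap intervals are
   disjoint; if there is none, the probability is 0. *)
have [->|/set0P[v [v1 v2]]] := eqVneq (E `&` F) set0.
  by rewrite {1}/pr measure0; exact: phi_ge0.
have ijh : i%:R * h + h <= j%:R * h.
  by rewrite -[X in _ + X]mul1r -mulrDl natr1 ler_pM2r// ler_nat.
have := exceed_separated hge0 (ltW rho0) ijh v1 v2 => sepij.
apply: (@le_trans _ _ (pr P (gap_event Z `[i%:R * h + h, i%:R * h + h + rho 0]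
    `&` gap_event Z `[j%:R * h + h, j%:R * h + h + rho 0]))).
  apply: pr_le; [by apply: measurableI; exact: measurable_exceed|
    by apply: measurableI; exact: measurable_gap_event|].
  by move=> x [[? _] [? _]].
apply: ub_le_sup; first exact: phi_has_ub.
exists `[i%:R * h + h, i%:R * h + h + rho 0], `[j%:R * h + h, j%:R * h + h + rho 0].
split=> //; first by split; exact: segment_compact.
- move=> x y [] /=; rewrite !in_itv/= => /andP[_ x1] /andP[x2 _].
  by exfalso; move: x1 x2 sepij; lra.
- by rewrite itv_length_cc ?lee_fin; move: rho0; lra.
- by rewrite itv_length_cc ?lee_fin; move: rho0; lra.
Qed.

Let bad : set Omega := \big[setU/set0]_(i : 'I_T) \big[setU/set0]_(j : 'I_T)
  (if grid_near i j && (i < j)%N then grid_exceed i 0 `&` grid_exceed j 0 else set0).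

Let mbad_in (i j : 'I_T) : measurable
  (if grid_near i j && (i < j)%N then grid_exceed i 0 `&` grid_exceed j 0 else set0).
Proof. by case: ifP => // _; apply: measurableI; exact: measurable_grid_exceed. Qed.

Let mbad : measurable bad.
Proof. by apply: bigsetU_measurable => i _; apply: bigsetU_measurable. Qed.

Let pbad : pr P bad <= T%:R * (w + w).+1%:R * phi P Z (rho 0).
Proof.
pose F (i : 'I_T) : set Omega := \big[setU/set0]_(j : 'I_T)
  (if grid_near i j && (i < j)%N then grid_exceed i 0 `&` grid_exceed j 0 else set0).
have mF i : measurable (F i) by apply: bigsetU_measurable.
have [_] := @pr_bigcup _ _ _ P _ (index_enum 'I_T) F mF.
move=> /le_trans; apply.
apply: (@le_trans _ _ (\sum_(i < T) (w + w).+1%:R * phi P Z (rho 0))); last first.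
  by rewrite sumr_const card_ord -[leLHS]mulr_natl mulrA.
apply: ler_sum => i _.
have [_] := @pr_bigcup _ _ _ P _ (index_enum 'I_T) _ (mbad_in i).
move=> /le_trans; apply.
apply: (@le_trans _ _ (\sum_(j in [set j | grid_near i j]%SET) phi P Z (rho 0))).
  rewrite big_mkcond [leRHS]big_mkcond/=; apply: ler_sum => j _; rewrite inE.
  case: ifPn => [/andP[-> ij]|_]; first exact: exceed0_phi.
  by rewrite {1}/pr measure0; case: ifP => // _; exact: phi_ge0.
rewrite sumr_const -[leLHS]mulr_natl ler_wpM2r ?phi_ge0// ler_nat.
exact: near_card.
Qed.

Let badE v (i j : 'I_T) : ~ bad v -> i != j -> grid_near i j ->
  weighted_exceed i v * weighted_exceed j v = 0.
Proof.
wlog ij : i j / (i < j)%N => [wl|].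
  move=> bv ne nij; have : (val i != val j)%N by [].
  rewrite neq_ltn => /orP[] ij; first exact: wl.
  by rewrite mulrC; apply: wl => //; [rewrite eq_sym|rewrite near_sym].
move=> bv _ nij; apply/eqP; rewrite mulf_eq0; apply/negPn/negP.
rewrite negb_or => /andP[yi yj]; apply: bv.
have hit (k : 'I_T) : weighted_exceed k v != 0 -> grid_exceed k 0 v.
  move=> yk; apply: contrapT => nk; case/andP: (weighted_exceed01 k v).
  rewrite indicE memNset// => y1 y2; move/eqP: yk; apply.
  by apply/eqP; rewrite eq_le y1 y2.
rewrite /bad (bigD1 i)//=; left; rewrite (bigD1 j)//=; left.
by rewrite nij ij; split; exact: hit.
Qed.

Variables (C alpha b : R).
Hypothesis T0 : (0 < T)%N.
Hypothesis b0 : 0 < b.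
Hypothesis alphaE : G (rho 0) - G (h + rho 0) <= alpha.
Hypothesis alpha1 : alpha <= 1.
Hypothesis aC : T%:R * alpha <= C.
Hypothesis C1 : 1 <= C.

Lemma weighted_mean_bounds J : 0 <= weighted_mean J <= alpha.
Proof.
have step k : 0 <= pr P (grid_exceed J k) - pr P (grid_exceed J k.+1).
  rewrite subr_ge0; apply: pr_le; [exact: measurable_grid_exceed..|].
  exact: grid_exceed_sub.
apply/andP; split.
  by apply: sumr_ge0 => k _; rewrite mulr_ge0//; case/andP: (s01 J k).
apply: le_trans alphaE; rewrite -(pr_grid_exceed J q0).
apply: (@le_trans _ _ (\sum_(k < q) (pr P (grid_exceed J k) - pr P (grid_exceed J k.+1)))).
  by apply: ler_sum => k _; rewrite ler_piMl//; case/andP: (s01 J k).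
rewrite -(big_mkord predT (fun k => pr P (grid_exceed J k) - pr P (grid_exceed J k.+1))).
rewrite (eq_bigr (fun k => - (pr P (grid_exceed J k.+1) - pr P (grid_exceed J k)))).
  by rewrite sumrN telescope_sumr// opprB gerBl pr_ge0.
by move=> k _; rewrite opprB.
Qed.

(** Instance of [separated_comparison] in which gap events at the lowest level dominate, each cell
    has at most 2 w + 1 near cells, and r1 is (2 q) ^ K t because every weighted indicator combines
    2 q gap events. *)
Lemma discrete_comparison :
  `|Ex P (fun v => \prod_J (1 - weighted_exceed J v)) - \prod_J (1 - weighted_mean J)| <=
    2 * (C ^+ K / K`!%:R) +
    K.+1%:R * ((1 + T%:R * G (rho 0)) ^+ K * ((q * 2)%:R ^+ K * t)) +
    K%:R * ((w + w).+1%:R / T%:R * C ^+ K) +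
    K.+1%:R * (b * (T%:R * (w + w).+1%:R * phi P Z (rho 0)) +
      2 * (1 + (T%:R * G (rho 0) + ((K + K) * (w + w).+1)%:R)) ^+ (K + K) / b) +
    T%:R * (w + w).+1%:R * phi P Z (rho 0).
Proof.
have e0 : 'I_q * bool := (Ordinal q0, true).
have cE : #|{: 'I_q * bool}| = (q * 2)%N by rewrite card_prod card_ord card_bool.
have q21 : 1 <= (q * 2)%:R :> R by rewrite ler1n muln_gt0 q0.
have t0 : 0 <= t by case/andP: t01.
have bW J : bmeas (weighted_exceed J).
  apply: bmeas_sum => k _; apply: bmeasZ; apply: bmeasB; apply: bmeas_indic;
    exact: measurable_grid_exceed.
pose Gev (J : 'I_T) := gap_event Z (gapI J (Ordinal q0, true)).
have WG J v : 0 <= weighted_exceed J v <= \1_(Gev J) v.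
  case/andP: (weighted_exceed01 J v) => -> /le_trans; apply.
  rewrite !indicE ler_nat; case: (boolP (v \in grid_exceed J 0)) => //.
  rewrite inE /grid_exceed q0 => -[hv _]; rewrite mem_set//.
rewrite -[in T%:R](card_ord T).
apply: (@separated_comparison _ _ _ P _ grid_near near_refl near_sym (w + w).+1 Gev
  weighted_exceed weighted_mean near_card _ bW WG bad mbad badE K _ (G (rho 0)) alpha) => //.
- by move=> J; exact: measurable_gap_event.
- by rewrite card_ord.
- exact: ltW.
- by rewrite mulr_ge0// exprn_ge0.
- move=> A sA cA.
  under eq_fun do under eq_bigr do rewrite weighted_exceedE.
  under [X in _ - X]eq_bigr do rewrite weighted_meanE.
  apply: le_trans (Ex_linear_products hZ e0 coef1 (r := t * G (rho 0) ^+ #|A|) _) _.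
    by move=> f; apply: split_set => //; rewrite (leq_trans cA)// leq_addr.
  rewrite cE mulrA; apply: ler_wpM2r; first by rewrite exprn_ge0// ltW.
  by apply: ler_wpM2r => //; exact: ler_weXn2l.
- move=> A sA cA.
  have := @split_set A (fun=> (Ordinal q0, true)) sA cA.
  rewrite ler_norml => /andP[_]; rewrite lerBlDr => /le_trans; apply.
  rewrite mulr_natl mulr2n lerD//.
    by apply: ler_piMl; [rewrite exprn_ge0// ltW|case/andP: t01].
  rewrite -prodr_const; apply: ler_prod => j _.
  by have /andP[/ltW -> ->] := gap_pr_le j (Ordinal q0, true).
- exact: weighted_mean_bounds.
- by rewrite card_ord.
- by rewrite card_ord.
Qed.

End discretised_exceedances.

Lemma near_powR_small {R : realType} (c a tol : R) : 0 < a -> 0 < tol ->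
  \forall L \near +oo, c * L `^ (- a) <= tol.
Proof.
move=> a0 tol0; near=> L.
have L1 : 1 < L by near: L; apply: nbhs_pinfty_gt; exact: num_real.
have L0 : 0 < L by lra.
have p0 := powR_gt0 (- a) L0.
have [c0|c0] := lerP c 0; first by nra.
rewrite -ler_pdivlMl// -[leRHS]lnK ?posrE ?mulr_gt0 ?invr_gt0//.
rewrite /powR gt_eqF// ler_expR mulNr.
have : - ln (c^-1 * tol) / a <= ln L by near: L; exact: near_ln_ge.
rewrite ler_pdivrMr//; lra.
Unshelve. all: by end_near.
Qed.

Lemma near_all_lt {R : realType} n (Q : nat -> R -> Prop) :
  (forall b, (b < n)%N -> \forall L \near +oo, Q b L) ->
  \forall L \near +oo, forall b, (b < n)%N -> Q b L.
Proof.
elim: n => [|n ih] h; first by near=> L.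
have h1 : \forall L \near +oo, forall b, (b < n)%N -> Q b L.
  by apply: ih => b bn; apply: h; exact: ltnW.
have h2 := h _ (ltnSn n).
near=> L => b; rewrite ltnS leq_eqVlt => /orP[/eqP ->|].
  by near: L.
by move: b; near: L.
Unshelve. all: by end_near.
Qed.

Lemma exists_exp_coeff_small {R : realType} (x tol : R) : 0 < tol ->
  exists K : nat, 2 * (x ^+ K / K`!%:R) <= tol.
Proof.
move=> tol0; have := cvg_series_cvg_0 (is_cvg_series_exp_coeff x).
move/cvgrPdist_le => /(_ (tol / 2)); rewrite divr_gt0// => /(_ isT)[K _ /(_ K)].
move=> /(_ (leqnn K)); rewrite sub0r normrN => h; exists K.
have := le_trans (ler_norm _) h; rewrite /exp_coeff/=; lra.
Qed.

(** * Levels and clustering as L tends to infinity *)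

Section asymptotic_comparison.
Context {R : realType} {d : measure_display} {Omega : measurableType d}.
Variables (P : probability Omega R) (Z : Omega -> set R).
Hypotheses (hZ : point_process Z) (hstat : stationary P Z).
Hypotheses (h1 : gap_decay P Z) (h2 : regularity P Z) (h3 : splitting P Z)
  (h5 : absence_of_clustering P Z).
Local Notation G := (gap_prob P Z).
Local Notation g := (fun r => - derive1 G r).

Lemma gap_prob01 r : 0 <= G r <= 1.
Proof. by rewrite gap_prob_ge0 gap_prob_le1. Qed.

Lemma gap_prob_gt0 r : 0 < G r.
Proof.
have [B hB] := near_pinfty_and (ln_gap_prob_decay h1 0).
have [_ + _ _] : [/\ 1 < Num.max r (B + 1), 0 < G (Num.max r (B + 1)),
  ln (G (Num.max r (B + 1))) < 0 &
  0 * ln (Num.max r (B + 1)) <= - ln (G (Num.max r (B + 1)))].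
  by apply: hB; rewrite lt_max; apply/orP; right; lra.
move=> /lt_le_trans; apply; apply: gap_prob_nincr => //.
by rewrite le_max lexx.
Qed.

Let dG : forall r, 0 < r -> derivable G r 1 /\ derivable (derive1 G) r 1.
Proof. by case: h2. Qed.
Let cG : convex_function (`[0, +oo[%classic : set R) G.
Proof. by case: h2. Qed.
Let hlog : ln (g r) / ln (G r) @[r --> +oo] --> (1 : R).
Proof. by case: h2. Qed.
Let hG2 : exists e : R -> R, e r @[r --> +oo] --> (0 : R) /\
  \forall r \near +oo,
    (lne (derive1n 2 G r)%:E <= (ln (G r) * (1 + e r))%:E)%E.
Proof. by case: h2. Qed.

Let G_nincr := gap_prob_nincr P hZ.

Variables (q : nat) (u : nat -> R).
Hypothesis q0 : (0 < q)%N.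
Hypothesis u0 : forall b, (b < q)%N -> 0 < u b.
Hypothesis u_ni : forall b c, (b <= c < q)%N -> u c <= u b.

Definition level (L : R) (b : nat) : R := gap_level G (u b) L.

Lemma near_level : \forall L \near +oo, forall b, (b < q)%N ->
  [/\ 1 < level L b, g (level L b) = u b / L &
      forall x, 0 < x -> (g x < u b / L) = (level L b < x)].
Proof.
apply: near_all_lt => b bq; near=> L.
have [_ e1 e2] : [/\ 0 < gap_level G (u b) L, g (gap_level G (u b) L) = u b / L &
  forall x, 0 < x -> (g x < u b / L) = (gap_level G (u b) L < x)].
  near: L; apply: gap_levelP => //; [exact: gap_prob01|exact: u0].
have [l1 _] : 1 < gap_level G (u b) L /\ ln (gap_level G (u b) L) <= 1 * ln L.
  near: L; apply: ln_gap_level => //; [exact: gap_prob01|exact: u0].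
by [].
Unshelve. all: by end_near.
Qed.

Lemma near_level_le (k : R) : 0 < k -> \forall L \near +oo,
  forall b, (b < q)%N -> level L b <= L `^ k.
Proof.
move=> k0; apply: near_all_lt => b bq; near=> L.
have L0 : 0 < L by near: L; apply: nbhs_pinfty_gt; exact: num_real.
have [l1 l2] : 1 < gap_level G (u b) L /\ ln (gap_level G (u b) L) <= k * ln L.
  near: L; apply: ln_gap_level => //; [exact: gap_prob01|exact: u0].
rewrite /level -[leLHS]lnK ?posrE; last lra.
by rewrite /powR gt_eqF// ler_expR.
Unshelve. all: by end_near.
Qed.

Lemma near_gap_prob_level (k : R) : 0 < k -> k <= 1 -> \forall L \near +oo,
  G (level L 0) <= L `^ (- 1 + k).
Proof.
move=> k0 k1; near=> L.
have L0 : 0 < L by near: L; apply: nbhs_pinfty_gt; exact: num_real.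
have [Gr /andP[_ l2]] : 0 < G (gap_level G (u 0%N) L) /\
   - ((1 + k) * ln L) <= ln (G (gap_level G (u 0%N) L)) <= - ((1 - k) * ln L).
  near: L; apply: ln_gap_prob_level => //; [exact: gap_prob01|exact: u0].
rewrite /level -[leLHS]lnK ?posrE// /powR gt_eqF// ler_expR; lra.
Unshelve. all: by end_near.
Qed.

Lemma near_phi_level : exists2 eta : R, 0 < eta <= 1 & \forall L \near +oo,
  phi P Z (level L 0) <= L `^ (- 1 - eta / 4).
Proof.
have [eta0 [eta00 [e [e0 he]]]] := h5.
(* With eta at most 1 the final comparison of exponents has the nonnegative slack eta * (2 - eta) /
   16. *)
pose eta := Num.min eta0 1.
have eta_gt : 0 < eta by rewrite lt_min eta00 ltr01.
have eta1 : eta <= 1 by rewrite ge_min lexx orbT.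
have etale : eta <= eta0 by rewrite ge_min lexx.
exists eta; first by rewrite eta_gt.
have k0 : 0 < eta / 8 by rewrite divr_gt0.
have hE : \forall r \near +oo, `|0 - e r| <= eta / 2.
  by move/cvgrPdist_le : e0; apply; rewrite divr_gt0.
near=> L.
have L0 : 0 < L by near: L; apply: nbhs_pinfty_gt; exact: num_real.
have [Gr /andP[_ l2]] : 0 < G (gap_level G (u 0%N) L) /\
   - ((1 + eta / 8) * ln L) <= ln (G (gap_level G (u 0%N) L)) <=
   - ((1 - eta / 8) * ln L).
  near: L; apply: ln_gap_prob_level => //; [exact: gap_prob01|exact: u0|lra].
have : phi P Z (level L 0) <= G (level L 0) `^ (1 + eta0 + e (level L 0)).
  by near: L; have := near_gap_level gap_prob01 dG cG h1 hlog (u0 q0) he.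
move=> /le_trans; apply.
have : `|0 - e (level L 0)| <= eta / 2.
  by near: L; have := near_gap_level gap_prob01 dG cG h1 hlog (u0 q0) hE.
rewrite sub0r normrN ler_norml => /andP[el _].
rewrite /powR !gt_eqF// ler_expR.
have l1 : 1 <= ln L by near: L; exact: near_ln_ge.
move: l2 el; rewrite -/(level L 0).
move: (ln (G _)) (ln L) l1 (e _) => x l l1 y l2 el.
have pl : 0 <= (1 - eta / 8) * l by apply: mulr_ge0; lra.
have x0 : x <= 0 by lra.
have : (1 + eta0 + y) * x <= (1 + eta / 2) * x by rewrite ler_wnM2r//; lra.
move=> /le_trans; apply.
have : (1 + eta / 2) * x <= (1 + eta / 2) * - ((1 - eta / 8) * l).
  by rewrite ler_pM2l//; lra.
move=> /le_trans; apply; rewrite -subr_ge0.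
have -> : (- 1 - eta / 4) * l - (1 + eta / 2) * - ((1 - eta / 8) * l) =
  l * (eta * (2 - eta)) / 16 by field.
by rewrite divr_ge0// mulr_ge0 ?mulr_ge0//; lra.
Unshelve. all: by end_near.
Qed.

Lemma power_asymptotic_cst (a : R) : power_asymptotic a (fun L : R => L `^ a).
Proof.
exists (fun=> 0); split; first exact: cvg_cst.
by near=> L; rewrite addr0.
Unshelve. all: by end_near.
Qed.

Lemma level_nd L : 0 < L ->
  (forall b, (b < q)%N -> [/\ 1 < level L b, g (level L b) = u b / L &
      forall x, 0 < x -> (g x < u b / L) = (level L b < x)]) ->
  forall b c, (b <= c < q)%N -> level L b <= level L c.
Proof.
move=> L0 hl b c /andP[bc cq]; have bq := leq_ltn_trans bc cq.
have [b1 be _] := hl b bq; have [_ _ ch] := hl c cq.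
rewrite leNgt -ch; last by lra.
by rewrite be -leNgt ler_pM2r ?invr_gt0// u_ni// bc.
Qed.

(** The gap intervals exceed the highest level by at most one mesh, hence the summand 1: this is the
    length r fed to the splitting hypothesis. *)
Lemma power_asymptotic_level : power_asymptotic 0 (fun L : R => level L q.-1 + 1).
Proof.
have qq : (q.-1 < q)%N by rewrite ltn_predL.
exists (fun L => ln (level L q.-1 + 1) / ln L); split; last first.
  near=> L.
  have L0 : 0 < L by near: L; apply: nbhs_pinfty_gt; exact: num_real.
  have l1 : 1 <= ln L by near: L; exact: near_ln_ge.
  have hl : forall b, (b < q)%N -> [/\ 1 < level L b, g (level L b) = u b / L &
      forall x, 0 < x -> (g x < u b / L) = (level L b < x)].
    by near: L; exact: near_level.
  have [r1 _ _] := hl _ qq.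
  rewrite add0r /powR gt_eqF// divfK; last by rewrite gt_eqF//; lra.
  by rewrite lnK// posrE; lra.
apply/cvgrPdist_le => e e0; near=> L; rewrite sub0r normrN.
have L0 : 0 < L by near: L; apply: nbhs_pinfty_gt; exact: num_real.
have l1 : 1 <= ln L by near: L; exact: near_ln_ge.
have hl : forall b, (b < q)%N -> [/\ 1 < level L b, g (level L b) = u b / L &
      forall x, 0 < x -> (g x < u b / L) = (level L b < x)].
    by near: L; exact: near_level.
have [r1 _ _] := hl _ qq.
have rl : level L q.-1 <= L `^ (e / 2).
  have : forall b, (b < q)%N -> level L b <= L `^ (e / 2).
    by near: L; apply: near_level_le; rewrite divr_gt0.
  exact.
rewrite ger0_norm; last by rewrite divr_ge0 ?ln_ge0//; lra.
rewrite ler_pdivrMr; last by lra.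
have : ln (level L q.-1 + 1) <= ln (2 * L `^ (e / 2)).
  rewrite ler_ln ?posrE ?mulr_gt0 ?powR_gt0//; lra.
rewrite lnM ?posrE ?powR_gt0// ln_powR => /le_trans; apply.
have : ln 2 * 2 / e <= ln L by near: L; exact: near_ln_ge.
rewrite ler_pdivrMr//; lra.
Unshelve. all: by end_near.
Qed.

End asymptotic_comparison.

(** * Choice of the exponents *)

Section asymptotic_comparison_bound.
Context {R : realType} {d : measure_display} {Omega : measurableType d}.
Variables (P : probability Omega R) (Z : Omega -> set R).
Hypotheses (hZ : point_process Z) (hstat : stationary P Z).
Hypotheses (h1 : gap_decay P Z) (h2 : regularity P Z) (h3 : splitting P Z)
  (h5 : absence_of_clustering P Z).
Local Notation G := (gap_prob P Z).
Local Notation g := (fun r => - derive1 G r).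
Variables (q : nat) (u : nat -> R).
Hypothesis q0 : (0 < q)%N.
Hypothesis u0 : forall b, (b < q)%N -> 0 < u b.
Hypothesis u_ni : forall b c, (b <= c < q)%N -> u c <= u b.
Local Notation level := (level P Z u).

Let powM (L a b : R) : 0 < L -> L `^ a * L `^ b = L `^ (a + b).
Proof. by move=> L0; rewrite powRD//; apply/implyP => _; rewrite gt_eqF. Qed.

Let powX (L a : R) n : (L `^ a) ^+ n = L `^ (a * n%:R).
Proof. by rewrite -powR_mulrn ?powR_ge0// powRrM. Qed.

(** Up to constants there are L ^ (1 + eps) cells, at most L ^ (2 delta) of them near a given one; T
    * G is at most L ^ (2 eps), and two near cells are both hit with probability at most L ^ (-1 -
    eta / 4). The choice b = L ^ (eta / 8) balances the two terms of [pow_split]: b times the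
    probability of a bad pair and the moment of order 2 K divided by b both decay. *)
Lemma asymptotic_comparison (c0 tol : R) : 1 <= c0 -> 0 < tol ->
  exists2 eps : R, 0 < eps <= 2^-1 & \forall L \near +oo,
  forall (T : nat) (s : 'I_T -> nat -> R),
    L `^ (1 + eps) <= T%:R <= c0 * L `^ (1 + eps) ->
    (forall J b, 0 <= s J b <= 1) ->
    `|Ex P (fun v => \prod_J (1 - weighted_exceed Z (L / T%:R) q (level L) s J v)) -
      \prod_J (1 - weighted_mean P Z (L / T%:R) q (level L) s J)| <= tol.
Proof.
move=> c01 tol0.
pose C := 1 + u 0%N.
have u00 := u0 q0.
have tol5 : 0 < tol / 5 by rewrite divr_gt0.
(* K comes first, from the factorial decay of the Bonferroni remainder; the means sum to at most
   C. *)
have [K hK] := exists_exp_coeff_small C tol5.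
have [eta /andP[eta0 eta1] hphi] := near_phi_level hZ h1 h2 h5 q0 u0.
have K1 : 0 < K.+1%:R :> R by rewrite ltr0n.
(* The moment of order 2 K is of order L ^ (4 K delta), and 4 K delta is at most eta / 16, half of
   the exponent of b. *)
pose delta := eta / (64 * K.+1%:R).
have delta0 : 0 < delta by rewrite divr_gt0// mulr_gt0.
have dK : delta * K.+1%:R = eta / 64 by rewrite /delta; field; rewrite gt_eqF.
have K1' : 1 <= K.+1%:R :> R by rewrite ler1n.
have deltaK : delta <= eta / 64 by rewrite -dK ler_peMr// ltW.
have deltaK' : delta * K%:R <= eta / 64.
  by rewrite -dK ler_pM2l// ler_nat.
have [delta' delta'0 hsplit] := splitting_products h3 (K + K) delta0.
(* The mesh comes last: the K-th power of T * G, of order L ^ (2 K eps), must be beaten by the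
   splitting rate L ^ (- delta'). *)
pose eps := Num.min (delta / 2) (delta' / (4 * K.+1%:R)).
have eps0 : 0 < eps by rewrite lt_min !divr_gt0// mulr_gt0.
have epsd : eps <= delta / 2 by rewrite ge_min lexx.
have epsd' : eps * K.+1%:R <= delta' / 4.
  have -> : delta' / 4 = delta' / (4 * K.+1%:R) * K.+1%:R.
    by field; rewrite gt_eqF.
  by rewrite ler_pM2r// ge_min lexx orbT.
have epsd'' : eps * K%:R <= delta' / 4.
  by apply: le_trans epsd'; rewrite ler_pM2l// ler_nat.
have eps1 : eps <= 1 by lra.
exists eps; first by rewrite eps0; lra.
have c00 : 0 <= c0 by lra.
have c0p : 0 < c0 by lra.
have c0s : 0 <= 1 + c0 by lra.
have x1 : 1 + delta + 2 * delta + (- 1 - eta / 4) <= - (3 * eta / 16) by lra.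
have x2 : 2 * eps * K%:R + - delta' <= - (delta' / 2) by lra.
have x3 : 2 * delta <= - 2^-1 + 1 by lra.
have x4 : 2 * eps <= 2 * delta by lra.
have x4' : 1 + eps <= 1 + delta by lra.
have x5 : eta / 8 + - (3 * eta / 16) <= - (eta / 16) by lra.
have x6 : 2 * delta * (K + K)%:R + - (eta / 8) <= - (eta / 16).
  by rewrite natrD; lra.
have x7 : 1 + eps <= delta + 1 by lra.
have x8 : 1 <= 1 + eps by lra.
have uC : 0 <= C by rewrite /C addr_ge0// ltW.
have y1 (x l : R) : l <= x -> 1 <= x -> x + (l + 1) <= 3 * x by lra.
have y2 (v y z : R) : v <= y + 1 -> y <= 3 * c0 * z -> 1 <= c0 * z ->
  v + v + 1 <= 9 * c0 * z by lra.
have y3 (y z : R) : y <= c0 * z -> 1 <= z -> 1 + y <= (1 + c0) * z by lra.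
have y4 (k v y z : R) : y <= c0 * z -> 1 <= z -> v <= k * z ->
  1 + (y + v) <= (1 + c0 + k) * z by lra.
have y5 (z1 z2 z3 z4 z5 : R) : z1 <= tol / 5 -> z2 <= tol / 5 -> z3 <= tol / 5 ->
  z4 <= tol / 5 -> z5 <= tol / 5 -> z1 + z2 + z3 + z4 + z5 <= tol by lra.
have r_asym := power_asymptotic_level hZ h1 h2 q0 u0.
have s_asym := @power_asymptotic_cst R delta.
have hs := hsplit _ _ r_asym s_asym.
near=> L => T s /andP[TL1 TL2] s01.
have L1 : 1 < L by near: L; apply: nbhs_pinfty_gt; exact: num_real.
have L0 : 0 < L := lt_trans ltr01 L1.
have pw1 a : 0 < a -> 1 <= L `^ a.
  by move=> a0; rewrite -(powRr0 L) ler_powR ?(ltW L1)// ltW.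
have pwle a b : a <= b -> L `^ a <= L `^ b by move=> ab; rewrite ler_powR ?(ltW L1).
have T0 : 0 < T%:R :> R by apply: lt_le_trans TL1; exact: powR_gt0.
pose h := L / T%:R.
have hpos : 0 < h by rewrite divr_gt0.
have LT : L <= T%:R.
  by apply: le_trans TL1; rewrite -{1}(powRr1 (ltW L0)) pwle.
have hle1 : h <= 1 by rewrite ler_pdivrMr// mul1r.
have hl : forall b, (b < q)%N -> [/\ 1 < level L b, g (level L b) = u b / L &
      forall x, 0 < x -> (g x < u b / L) = (level L b < x)].
  by near: L; exact: near_level.
have lnd := level_nd u_ni L0 hl.
have qq : (q.-1 < q)%N by rewrite ltn_predL.
have [l01 l0g _] := hl 0%N q0.
have rho0 : 0 < level L 0 := lt_trans ltr01 l01.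
have rrmax b : (b < q)%N -> h + level L b <= level L q.-1 + 1.
  move=> bq; rewrite addrC lerD// lnd//; rewrite qq andbT.
  by rewrite -ltnS prednK.
pose w := (Num.truncn ((L `^ delta + (level L q.-1 + 1)) / h)).+1.
have hw : L `^ delta + (level L q.-1 + 1) <= w%:R * h.
  by rewrite -ler_pdivrMr// ltW// truncnS_gt.
have sep0 : 0 < L `^ delta by rewrite powR_gt0.
have t01 : 0 <= L `^ (- delta') <= 1.
  by rewrite powR_ge0/= -[leRHS](powRr0 L) pwle// oppr_le0 ltW.
have hS : forall k (I : 'I_k -> interval R), (k <= K + K)%N ->
  separated_family (level L q.-1 + 1) (L `^ delta) I ->
  (forall i, 0 < pr P (gap_event Z (I i))) ->
  `|pr P (\bigcap_i gap_event Z (I i)) - \prod_i pr P (gap_event Z (I i))| <=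
     L `^ (- delta') * \prod_i pr P (gap_event Z (I i)).
  by near: L; exact: hs.
have alphaE : G (level L 0) - G (h + level L 0) <= u 0%N / T%:R.
  have [dG cG _ _] := h2.
  have /andP[_] := increment_bounds dG cG rho0 (ltW hpos).
  rewrite [_ + h]addrC l0g => /le_trans; apply.
  by rewrite le_eqVlt; apply/orP; left; apply/eqP; rewrite /h; field; rewrite !gt_eqF.
have Tu : u 0%N <= T%:R.
  by apply: le_trans LT; near: L; apply: nbhs_pinfty_ge; exact: num_real.
have alpha1 : u 0%N / T%:R <= 1 by rewrite ler_pdivrMr// mul1r.
have aC : T%:R * (u 0%N / T%:R) <= C by rewrite mulrC divfK ?gt_eqF// /C lerDr.
have C1 : 1 <= C by rewrite /C lerDl ltW.
have b0 : 0 < L `^ (eta / 8) by rewrite powR_gt0.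
have Tn0 : (0 < T)%N by rewrite -(ltr0n R).
have := discrete_comparison hZ hstat (gap_prob_gt0 hZ h1) hpos q0 rho0 lnd s01 sep0
  rrmax hw t01 hS Tn0 b0 alphaE alpha1 aC C1.
set W := (w + w).+1%:R; set F := phi P Z _; set Q := G (level L 0).
move=> /le_trans; apply.
have F0 : 0 <= F by exact: phi_ge0.
have W0 : 0 <= W by rewrite ler0n.
have Q0 : 0 <= Q by exact: gap_prob_ge0.
have Fle : F <= L `^ (- 1 - eta / 4) by rewrite /F; near: L.
have Qle : Q <= L `^ (- 1 + eps).
  rewrite /Q; near: L.
  exact: (near_gap_prob_level hZ h1 h2 q0 u0 eps0 eps1).
have lq : level L q.-1 <= L `^ delta.
  have : forall b, (b < q)%N -> level L b <= L `^ delta.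
    by near: L; exact: near_level_le.
  exact.
have d1 : 1 <= L `^ delta by apply: pw1.
have [lq1 _ _] := hl _ qq.
have Tle : T%:R <= c0 * L `^ (1 + delta).
  by apply: le_trans TL2 _; rewrite ler_pM2l ?pwle.
have hinv : h^-1 <= c0 * L `^ delta.
  rewrite /h invf_div ler_pdivrMr// (le_trans TL2)// -mulrA.
  rewrite ler_pM2l//.
  by rewrite -[X in _ * X](powRr1 (ltW L0)) powM// pwle.
have Wle : W <= 9 * c0 * L `^ (2 * delta).
  have wle : w%:R <= (L `^ delta + (level L q.-1 + 1)) / h + 1.
    rewrite /w -natr1 lerD2r truncn_le; apply: divr_ge0; last exact: ltW.
    by rewrite !addr_ge0// ?powR_ge0// ltW// (lt_trans ltr01 lq1).
  have b1 : (L `^ delta + (level L q.-1 + 1)) / h <= 3 * L `^ delta * (c0 * L `^ delta).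
    apply: ler_pM => //; [|by rewrite invr_ge0 ltW|].
      by rewrite !addr_ge0// ?powR_ge0// ltW// (lt_trans ltr01 lq1).
    exact: y1.
  have b2 : 3 * L `^ delta * (c0 * L `^ delta) = 3 * c0 * L `^ (2 * delta).
    by rewrite mulrACA powM// (_ : delta + delta = 2 * delta)//; ring.
  have b3 : 1 <= c0 * L `^ (2 * delta).
    by apply: mulr_ege1 => //; apply: pw1; rewrite mulr_gt0.
  by rewrite /W -natr1 natrD; apply: (y2 _ _ _ wle) => //; rewrite -b2.
have TQ : T%:R * Q <= c0 * L `^ (2 * eps).
  apply: (@le_trans _ _ (c0 * L `^ (1 + eps) * L `^ (- 1 + eps))).
    by apply: ler_pM.
  by rewrite -mulrA powM// (_ : 1 + eps + (- 1 + eps) = 2 * eps)//; ring.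
have TWF : T%:R * W * F <= 9 * c0 ^+ 2 * L `^ (- (3 * eta / 16)).
  apply: (@le_trans _ _ (c0 * L `^ (1 + delta) * (9 * c0 * L `^ (2 * delta)) *
      L `^ (- 1 - eta / 4))).
    by apply: ler_pM => //; [exact: mulr_ge0|exact: ler_pM].
  have -> : c0 * L `^ (1 + delta) * (9 * c0 * L `^ (2 * delta)) * L `^ (- 1 - eta / 4)
    = 9 * c0 ^+ 2 * (L `^ (1 + delta) * L `^ (2 * delta) * L `^ (- 1 - eta / 4)) by ring.
  rewrite !powM//; apply: ler_wpM2l; first by rewrite mulr_ge0 ?exprn_ge0.
  exact: pwle.
have TWF0 : 0 <= T%:R * W * F by rewrite !mulr_ge0// ltW.
have t2 : K.+1%:R * ((1 + T%:R * Q) ^+ K * ((q * 2)%:R ^+ K * L `^ (- delta'))) <= tol / 5.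
  apply: (@le_trans _ _ (K.+1%:R * (((1 + c0) * L `^ (2 * eps)) ^+ K *
     ((q * 2)%:R ^+ K * L `^ (- delta'))))).
    rewrite ler_pM2l//; apply: ler_wpM2r; first by rewrite mulr_ge0 ?exprn_ge0 ?powR_ge0.
    rewrite lerXn2r ?nnegrE//.
    - by rewrite addr_ge0// mulr_ge0// ltW.
    - by rewrite mulr_ge0 ?powR_ge0.
    - have : 1 <= L `^ (2 * eps) by apply: pw1; rewrite mulr_gt0.
      exact: y3.
  rewrite exprMn powX.
  have -> : K.+1%:R * ((1 + c0) ^+ K * L `^ (2 * eps * K%:R) *
     ((q * 2)%:R ^+ K * L `^ (- delta'))) =
    (K.+1%:R * (1 + c0) ^+ K * (q * 2)%:R ^+ K) *
     (L `^ (2 * eps * K%:R) * L `^ (- delta')) by ring.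
  rewrite powM//.
  apply: (@le_trans _ _ ((K.+1%:R * (1 + c0) ^+ K * (q * 2)%:R ^+ K) * L `^ (- (delta' / 2)))).
    apply: ler_wpM2l; last exact: pwle.
    by rewrite !mulr_ge0 ?exprn_ge0.
  by near: L; apply: near_powR_small => //; rewrite divr_gt0.
have t3 : K%:R * (W / T%:R * C ^+ K) <= tol / 5.
  apply: (@le_trans _ _ (K%:R * (9 * c0 * L `^ (- 2^-1) * C ^+ K))).
    apply: ler_wpM2l => //; apply: ler_wpM2r; first by rewrite exprn_ge0.
    rewrite ler_pdivrMr// (le_trans Wle)// -(mulrA (9 * c0)).
    apply: ler_wpM2l; first by rewrite mulr_ge0.
    apply: (@le_trans _ _ (L `^ (- 2^-1) * L `^ 1)).
      by rewrite powM// pwle.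
    by rewrite (powRr1 (ltW L0)); apply: ler_wpM2l; rewrite ?powR_ge0.
  have -> : K%:R * (9 * c0 * L `^ (- 2^-1) * C ^+ K) =
     (K%:R * (9 * c0) * C ^+ K) * L `^ (- 2^-1) by ring.
  by near: L; apply: near_powR_small.
have t5 : T%:R * W * F <= tol / 5.
  apply: (le_trans TWF); near: L; apply: near_powR_small => //.
  by rewrite divr_gt0// mulr_gt0.
have t4 : K.+1%:R * (L `^ (eta / 8) * (T%:R * W * F) +
      2 * (1 + (T%:R * Q + ((K + K) * (w + w).+1)%:R)) ^+ (K + K) / L `^ (eta / 8)) <= tol / 5.
  pose c1 := 1 + c0 + (K + K)%:R * (9 * c0).
  have c10 : 0 <= c1 by rewrite /c1 addr_ge0 ?mulr_ge0.
  have M1 : 1 + (T%:R * Q + ((K + K) * (w + w).+1)%:R) <= c1 * L `^ (2 * delta).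
    rewrite natrM -/W /c1.
    have : (K + K)%:R * W <= (K + K)%:R * (9 * c0) * L `^ (2 * delta).
      by rewrite -mulrA ler_wpM2l.
    have : 1 <= L `^ (2 * delta) by apply: pw1; rewrite mulr_gt0.
    have : T%:R * Q <= c0 * L `^ (2 * delta).
      by apply: le_trans TQ _; rewrite ler_pM2l ?pwle.
    by move=> q1 q2 q3; exact: y4.
  have M0 : 0 <= 1 + (T%:R * Q + ((K + K) * (w + w).+1)%:R).
    by rewrite !addr_ge0// mulr_ge0// ltW.
  have p1 : L `^ (eta / 8) * (T%:R * W * F) <= 9 * c0 ^+ 2 * L `^ (- (eta / 16)).
    apply: (@le_trans _ _ (L `^ (eta / 8) * (9 * c0 ^+ 2 * L `^ (- (3 * eta / 16))))).
      by rewrite ler_pM2l.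
    rewrite mulrCA powM//; apply: ler_wpM2l; first by rewrite mulr_ge0 ?exprn_ge0.
    exact: pwle.
  have p2 : 2 * (1 + (T%:R * Q + ((K + K) * (w + w).+1)%:R)) ^+ (K + K) / L `^ (eta / 8) <=
      2 * c1 ^+ (K + K) * L `^ (- (eta / 16)).
    rewrite -powRN -!mulrA; apply: ler_wpM2l => //.
    apply: (@le_trans _ _ ((c1 * L `^ (2 * delta)) ^+ (K + K) * L `^ (- (eta / 8)))).
      apply: ler_wpM2r; first exact: powR_ge0.
      by rewrite lerXn2r ?nnegrE// mulr_ge0// powR_ge0.
    rewrite exprMn powX -(mulrA (c1 ^+ _)) powM//; apply: ler_wpM2l; first exact: exprn_ge0.
    exact: pwle.
  apply: (@le_trans _ _ ((K.+1%:R * (9 * c0 ^+ 2 + 2 * c1 ^+ (K + K))) * L `^ (- (eta / 16)))).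
    by rewrite -(mulrA K.+1%:R) ler_pM2l// [leRHS]mulrDl lerD.
  by near: L; apply: near_powR_small => //; rewrite divr_gt0.
exact: y5.
Unshelve. all: by end_near.
Qed.

End asymptotic_comparison_bound.

Lemma prod_dist_le {R : realDomainType} (I : Type) (r : seq I) (x y : I -> R) :
  (forall i, 0 <= x i <= 1) -> (forall i, 0 <= y i <= 1) ->
  `|\prod_(i <- r) x i - \prod_(i <- r) y i| <= \sum_(i <- r) `|x i - y i|.
Proof.
move=> x01 y01; elim: r => [|i r ih]; first by rewrite !big_nil subrr normr0.
rewrite !big_cons.
have -> : x i * \prod_(j <- r) x j - y i * \prod_(j <- r) y j =
  (x i - y i) * \prod_(j <- r) x j + y i * (\prod_(j <- r) x j - \prod_(j <- r) y j).
  by ring.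
rewrite (le_trans (ler_normD _ _))// !normrM lerD//.
  rewrite ler_piMr// ger0_norm ?prodr_ile1// prodr_ge0// => j _.
  by case/andP: (x01 j).
apply: le_trans ih; rewrite ler_piMl//.
by case/andP: (y01 i) => y0 y1; rewrite ger0_norm.
Qed.

Lemma expR_quadratic {R : realType} (a : R) : 0 <= a <= 1 ->
  `|1 - a - expR (- a)| <= a ^+ 2.
Proof.
move=> /andP[a0 a1].
have e1 := expR_ge1Dx (- a); have e2 := expR_ge1Dx a.
have e3 : expR (- a) <= 1 - a + a ^+ 2.
  rewrite expRN -[leLHS]mul1r ler_pdivrMr ?expR_gt0//.
  apply: (@le_trans _ _ ((1 - a + a ^+ 2) * (1 + a))).
    have -> : (1 - a + a ^+ 2) * (1 + a) = 1 + a ^+ 3 by ring.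
    by rewrite lerDl exprn_ge0.
  by rewrite ler_wpM2l// addr_ge0 ?sqr_ge0// subr_ge0.
by rewrite ler_norml; apply/andP; split; lra.
Qed.

Lemma expR_dist {R : realType} (x y : R) : 0 <= x -> 0 <= y ->
  `|expR (- x) - expR (- y)| <= `|x - y|.
Proof.
wlog xy : x y / x <= y => [wl|].
  have [|/ltW] := leP x y; first exact: wl.
  by move=> yx x0 y0; rewrite distrC (distrC x); exact: wl.
move=> x0 y0; rewrite ger0_norm ?subr_ge0 ?ler_expR ?lerN2//.
rewrite distrC (ger0_norm (x := y - x)) ?subr_ge0//.
have -> : - y = - x + (x - y) by ring.
rewrite expRD -{1}[expR (- x)]mulr1 -mulrBr.
have e1 := expR_ge1Dx (x - y).
have e0 : expR (- x) <= 1 by rewrite -expR0 ler_expR oppr_le0.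
apply: (@le_trans _ _ (1 - expR (x - y))); last lra.
rewrite ler_piMl// subr_ge0 -expR0 ler_expR; lra.
Qed.

(** * Means of the grid counts *)

Section grid_means.
Context {R : realType} {d : measure_display} {Omega : measurableType d}.
Variables (P : probability Omega R) (Z : Omega -> set R).
Hypotheses (hZ : point_process Z) (hstat : stationary P Z).
Hypotheses (h1 : gap_decay P Z) (h2 : regularity P Z) (h3 : splitting P Z)
  (h5 : absence_of_clustering P Z).
Local Notation G := (gap_prob P Z).
Local Notation g := (fun r => - derive1 G r).
Variables (q : nat) (u : nat -> R).
Hypothesis q0 : (0 < q)%N.
Hypothesis u0 : forall b, (b < q)%N -> 0 < u b.
Hypothesis u_ni : forall b c, (b <= c < q)%N -> u c <= u b.
Hypothesis uq : u q = 0.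
Local Notation level := (level P Z u).

Let u_ge0 b : (b <= q)%N -> 0 <= u b.
Proof. by rewrite leq_eqVlt => /orP[/eqP ->|/u0/ltW//]; rewrite uq. Qed.

Let u_step b : (b < q)%N -> u b.+1 <= u b.
Proof.
move=> bq; have [b1|] := ltnP b.+1 q; first by rewrite u_ni// leqnSn.
by move=> h; rewrite (_ : b.+1 = q) ?uq ?u_ge0 1?ltnW//; apply/eqP; rewrite eqn_leq bq.
Qed.

Let near_flat (eps tol : R) : 0 < eps <= 2^-1 -> 0 < tol -> \forall L \near +oo,
  forall b, (b < q)%N -> forall h, 0 < h -> h <= L `^ (- eps) ->
  L * (g (level L b - h) - g (level L b + h)) <= tol.
Proof.
move=> /andP[eps0 eps1] tol0; apply: near_all_lt => b bq.
have [dG cG hlog hG2] := h2.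
have := @level_density_flat _ G (gap_prob01 P hZ) (gap_prob_nincr P hZ) dG cG
  h1 hlog hG2 (u b) eps tol (u0 bq) eps0.
by apply => //; lra.
Qed.

Lemma near_grid_scale (eps : R) : 0 < eps -> \forall L \near +oo, forall T : nat,
  L `^ (1 + eps) <= T%:R ->
  [/\ 1 < L, 0 < T%:R :> R, 0 < L / T%:R, L / T%:R <= L `^ (- eps) & L / T%:R <= 2^-1].
Proof.
move=> eps0; near=> L => T TL.
have L1 : 1 < L by near: L; apply: nbhs_pinfty_gt; exact: num_real.
have L0 : 0 < L by lra.
have T0 : 0 < T%:R :> R by apply: lt_le_trans TL; exact: powR_gt0.
have hL : L / T%:R <= L `^ (- eps).
  rewrite ler_pdivrMr// -ler_pdivrMl ?powR_gt0// -powRN opprK.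
  apply: le_trans TL; rewrite powRD; last by apply/implyP => _; rewrite gt_eqF.
  by rewrite (powRr1 (ltW L0)) mulrC.
split=> //; first exact: divr_gt0.
apply: (le_trans hL); rewrite -[L `^ _]mul1r; near: L.
exact: near_powR_small.
Unshelve. all: by end_near.
Qed.

(** The decrease of G over one mesh lies between h times the density at its two ends. As T h = L and
    the density at the level is u b / L, [level_density_flat] closes the bracket around u b. *)
Lemma near_grid_mean (eps tol : R) : 0 < eps <= 2^-1 -> 0 < tol -> \forall L \near +oo,
  forall T : nat, L `^ (1 + eps) <= T%:R -> forall J b, (b <= q)%N ->
  `|T%:R * pr P (grid_exceed Z (L / T%:R) q (level L) J b) - u b| <= tol /\
  T%:R * pr P (grid_exceed Z (L / T%:R) q (level L) J b) <= u b.
Proof.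
move=> eps01 tol0; near=> L => T TL J b bq.
have [L1 T0 h0 hL h12] : [/\ 1 < L, 0 < T%:R :> R, 0 < L / T%:R,
    L / T%:R <= L `^ (- eps) & L / T%:R <= 2^-1].
  by move: T TL; near: L; apply: near_grid_scale; case/andP: eps01.
have hl : forall b, (b < q)%N -> [/\ 1 < level L b, g (level L b) = u b / L &
      forall x, 0 < x -> (g x < u b / L) = (level L b < x)].
  by near: L; exact: near_level.
have flat : forall b, (b < q)%N -> forall h, 0 < h -> h <= L `^ (- eps) ->
  L * (g (level L b - h) - g (level L b + h)) <= tol by near: L; exact: near_flat.
move: bq; rewrite leq_eqVlt => /orP[/eqP ->|bq].
  by rewrite /grid_exceed ltnn uq {1 2}/pr measure0 mulr0 subrr normr0 lexx ltW.
rewrite (pr_grid_exceed hZ hstat _ h0)//.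
have [l1 lg _] := hl _ bq.
set h := L / T%:R in h0 hL h12 *.
have [dG cG _ _] := h2.
have := flat _ bq _ h0 hL.
have lb0 : 0 < level L b by lra.
have /andP[i1 i2] := increment_bounds dG cG lb0 (ltW h0).
rewrite [level L b + h]addrC in i1 i2 *.
have Th : T%:R * h = L by rewrite /h mulrC divfK// gt_eqF.
have j1 : L * g (h + level L b) <= T%:R * (G (level L b) - G (h + level L b)).
  by rewrite -[X in X * _ <= _]Th -mulrA ler_pM2l.
have j2 : T%:R * (G (level L b) - G (h + level L b)) <= u b.
  have -> : u b = T%:R * (h * (u b / L)).
    by rewrite mulrA Th mulrC divfK// gt_eqF//; lra.
  by rewrite ler_pM2l// -lg.
have lbh : 0 < level L b - h by lra.
have lbh2 : level L b - h <= level L b by lra.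
have mono := derive1_convex_nondecreasing dG cG lbh lbh2.
have j3 : u b <= L * g (level L b - h).
  have -> : u b = L * (u b / L) by rewrite mulrC divfK// gt_eqF//; lra.
  by rewrite ler_pM2l; [rewrite -lg lerN2|lra].
move=> fl; split=> //; rewrite ler_norml; apply/andP; split; lra.
Unshelve. all: by end_near.
Qed.

(** With sigma = 1 - z this is minus the logarithm of the limiting generating function: (u b - u
    b.+1) / p is the intensity of a cell, by [intensity_cell]. *)
Definition cell_mean p (sigma : nat -> nat -> R) : R :=
  \sum_(a < p) \sum_(b < q) sigma a b * ((u b - u b.+1) / p%:R).

Lemma sum_grid_blocks p M (F : nat -> R) : (0 < M)%N ->
  \sum_(J < p * M) F (J %/ M)%N = M%:R * \sum_(a < p) F a.
Proof.
move=> M0; rewrite -(big_mkord predT (fun J => F (J %/ M)%N)).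
elim: p => [|p ih]; first by rewrite mul0n big_geq// big_ord0 mulr0.
rewrite mulSn addnC (@big_cat_nat _ _ _ (p * M)%N) ?leq_addr//= ih big_ord_recr/= mulrDr.
congr (_ + _); rewrite -{1}(add0n (p * M)%N) big_addn addKn.
rewrite (eq_big_nat _ _ (F2 := fun=> F p)).
  by rewrite sumr_const_nat subn0 mulr_natl.
by move=> i /andP[_ iM]; rewrite divnDr ?dvdn_mull// mulnK// divn_small// add0n.
Qed.

(** A product of factors 1 - a differs from the exponential of minus the sum by at most the sum of
    the squares, here at most u 0 ^ 2 / T. The sum itself is computed block by block. *)
Lemma near_prod_mean p (sigma : nat -> nat -> R) (eps tol : R) : (0 < p)%N ->
  (forall a b, 0 <= sigma a b <= 1) -> 0 < eps <= 2^-1 -> 0 < tol ->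
  \forall L \near +oo, forall M : nat, L `^ (1 + eps) <= (p * M)%:R ->
  `|\prod_(J < p * M) (1 - weighted_mean P Z (L / (p * M)%:R) q (level L)
       (fun J b => sigma (J %/ M)%N b) J) - expR (- cell_mean p sigma)| <= tol.
Proof.
move=> p0 s01 eps01 tol0.
pose tau := tol / (4 * q%:R).
have q0' : 0 < q%:R :> R by rewrite ltr0n.
have p0' : 0 < p%:R :> R by rewrite ltr0n.
have tau0 : 0 < tau by rewrite divr_gt0// mulr_gt0.
near=> L => M TL; set T := (p * M)%N in TL *.
have [L1 T0 h0 hL h12] : [/\ 1 < L, 0 < T%:R :> R, 0 < L / T%:R,
    L / T%:R <= L `^ (- eps) & L / T%:R <= 2^-1].
  by move: T TL; near: L; apply: near_grid_scale; case/andP: eps01.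
have L0 : 0 < L by lra.
have hl : forall b, (b < q)%N -> [/\ 1 < level L b, g (level L b) = u b / L &
      forall x, 0 < x -> (g x < u b / L) = (level L b < x)].
  by near: L; exact: near_level.
have lnd := level_nd u_ni L0 hl.
have [l01 l0g _] := hl 0%N q0.
have rho0 : 0 < level L 0 by lra.
have hm : forall J b, (b <= q)%N ->
  `|T%:R * pr P (grid_exceed Z (L / T%:R) q (level L) J b) - u b| <= tau /\
  T%:R * pr P (grid_exceed Z (L / T%:R) q (level L) J b) <= u b.
  by move: T TL {T0 h0 hL h12}; near: L; exact: near_grid_mean.
have M0 : (0 < M)%N by move: T0; rewrite ltr0n muln_gt0 => /andP[].
pose s (J : 'I_T) b := sigma (J %/ M)%N b.
pose al := u 0%N / T%:R.
have u00 := u0 q0.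
have LT : L <= T%:R by have := h12; rewrite ler_pdivrMr//; lra.
have uT : u 0%N <= T%:R.
  by apply: le_trans LT; near: L; apply: nbhs_pinfty_ge; exact: num_real.
have wm J : 0 <= weighted_mean P Z (L / T%:R) q (level L) s J <= al.
  apply: weighted_mean_bounds => //; first by move=> ? ?; exact: s01.
  have := (hm 0%N 0%N (leq0n _)).2; rewrite (pr_grid_exceed hZ hstat _ h0)//.
  by rewrite /al ler_pdivlMr// mulrC.
have al1 : al <= 1 by rewrite ler_pdivrMr// mul1r.
pose wb J := weighted_mean P Z (L / T%:R) q (level L) s J.
have sumE : \sum_J wb J = \sum_(a < p) \sum_(b < q) sigma a b *
  ((T%:R * pr P (grid_exceed Z (L / T%:R) q (level L) 0 b) -
    T%:R * pr P (grid_exceed Z (L / T%:R) q (level L) 0 b.+1)) / p%:R).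
  pose F a := \sum_(b < q) sigma a b *
     (pr P (grid_exceed Z (L / T%:R) q (level L) 0 b) -
      pr P (grid_exceed Z (L / T%:R) q (level L) 0 b.+1)).
  have prJ J b : pr P (grid_exceed Z (L / T%:R) q (level L) J b) =
      pr P (grid_exceed Z (L / T%:R) q (level L) 0 b).
    have [bq|bq] := ltnP b q; first by rewrite !(pr_grid_exceed hZ hstat _ h0).
    by rewrite /grid_exceed ltnNge bq.
  transitivity (\sum_(J < p * M) F (J %/ M)%N).
    by apply: eq_bigr => J _; apply: eq_bigr => b _; rewrite /s prJ (prJ J b.+1).
  rewrite sum_grid_blocks// mulr_sumr; apply: eq_bigr => a _.
  rewrite mulr_sumr; apply: eq_bigr => b _.
  by rewrite /T natrM; field; rewrite gt_eqF.
have sum_close : `|\sum_J wb J - cell_mean p sigma| <= tol / 2.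
  rewrite sumE /cell_mean -sumrB; apply: le_trans (ler_norm_sum _ _ _) _.
  apply: (@le_trans _ _ (\sum_(a < p) (tol / 2 / p%:R))); last first.
    by rewrite sumr_const card_ord -[leLHS]mulr_natl mulrC divfK// gt_eqF.
  apply: ler_sum => a _; rewrite -sumrB; apply: le_trans (ler_norm_sum _ _ _) _.
  apply: (@le_trans _ _ (\sum_(b < q) (2 * tau / p%:R))); last first.
    rewrite sumr_const card_ord -[leLHS]mulr_natl /tau.
    by rewrite le_eqVlt; apply/orP; left; apply/eqP; field; rewrite !gt_eqF.
  apply: ler_sum => b _; rewrite -mulrBr -mulrBl !normrM.
  rewrite (gtr0_norm (x := p%:R^-1)) ?invr_gt0// mulrA ler_pM2r ?invr_gt0//.
  have [c1 _] := hm 0%N b (ltnW (ltn_ord b)).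
  have [c2 _] := hm 0%N b.+1 (ltn_ord b).
  case/andP: (s01 a b) => sg0 sg1; rewrite (ger0_norm sg0).
  apply: (@le_trans _ _ (1 * (2 * tau))); last by rewrite mul1r.
  apply: ler_pM => //; rewrite (_ : _ - _ - _ =
    (T%:R * pr P (grid_exceed Z (L / T%:R) q (level L) 0 b) - u b) -
    (T%:R * pr P (grid_exceed Z (L / T%:R) q (level L) 0 b.+1) - u b.+1)); last by ring.
  by rewrite (le_trans (ler_normB _ _))// (_ : 2 * tau = tau + tau) ?lerD//; ring.
have w01 J : 0 <= wb J <= 1 by case/andP: (wm J) => -> /le_trans ->.
have cm0 : 0 <= cell_mean p sigma.
  apply: sumr_ge0 => a _; apply: sumr_ge0 => b _; apply: mulr_ge0.
    by case/andP: (s01 a b).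
  by rewrite divr_ge0// subr_ge0 u_step.
have d1 : `|\prod_(J < T) (1 - wb J) - expR (- \sum_J wb J)| <= tol / 2.
  rewrite -sumrN expR_sum.
  apply: le_trans (prod_dist_le _ _ _) _.
  - by move=> J; case/andP: (w01 J) => *; rewrite subr_ge0 gerBl; apply/andP.
  - move=> J; case/andP: (w01 J) => *; rewrite expR_ge0 -expR0 ler_expR; lra.
  apply: (@le_trans _ _ (\sum_(J < T) al ^+ 2)).
    apply: ler_sum => J _; apply: le_trans (expR_quadratic (w01 J)) _.
    by rewrite lerXn2r ?nnegrE//; case/andP: (wm J) => // /le_trans h /h.
  rewrite sumr_const card_ord -[leLHS]mulr_natl.
  have -> : T%:R * al ^+ 2 = u 0%N ^+ 2 / T%:R by rewrite /al; field; rewrite gt_eqF.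
  rewrite ler_pdivrMr// -ler_pdivrMl ?divr_gt0//; apply: le_trans LT.
  by near: L; apply: nbhs_pinfty_ge; exact: num_real.
have d2 : `|expR (- \sum_J wb J) - expR (- cell_mean p sigma)| <= tol / 2.
  apply: le_trans (expR_dist _ _) sum_close => //.
  by apply: sumr_ge0 => J _; case/andP: (w01 J).
rewrite (le_trans (ler_distD (expR (- \sum_J wb J)) _ _))//.
by rewrite [leRHS](splitr tol) lerD.
Unshelve. all: by end_near.
Qed.

End grid_means.

(** * From grid cells to gaps *)

Lemma seq_has_min {R : realDomainType} (s : seq R) : s != [::] ->
  exists2 x, x \in s & forall y, y \in s -> x <= y.
Proof.
elim: s => // x s ih _; have [->|/ih[y ys hy]] := eqVneq s [::].
  by exists x; rewrite ?inE// => y; rewrite inE => /eqP ->.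
have [xy|/ltW yx] := leP x y.
  exists x; first by rewrite inE eqxx.
  by move=> z; rewrite inE => /orP[/eqP ->//|/hy]; exact: le_trans.
exists y; first by rewrite inE ys orbT.
by move=> z; rewrite inE => /orP[/eqP ->//|/hy].
Qed.

Lemma finite_set_min {R : realType} (A : set R) : finite_set A -> A !=set0 ->
  exists2 x, A x & forall y, A y -> x <= y.
Proof.
move=> fA [a Aa].
have inA x : (x \in finmap.enum_fset (fset_set A)) <-> A x.
  rewrite -[x \in _]/(x \in fset_set A) in_fset_set//.
  by split=> [/set_mem|/mem_set].
have [|x /inA Ax hx] := @seq_has_min R (finmap.enum_fset (fset_set A)).
  by apply/eqP => e; have /inA := Aa; rewrite e.
by exists x => // y /inA; exact: hx.
Qed.

Section grid_bijection.
Context {R : realType} {d : measure_display} {Omega : measurableType d}.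
Variables (P : probability Omega R) (Z : Omega -> set R).
Hypotheses (hZ : point_process Z).

(** Local finiteness makes the infimum a minimum once some later point z1 is known; over an empty
    set [inf] would be a default value. *)
Lemma next_pointP w z z1 : Z w z1 -> z < z1 ->
  [/\ Z w (next_point Z w z), z < next_point Z w z &
      forall y, Z w y -> z < y -> next_point Z w z <= y].
Proof.
move=> Zz1 zz1.
have fA : finite_set (Z w `&` `]z, z1]).
  apply: sub_finite_set (hZ.1 w z z1) => y [Zy /=]; rewrite !in_itv/= => /andP[zy ->].
  by split=> //; rewrite (ltW zy).
have [|n [Zn]] := finite_set_min fA; first by exists z1; split=> //; rewrite /= in_itv/= zz1/=.
rewrite /= in_itv/= => /andP[zn nz1] hn.
have hn' y : Z w y -> z < y -> n <= y.
  move=> Zy zy; have [yz1|/ltW z1y] := leP y z1.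
    by apply: hn; split=> //; rewrite /= in_itv/= zy.
  exact: le_trans z1y.
have -> : next_point Z w z = n.
  apply/eqP; rewrite eq_le; apply/andP; split.
    apply: ge_inf; last by split=> //; rewrite /= in_itv/= zn.
    by exists n => y [Zy /=]; rewrite in_itv/= andbT; exact: hn'.
  apply: lb_le_inf; first by exists n; split=> //; rewrite /= in_itv/= zn.
  by move=> y [Zy /=]; rewrite in_itv/= andbT; exact: hn'.
by split.
Qed.

Lemma last_point_before w x y z0 : Z w z0 -> x <= z0 < y ->
  exists2 z, Z w z & x <= z < y /\ forall z', Z w z' -> z' < y -> z' <= z.
Proof.
move=> Zz0 /andP[xz0 z0y].
have fA : finite_set [set - z | z in Z w `&` `[x, y[].
  apply: finite_image; apply: sub_finite_set (hZ.1 w x y) => t [Zt /=].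
  rewrite !in_itv/= => /andP[t1 t2]; split=> //; rewrite t1; exact: ltW.
have [|_ [z [Zz zxy] <-] hz] := finite_set_min fA.
  by exists (- z0), z0 => //; split=> //; rewrite /= in_itv/= xz0.
move: zxy; rewrite /= in_itv/= => zxy.
exists z => //; split=> // z' Zz' z'y; have [xz'|z'x] := leP x z'.
  by rewrite -lerN2; apply: hz; exists z' => //; split=> //; rewrite /= in_itv/= xz'.
by case/andP: zxy => xz _; apply: ltW; apply: lt_le_trans xz.
Qed.

Definition points (L : R) (w : Omega) : seq R :=
  finmap.enum_fset (fset_set (Z w `&` `[0, L])).

Lemma mem_points L w z : (z \in points L w) <-> (Z w z /\ 0 <= z <= L).
Proof.
rewrite -[z \in _]/(z \in fset_set (Z w `&` `[0, L])) in_fset_set; last exact: hZ.1.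
split=> [/set_mem[Zz]|[Zz zL]]; first by rewrite /= in_itv.
by apply/mem_set; split=> //; rewrite /= in_itv.
Qed.

Lemma uniq_points L w : uniq (points L w).
Proof. exact: finmap.fset_uniq. Qed.

Lemma Psi_count L w (B : set (R * \bar R)) : Psi P Z L w B =
  (count (fun z => rescaled_gap P Z L w z \in B) (points L w))%:R%:E.
Proof.
rewrite -[LHS]/(\sum_(k < size (points L w))
  dirac (rescaled_gap P Z L w (nth 0%R (points L w) k)) B)%E.
under eq_bigr do rewrite /dirac indicE.
rewrite sumEFin; congr EFin.
rewrite -sum1_count natr_sum [RHS]big_mkcond/= [RHS](big_nth 0) big_mkord.
by apply: eq_bigr => i _; case: (_ \in _).
Qed.

Variables (L h : R) (T q : nat) (rho : nat -> R) (w : Omega).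
Hypotheses (h0 : 0 < h) (TE : T%:R * h = L) (q0 : (0 < q)%N).
Hypothesis rho_nd : forall b c, (b <= c < q)%N -> rho b <= rho c.
Hypothesis h_rho : h < rho 0.

Let hr b : (b < q)%N -> h < rho b.
Proof. by move=> bq; rewrite (lt_le_trans h_rho)// rho_nd. Qed.

Let gap z := next_point Z w z - z.

Hypothesis good_next : exists2 z1, Z w z1 & L < z1.
Hypothesis good_grid : forall J b, (J < T)%N -> (b < q)%N ->
  exceed Z (J%:R * h) h (rho b - h) w -> exceed Z (J%:R * h) h (rho b) w.
Hypothesis good_end : ~ exceed Z (T%:R * h) h (rho 0 - h) w.

Definition grid_index (z : R) : nat := Num.truncn (z / h).

Lemma grid_indexP z : 0 <= z ->
  (grid_index z)%:R * h <= z < (grid_index z)%:R * h + h.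
Proof.
move=> z0; have zh : 0 <= z / h by apply: divr_ge0 => //; exact: ltW.
have := truncn_itv zh; rewrite -/(grid_index z).
by rewrite ler_pdivlMr// ltr_pdivrMr// -natr1 mulrDl mul1r.
Qed.

Lemma grid_index_eq z (J : nat) : J%:R * h <= z < J%:R * h + h -> grid_index z = J.
Proof.
move=> /andP[z1 z2]; apply: truncn_def.
by rewrite ler_pdivlMr// z1/= ltr_pdivrMr// -natr1 mulrDl mul1r.
Qed.

Let nextP z : z <= L -> [/\ Z w (next_point Z w z), z < next_point Z w z &
      forall y, Z w y -> z < y -> next_point Z w z <= y].
Proof.
by move=> zL; have [z1 Zz1 Lz1] := good_next; apply: (next_pointP Zz1 (le_lt_trans zL Lz1)).
Qed.

Lemma gap_gt0 z : z <= L -> 0 < gap z.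
Proof. by move=> /nextP[_ + _]; rewrite /gap subr_gt0. Qed.

(** The empty stretch after the cell of z can be shorter than the gap by up to h, since z may be
    anywhere in its cell; [good_grid] says that this h makes no difference at any level. Cell number
    T can only be reached by z = L, and [good_end] excludes it. *)
Lemma grid_cell_of_gap z b : Z w z -> 0 <= z <= L -> (b < q)%N -> rho b < gap z ->
  (grid_index z < T)%N /\ forall c, (c <= q)%N ->
   (grid_exceed Z h q rho (grid_index z) c w <-> (c < q)%N /\ rho c < gap z).
Proof.
move=> Zz /andP[z0 zL] bq bgap; set J := grid_index z.
have [Zn zn hn] := nextP zL.
have /andP[J1 J2] : J%:R * h <= z < J%:R * h + h by exact: grid_indexP.
have ex c : (c < q)%N -> rho c < gap z -> exceed Z (J%:R * h) h (rho c - h) w.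
  move=> cq cgap; apply/exceedP; [exact: ltW|by rewrite subr_ge0 ltW// hr|].
  split; first by exists z => //; rewrite J1.
  move=> y Zy y1; have zy : z < y by apply: lt_le_trans y1.
  have := hn y Zy zy; move: cgap; rewrite /gap; lra.
have JT : (J < T)%N.
  rewrite ltnNge; apply/negP => TJ.
  have JE : J = T.
    apply/eqP; rewrite eqn_leq TJ andbT -(ler_nat R) -(ler_pM2r h0) TE.
    exact: le_trans zL.
  apply: good_end; rewrite -JE; apply: ex => //; apply: le_lt_trans bgap.
  by rewrite rho_nd.
split=> // c cq'; rewrite /grid_exceed; case: ltnP => cq; last by split=> // -[].
split=> [|[_ cgap]]; last by apply: good_grid => //; exact: ex.
move=> /exceedP -/(_ (ltW h0) (ltW (lt_trans h0 (hr cq))))[_ miss]; split=> //.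
have hz : h < gap z by apply: lt_trans bgap; exact: hr.
have := miss _ Zn; rewrite /gap in hz *; move=> m.
have : J%:R * h + h <= next_point Z w z by lra.
move=> /m; lra.
Qed.

(** The witness is the last point of the cell: every later point lies beyond the empty stretch. *)
Lemma gap_of_grid_cell J b : (J < T)%N -> grid_exceed Z h q rho J b w ->
  exists z, [/\ Z w z, 0 <= z < L, grid_index z = J & rho b < gap z].
Proof.
move=> JT; rewrite /grid_exceed; case: ltnP => // bq.
move=> /exceedP -/(_ (ltW h0) (ltW (lt_trans h0 (hr bq))))[[z0 Zz0 z0J] miss].
have [z Zz [zJ hz]] := last_point_before Zz0 z0J.
have /andP[z1 z2] := zJ.
have zL : z < L.
  apply: (lt_le_trans z2); rewrite -TE -[X in _ + X]mul1r -mulrDl natr1 ler_pM2r//.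
  by rewrite ler_nat.
exists z; split=> //; last 2 first.
- exact: grid_index_eq.
- have [Zn zn hn] := nextP (ltW zL).
  have : J%:R * h + h <= next_point Z w z.
    by rewrite leNgt; apply/negP => nJ; have := hz _ Zn nJ; rewrite leNgt zn.
  move=> /(miss _ Zn); rewrite /gap; lra.
by rewrite zL andbT (le_trans _ z1)// mulr_ge0// ltW.
Qed.

Variables (p M : nat) (Lp : (0 < L)).
Hypotheses (TpM : T = (p * M)%N) (M0 : (0 < M)%N).

Definition grid_count (a b : nat) : nat :=
  #|[set J : 'I_T | ((J %/ M)%N == a) &&
     (w \in grid_exceed Z h q rho J b `\` grid_exceed Z h q rho J b.+1)]%SET|.

(** Columns are closed on the left and open on the right, except the last one, which is closed: they
    partition [0, 1]. *)
Definition xcell (a : nat) : set R :=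
  [set` Interval (BLeft (a%:R / p%:R)) (BSide (a.+1 != p) (a.+1%:R / p%:R))].

Let grid_xcell z a : 0 <= z < L ->
  xcell a (z / L) <-> (grid_index z %/ M)%N = a.
Proof.
move=> /andP[z0 zL]; have /andP[J1 J2] := grid_indexP z0.
set J := grid_index z in J1 J2 *.
have p0 : (0 < p)%N.
  rewrite lt0n; apply/eqP => p0; move: TE Lp; rewrite TpM p0 mul0n mul0r => <-.
  by rewrite ltxx.
have p0' : 0 < p%:R :> R by rewrite ltr0n.
have M0' : 0 < M%:R :> R by rewrite ltr0n.
have Lh : L = p%:R * (M%:R * h) by rewrite -TE TpM natrM mulrA.
have le_z k : (k%:R / p%:R <= z / L) = (k * M <= J)%N.
  rewrite ler_pdivlMr//.
  have -> : k%:R / p%:R * L = k%:R * M%:R * h by rewrite Lh; field; rewrite gt_eqF.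
  rewrite -natrM; apply/idP/idP => [kz|kJ].
    have : (k * M)%:R * h < J.+1%:R * h.
      by apply: le_lt_trans kz _; rewrite -natr1 mulrDl mul1r.
    by rewrite ltr_pM2r// ltr_nat ltnS.
  by apply: le_trans J1; rewrite ler_pM2r// ler_nat.
have lt_z k : (z / L < k%:R / p%:R) = (J < k * M)%N by rewrite ltNge le_z ltnNge.
have zL1 : z / L < 1 by rewrite ltr_pdivrMr// mul1r.
have JT : (J < p * M)%N by rewrite -lt_z divff// gt_eqF.
rewrite /xcell /= in_itv/= le_z.
have -> : (z / L < a.+1%:R / p%:R ?<= if ~~ (a.+1 != p)) = (J < a.+1 * M)%N.
  have [ap|ap] := eqVneq a.+1 p; last by rewrite lteifF lt_z.
  rewrite lteifT.
  by rewrite ap divff ?gt_eqF// (ltW zL1) JT.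
split=> [/andP[h1 h2]|<-]; last by rewrite leq_divM ltn_ceil.
by apply/eqP; rewrite eqn_leq -ltnS ltn_divLR// h2 leq_divRL.
Qed.

(** [grid_index] is a bijection from the counted points to the counted cells. Two such points cannot
    share a cell because their gaps exceed the mesh. *)
Lemma count_gaps (Q : pred R) a b : (b < q)%N ->
  (forall z, Z w z -> 0 <= z <= L -> Q z <->
     [/\ xcell a (z / L), rho b < gap z & (b.+1 < q)%N -> gap z <= rho b.+1]) ->
  count Q (points L w) = grid_count a b.
Proof.
move=> bq hQ; rewrite -size_filter /grid_count cardE.
rewrite -(size_map grid_index) -[RHS](size_map val).
have QP z : z \in seq.filter Q (points L w) -> [/\ Z w z, 0 <= z < L,
    xcell a (z / L), rho b < gap z & (b.+1 < q)%N -> gap z <= rho b.+1].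
  rewrite mem_filter => /andP[Qz /mem_points[Zz zL]].
  have [xz bz bz'] := (hQ z Zz zL).1 Qz; split=> //.
  have [JT _] := grid_cell_of_gap Zz zL bq bz.
  case/andP: (zL) => z0 _; rewrite z0/=; have /andP[_ J2] := grid_indexP z0.
  apply: (lt_le_trans J2); rewrite -TE -[X in _ + X]mul1r -mulrDl natr1 ler_pM2r//.
  by rewrite ler_nat.
apply: perm_size; apply: uniq_perm.
- rewrite map_inj_in_uniq ?filter_uniq ?uniq_points//.
  have key z z' : z \in seq.filter Q (points L w) -> z' \in seq.filter Q (points L w) ->
      grid_index z = grid_index z' -> ~ z < z'.
    move=> /QP[Zz /andP[z0 zL] _ gz _] /QP[Zz' /andP[z'0 _] _ _ _] e zz'.
    have [_ _ hn] := nextP (ltW zL); have := hn _ Zz' zz'.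
    have /andP[a1 a2] := grid_indexP z0; have /andP[b1 b2] := grid_indexP z'0.
    have := hr bq; move: gz; rewrite /gap -e in b1 b2 *; lra.
  move=> z z' zP z'P e; case: (ltgtP z z') => // c.
    by case: (key z z' zP z'P e c).
  by case: (key z' z z'P zP (esym e) c).
- by rewrite map_inj_uniq ?enum_uniq//; exact: val_inj.
move=> J; apply/mapP/mapP => [[z zP ->]|[j + ->]].
  have [Zz zL xz gz gz'] := QP z zP.
  have zL' : 0 <= z <= L by case/andP: zL => -> /ltW.
  have [JT hJ] := grid_cell_of_gap Zz zL' bq gz.
  exists (Ordinal JT) => //; rewrite mem_enum inE/=.
  rewrite (grid_xcell a zL).1// eqxx/=; apply/mem_set; split.
    by apply/(hJ b (ltnW bq)).
  move=> /(hJ b.+1 bq)[bq' c]; have := gz' bq'; lra.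
rewrite mem_enum inE => /andP[/eqP ja]; rewrite inE => -[jb jb'].
have [z [Zz zL jz gz]] := gap_of_grid_cell (ltn_ord j) jb.
have zL' : 0 <= z <= L by case/andP: zL => -> /ltW.
exists z => //; rewrite mem_filter; apply/andP; split; last exact/mem_points.
apply/(hQ z Zz zL'); split=> //; first by apply/grid_xcell => //; rewrite jz.
move=> bq'; rewrite leNgt; apply/negP => c; apply: jb'.
have [_ hJ] := grid_cell_of_gap Zz zL' bq gz.
by rewrite -jz; apply/(hJ b.+1 bq).
Qed.

End grid_bijection.

Lemma indic_setD {R : realType} (T : Type) (A B : set T) w : A `<=` B ->
  \1_B w - \1_A w = (w \in B `\` A)%:R :> R.
Proof.
move=> AB; rewrite !indicE in_setD; have [wA|] := boolP (w \in A); last by rewrite andbT subr0.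
by rewrite andbF mem_set ?subrr//; apply: AB; exact: set_mem.
Qed.

(** At most one index is active, so both sides reduce to 1 or to a single factor 1 - s i. *)
Lemma prod_exclusive {R : realType} (I : finType) (e : I -> bool) (s : I -> R) :
  (forall i j, e i -> e j -> i = j) ->
  1 - \sum_i s i * (e i)%:R = \prod_i (1 - s i) ^+ e i.
Proof.
move=> excl; have [/existsP[/= i ei]|/existsPn none] := boolP [exists i, e i].
  have other j : j != i -> e j = false.
    by move=> ji; apply/negP => ej; move: ji; rewrite (excl _ _ ej ei) eqxx.
  rewrite (bigD1 i)//= ei mulr1 big1 ?addr0; last first.
    by move=> j ji; rewrite other// mulr0.
  by rewrite (bigD1 i)//= ei expr1 big1 ?mulr1// => j ji; rewrite other.
rewrite big1 ?subr0; last by move=> i _; rewrite (negbTE (none i)) mulr0.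
by rewrite big1// => i _; rewrite (negbTE (none i)).
Qed.

(** * Counts of the rescaled gaps and their generating function *)

Section grid_counts.
Context {R : realType} {d : measure_display} {Omega : measurableType d}.
Variables (P : probability Omega R) (Z : Omega -> set R).
Hypotheses (hZ : point_process Z) (hstat : stationary P Z).
Hypotheses (h1 : gap_decay P Z) (h2 : regularity P Z) (h3 : splitting P Z)
  (h5 : absence_of_clustering P Z).
Local Notation G := (gap_prob P Z).
Local Notation g := (fun r => - derive1 G r).
Variables (q : nat) (tau : nat -> R).
Hypothesis q0 : (0 < q)%N.
Hypothesis tau_nd : forall b c, (b <= c < q)%N -> tau b <= tau c.

(** The mass of e^{-y} dy above tau b; the value 0 from q on matches the infinite threshold of
    [grid_exceed]. *)
Definition level_rate (b : nat) : R := if (b < q)%N then expR (- tau b) else 0.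
Local Notation u := level_rate.
Local Notation level := (level P Z u).

Lemma level_rate_gt0 b : (b < q)%N -> 0 < u b.
Proof. by rewrite /level_rate => ->; exact: expR_gt0. Qed.

Lemma level_rate_ni b c : (b <= c < q)%N -> u c <= u b.
Proof.
move=> bcq; have /andP[bc cq] := bcq.
rewrite /level_rate cq (leq_ltn_trans bc cq) ler_expR lerN2.
exact: tau_nd.
Qed.

Lemma level_rate_q : u q = 0.
Proof. by rewrite /level_rate ltnn. Qed.

Let u0 := level_rate_gt0.
Let u_ni := level_rate_ni.
Let uq := level_rate_q.

(** What could make the grid miscount: a gap within about h of a level, a long gap starting at L,
    and the absence of a point in [L + 1, 2 L + 1], which could leave the last gap undefined. *)
Definition grid_bad (L : R) (T : nat) : set Omega :=
  \big[setU/set0]_(b < q) \big[setU/set0]_(J < T)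
    (exceed Z (J%:R * (L / T%:R)) (L / T%:R) (level L b - L / T%:R) `\`
     exceed Z (J%:R * (L / T%:R)) (L / T%:R) (level L b)) `|`
  (exceed Z (T%:R * (L / T%:R)) (L / T%:R) (level L 0 - L / T%:R) `|`
   gap_event Z `[L + 1, L + 1 + L]).

Let mbad1 L T b : measurable (\big[setU/set0]_(J < T)
    (exceed Z (J%:R * (L / T%:R)) (L / T%:R) (level L b - L / T%:R) `\`
     exceed Z (J%:R * (L / T%:R)) (L / T%:R) (level L b))).
Proof.
by apply: bigsetU_measurable => J _; apply: measurableD; exact: measurable_exceed.
Qed.

Lemma measurable_grid_bad L T : measurable (grid_bad L T).
Proof.
apply: measurableU; first by apply: bigsetU_measurable => b _; exact: mbad1.
by apply: measurableU; [exact: measurable_exceed|exact: measurable_gap_event].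
Qed.

(** The first part is a union over T cells of events whose probabilities are second differences of G
    with step h, at most h * (g (r - h) - g (r + h)); as T h = L, [level_density_flat] applies. The
    other two parts tend to 0 with G. *)
Lemma near_grid_bad (eps tol : R) : 0 < eps <= 2^-1 -> 0 < tol ->
  \forall L \near +oo, forall T : nat, L `^ (1 + eps) <= T%:R ->
  pr P (grid_bad L T) <= tol.
Proof.
move=> eps01 tol0; have [dG cG hlog hG2] := h2.
have q0' : 0 < q%:R :> R by rewrite ltr0n.
have G0 : \forall r \near +oo, G r <= tol / 3.
  have := gap_prob_cvg0 h1; move/cvgrPdist_le => /(_ (tol / 3)).
  rewrite divr_gt0// => /(_ isT); apply: filterS => r.
  by rewrite sub0r normrN; apply: le_trans; exact: ler_norm.
have [B hB] := near_pinfty_and G0.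
near=> L => T TL.
have [L1 T0 h0 hL h12] : [/\ 1 < L, 0 < T%:R :> R, 0 < L / T%:R,
    L / T%:R <= L `^ (- eps) & L / T%:R <= 2^-1].
  by move: T TL; near: L; apply: near_grid_scale; case/andP: eps01.
have L0 : 0 < L by lra.
have hl : forall b, (b < q)%N -> [/\ 1 < level L b, g (level L b) = u b / L &
      forall x, 0 < x -> (g x < u b / L) = (level L b < x)].
  by near: L; exact: near_level.
have flat : forall b, (b < q)%N -> forall h, 0 < h -> h <= L `^ (- eps) ->
  L * (g (level L b - h) - g (level L b + h)) <= tol / (3 * q%:R).
  near: L; apply: near_all_lt => b bq; case/andP: eps01 => eps0 eps1.
  have := @level_density_flat _ G (gap_prob01 P hZ) (gap_prob_nincr P hZ) dG cG
    h1 hlog hG2 (u b) eps (tol / (3 * q%:R)) (u0 bq) eps0.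
  by apply; [lra|rewrite divr_gt0// mulr_gt0].
set h := L / T%:R in h0 hL h12 *.
have Th : T%:R * h = L by rewrite /h mulrC divfK// gt_eqF.
apply: le_trans (pr_setU _ _ _) _.
- by apply: bigsetU_measurable => b _; exact: mbad1.
- by apply: measurableU; [exact: measurable_exceed|exact: measurable_gap_event].
have -> : tol = tol / 3 + (tol / 3 + tol / 3) by field.
have B2 : B + 1 < L by near: L; apply: nbhs_pinfty_gt; exact: num_real.
have B1 : B + 1 < level L 0.
  near: L; apply: (@near_gap_level _ G (gap_prob01 P hZ) dG cG h1 hlog _
    (fun r => B + 1 < r) (u0 q0)).
  by apply: nbhs_pinfty_gt; exact: num_real.
apply: lerD; last first.
  apply: le_trans (pr_setU _ _ _) _; [exact: measurable_exceed|
    exact: measurable_gap_event|].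
  apply: lerD.
    rewrite (pr_exceed hZ hstat _ _ (ltW h0)); apply: (@le_trans _ _ (G (level L 0 - h))).
      by rewrite gerBl gap_prob_ge0.
    by apply: hB; lra.
  by rewrite (gap_prob_shift hstat (r := L))//; apply: hB; lra.
have [_] := @pr_bigcup _ _ _ P _ (index_enum 'I_q) _ (mbad1 L T).
move=> /le_trans; apply.
apply: (@le_trans _ _ (\sum_(b < q) (tol / (3 * q%:R)))); last first.
  rewrite sumr_const card_ord -[leLHS]mulr_natl.
  by rewrite le_eqVlt; apply/orP; left; apply/eqP; field; rewrite gt_eqF.
apply: ler_sum => b _; have [l1 lg _] := hl b (ltn_ord b).
have mJ (J : 'I_T) : measurable (exceed Z (J%:R * h) h (level L b - h) `\`
     exceed Z (J%:R * h) h (level L b)).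
  by apply: measurableD; exact: measurable_exceed.
have [_] := @pr_bigcup _ _ _ P _ (index_enum 'I_T) _ mJ.
move=> /le_trans; apply.
have lh : 0 < level L b - h by lra.
have lb0 : 0 < level L b by lra.
have step : (G (level L b - h) - G (level L b)) -
    (G (level L b) - G (level L b + h)) <= h * (g (level L b - h) - g (level L b + h)).
  have /andP[_] := increment_bounds dG cG lh (ltW h0); rewrite subrK => i1.
  have /andP[i2 _] := increment_bounds dG cG lb0 (ltW h0); lra.
apply: (@le_trans _ _ (\sum_(J < T) h * (g (level L b - h) - g (level L b + h)))).
  apply: ler_sum => J _; rewrite pr_setD; [|exact: measurable_exceed..|].
    rewrite !(pr_exceed hZ hstat _ _ (ltW h0)); apply: le_trans step.
    rewrite (_ : h + (level L b - h) = level L b); last by ring.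
    by rewrite (addrC h).
  by move=> v; apply: exceed_sub; [exact: ltW|exact: ltW|lra].
rewrite sumr_const card_ord -[leLHS]mulr_natl mulrA Th.
exact: flat.
Unshelve. all: by end_near.
Qed.

Lemma not_grid_bad L T w : 0 < L -> ~ grid_bad L T w ->
  [/\ exists2 z1, Z w z1 & L < z1,
      forall J b, (J < T)%N -> (b < q)%N ->
        exceed Z (J%:R * (L / T%:R)) (L / T%:R) (level L b - L / T%:R) w ->
        exceed Z (J%:R * (L / T%:R)) (L / T%:R) (level L b) w &
      ~ exceed Z (T%:R * (L / T%:R)) (L / T%:R) (level L 0 - L / T%:R) w].
Proof.
move=> L0 nb; split.
- have : ~ gap_event Z `[L + 1, L + 1 + L] w by move=> h; apply: nb; right; right.
  move/eqP/set0P => [z []]; rewrite /= in_itv/= => /andP[z1 _] Zz.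
  by exists z => //; lra.
- move=> J b JT bq e1; apply: contrapT => e2; apply: nb; left.
  rewrite (bigD1 (Ordinal bq))//=; left; rewrite (bigD1 (Ordinal JT))//=; left.
  by split.
- by move=> h; apply: nb; right; left.
Qed.

Definition ycell (b : nat) : set (\bar R) :=
  [set y | ((tau b)%:E < y)%E /\ ((b.+1 < q)%N -> (y <= (tau b.+1)%:E)%E)].

(** After taking exponentials, the height exceeds tau b if and only if the density at x is below u b
    / L, and the level was chosen to make this equivalent to x lying beyond it. *)
Lemma rescaled_height L b x : 0 < L -> (b < q)%N ->
  (forall x, 0 < x -> (g x < u b / L) = (level L b < x)) -> 0 < x ->
  ((tau b)%:E < theta P Z x - (ln L)%:E)%E = (level L b < x).
Proof.
move=> L0 bq hl x0; rewrite -hl//.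
have g0 : 0 < - derive1 G x.
  have [dG cG hlog hG2] := h2.
  exact: (density_gt0 dG cG h1 hlog x0).
rewrite /theta /lne leNgt g0/= -EFinB lte_fin /level_rate bq.
rewrite ltr_pdivlMr// -[X in X * L < _]lnK ?posrE// -[X in _ * X < _](lnK (x := L)) ?posrE//.
rewrite -expRD ltr_expR; apply/idP/idP; lra.
Qed.

Section fixed_columns.
Variable p : nat.
Hypothesis p0 : (0 < p)%N.

Definition cell (a b : nat) : set (R * \bar R) := xcell p a `*` ycell b.

Definition gcount (L : R) (M a b : nat) (w : Omega) : nat :=
  grid_count Z (L / (p * M)%:R) (p * M) q (level L) w M a b.

Lemma near_Psi_cell (eps : R) : 0 < eps <= 2^-1 ->
  \forall L \near +oo, forall M : nat, L `^ (1 + eps) <= (p * M)%:R ->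
  forall w, ~ grid_bad L (p * M) w -> forall a b, (b < q)%N ->
  Psi P Z L w (cell a b) = (gcount L M a b w)%:R%:E.
Proof.
move=> eps01; near=> L => M TL w nb a b bq.
have [L1 T0 h0 hL h12] : [/\ 1 < L, 0 < (p * M)%:R :> R, 0 < L / (p * M)%:R,
    L / (p * M)%:R <= L `^ (- eps) & L / (p * M)%:R <= 2^-1].
  by move: (p * M)%N TL {nb}; near: L; apply: near_grid_scale; case/andP: eps01.
have L0 : 0 < L by lra.
have hl : forall b, (b < q)%N -> [/\ 1 < level L b, g (level L b) = u b / L &
      forall x, 0 < x -> (g x < u b / L) = (level L b < x)].
  by near: L; exact: near_level.
have [gn gg ge] := not_grid_bad L0 nb.
have TE : (p * M)%:R * (L / (p * M)%:R) = L by rewrite mulrC divfK// gt_eqF.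
have hr : L / (p * M)%:R < level L 0 by have [? _ _] := hl 0%N q0; lra.
have M0 : (0 < M)%N by move: T0; rewrite ltr0n muln_gt0 => /andP[].
rewrite Psi_count//; congr (_%:R%:E).
apply: (count_gaps hZ h0 TE q0 (level_nd u_ni L0 hl) hr gn gg ge L0 erefl M0 bq).
move=> z Zz /andP[z0 zL]; have gp := gap_gt0 hZ gn zL.
have [_ _ hb] := hl b bq.
have e1 := rescaled_height L0 bq hb gp.
split=> [/set_mem[/= xz [yz yz']]|[xz bz bz']].
  split=> //; first by rewrite -e1.
  move=> b1; have [_ _ hb1] := hl b.+1 b1.
  have := yz' b1; rewrite leNgt => /negP; rewrite leNgt => h; apply/negP => h'.
  by apply: h; rewrite (rescaled_height L0 b1 hb1 gp).
apply/mem_set; split=> //=; split; first by rewrite e1.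
move=> b1; have [_ _ hb1] := hl b.+1 b1.
by rewrite leNgt (rescaled_height L0 b1 hb1 gp) -leNgt bz'.
Unshelve. all: by end_near.
Qed.

Lemma gcount_indic L M a b w : (gcount L M a b w)%:R =
  \sum_(J < p * M | (J %/ M)%N == a)
    \1_(grid_exceed Z (L / (p * M)%:R) q (level L) J b `\`
        grid_exceed Z (L / (p * M)%:R) q (level L) J b.+1) w :> R.
Proof.
rewrite /gcount /grid_count -sum1_card natr_sum.
rewrite big_mkcond [RHS]big_mkcond/=; apply: eq_bigr => J _.
rewrite inE indicE; case: eqP => //= _.
by case: (w \in _).
Qed.

Lemma bmeas_gcount L M a b : bmeas (fun w => (gcount L M a b w)%:R : R).
Proof.
under eq_fun do rewrite gcount_indic.
apply: bmeas_sum => J _; apply: bmeas_indic; apply: measurableD;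
  exact: measurable_grid_exceed.
Qed.

(** The height classes of a cell are disjoint, so [prod_exclusive] turns each factor into powers;
    grouping the cells by column collects the exponents into counts. *)
Lemma prod_gcount L M (sigma : nat -> nat -> R) w :
  0 < L -> (0 < p * M)%N ->
  (forall b, (b < q)%N -> [/\ 1 < level L b, g (level L b) = u b / L &
      forall x, 0 < x -> (g x < u b / L) = (level L b < x)]) ->
  \prod_(J < p * M) (1 - weighted_exceed Z (L / (p * M)%:R) q (level L)
    (fun J b => sigma (J %/ M)%N b) J w) =
  \prod_(a < p) \prod_(b < q) (1 - sigma a b) ^+ gcount L M a b w.
Proof.
move=> L0 pM0 hl; set h := L / (p * M)%:R.
have h0 : 0 < h by rewrite divr_gt0// ltr0n.
have rho0 : 0 < level L 0 by have [? _ _] := hl _ q0; lra.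
have lnd := level_nd u_ni L0 hl.
pose E (J b : nat) := grid_exceed Z h q (level L) J b `\` grid_exceed Z h q (level L) J b.+1.
have sub J b c : (b <= c)%N -> grid_exceed Z h q (level L) J c `<=` grid_exceed Z h q (level L) J b.
  exact: grid_exceed_sub.
have lc J b : level_cell Z h q (level L) J b w = (w \in E J b)%:R.
  by rewrite /level_cell indic_setD//; exact: sub.
have disj J b c : (b < c)%N -> w \in E J b -> w \in E J c -> False.
  by move=> bc /set_mem[_ nb] /set_mem[hc _]; apply: nb; exact: sub hc.
have M0 : (0 < M)%N by move: pM0; rewrite muln_gt0 => /andP[].
transitivity (\prod_(J < p * M) \prod_(b < q)
    (1 - sigma (J %/ M)%N b) ^+ (w \in E J b)).
  apply: eq_bigr => J _; rewrite /weighted_exceed.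
  under eq_bigr do rewrite lc.
  apply: prod_exclusive => b c Eb Ec; apply/val_inj.
  by case: (ltngtP b c) => // bc; [have := disj _ _ _ bc Eb Ec|have := disj _ _ _ bc Ec Eb].
have Jp (J : 'I_(p * M)) : (J %/ M < p)%N by rewrite ltn_divLR.
rewrite (partition_big (fun J => Ordinal (Jp J)) predT)//=.
apply: eq_bigr => a _; rewrite exchange_big/=; apply: eq_bigr => b _.
transitivity (\prod_(J < p * M | (J %/ M)%N == a) (1 - sigma a b) ^+ (w \in E J b)).
  apply: eq_big => [J|J /eqP <-//].
  by rewrite -val_eqE.
rewrite -expr_sum; congr (_ ^+ _).
rewrite /gcount /grid_count -sum1_card big_mkcond [RHS]big_mkcond/=.
by apply: eq_bigr => J _; rewrite inE; case: eqP => //= _.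
Qed.

Definition fine_mesh (eps L : R) : nat := (Num.truncn (L `^ (1 + eps))).+1.

Lemma fine_meshP (eps L : R) : 1 <= L -> 0 < eps ->
  L `^ (1 + eps) <= (p * fine_mesh eps L)%:R <= (2 * p)%:R * L `^ (1 + eps).
Proof.
move=> L1 eps0; have x1 : 1 <= L `^ (1 + eps).
  by rewrite -[leLHS](powRr0 L) ler_powR//; lra.
have x2 : L `^ (1 + eps) <= (fine_mesh eps L)%:R by apply/ltW; exact: truncnS_gt.
have x3 : (fine_mesh eps L)%:R <= 2 * L `^ (1 + eps).
  have : (Num.truncn (L `^ (1 + eps)))%:R <= L `^ (1 + eps) by rewrite truncn_le powR_ge0.
  rewrite /fine_mesh -natr1; lra.
have p1 : 1 <= p%:R :> R by rewrite ler1n.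
have p00 : 0 <= p%:R :> R by [].
rewrite !natrM; apply/andP; split; first by apply: le_trans x2 _; rewrite ler_peMl.
by rewrite [2 * _]mulrC -mulrA ler_wpM2l.
Qed.

(** The exponent supplied by [asymptotic_comparison] depends on the tolerance; counts that can have
    a limit law need an exponent fixed once and for all. *)
Definition vcount (L : R) (a b : nat) (w : Omega) : nat :=
  gcount L (fine_mesh 2^-1 L) a b w.

Lemma bmeas_prod_expr (sigma : nat -> nat -> R) L M :
  bmeas (fun w => \prod_(a < p) \prod_(b < q) (1 - sigma a b) ^+ gcount L M a b w).
Proof.
apply: bmeas_prod => a _; apply: bmeas_prod => b _.
pose E (J : 'I_(p * M)) := grid_exceed Z (L / (p * M)%:R) q (level L) J b `\`
        grid_exceed Z (L / (p * M)%:R) q (level L) J b.+1.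
have -> : (fun w => (1 - sigma a b) ^+ gcount L M a b w) =
    (fun w => \prod_(J < p * M | (J %/ M)%N == a) (1 - sigma a b * \1_(E J) w)).
  apply/funext => w; rewrite /gcount /grid_count -sum1_card big_mkcond/= expr_sum.
  rewrite [RHS]big_mkcond/=; apply: eq_bigr => J _.
  rewrite inE -/(E J) indicE; case: eqP => //= _.
  by case: (w \in _); rewrite ?expr1 ?expr0 ?mulr1 ?mulr0 ?subr0.
apply: bmeas_prod => J _; apply: bmeasB; first exact: bmeas_cst.
by apply: bmeasZ; apply: bmeas_indic; apply: measurableD; exact: measurable_grid_exceed.
Qed.

Lemma prod_expr01 (sigma : nat -> nat -> R) (n : nat -> nat -> nat) :
  (forall a b, 0 <= sigma a b <= 1) ->
  0 <= \prod_(a < p) \prod_(b < q) (1 - sigma a b) ^+ n a b <= 1.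
Proof.
move=> s01.
have e01 a b : 0 <= (1 - sigma a b) ^+ n a b <= 1.
  case/andP: (s01 a b) => *; rewrite exprn_ge0 ?subr_ge0//= exprn_ile1 ?subr_ge0//.
  by rewrite gerBl.
apply/andP; split.
  by apply: prodr_ge0 => a _; apply: prodr_ge0 => b _; case/andP: (e01 a b).
apply: prodr_ile1 => a _; rewrite prodr_ge0 ?prodr_ile1// => b _.
by case/andP: (e01 a b).
Qed.

(* Both the fine mesh [eps] and the mesh of [vcount] compute the cell counts of
   [Psi] off a set of small probability. *)
Lemma vcount_generating_function (sigma : nat -> nat -> R) :
  (forall a b, 0 <= sigma a b <= 1) ->
  Ex P (fun w => \prod_(a < p) \prod_(b < q) (1 - sigma a b) ^+ vcount L a b w)
    @[L --> +oo] --> expR (- cell_mean q u p sigma).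
Proof.
move=> s01; apply/cvgrPdist_le => tol tol0.
have tol4 : 0 < tol / 4 by rewrite divr_gt0.
have p2 : 1 <= (2 * p)%:R :> R by rewrite ler1n muln_gt0.
have [eps eps01 hA] := asymptotic_comparison hZ hstat h1 h2 h3 h5 q0 u0 u_ni p2 tol4.
have half01 : 0 < (2^-1 : R) <= 2^-1 by apply/andP; split; lra.
have /andP[eps0 _] := eps01.
near=> L.
have L1 : 1 < L by near: L; apply: nbhs_pinfty_gt; exact: num_real.
have L0 : 0 < L by apply: lt_trans L1.
pose M1 := fine_mesh eps L; pose M2 := fine_mesh 2^-1 L.
have m1 := fine_meshP (ltW L1) eps0; rewrite -/M1 in m1.
have m2 : L `^ (1 + 2^-1) <= (p * M2)%:R <= (2 * p)%:R * L `^ (1 + 2^-1).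
  by apply: fine_meshP; [exact: ltW|rewrite invr_gt0].
have /andP[m1l _] := m1; have /andP[m2l _] := m2.
have hl : forall b, (b < q)%N -> [/\ 1 < level L b, g (level L b) = u b / L &
      forall x, 0 < x -> (g x < u b / L) = (level L b < x)].
  by near: L; exact: near_level.
pose X M w := \prod_(a < p) \prod_(b < q) (1 - sigma a b) ^+ gcount L M a b w.
have bX M : bmeas (X M) by exact: bmeas_prod_expr.
pose B := grid_bad L (p * M1) `|` grid_bad L (p * M2).
have mB : measurable B by apply: measurableU; exact: measurable_grid_bad.
have PB : pr P B <= tol / 4 + tol / 4.
  apply: le_trans (pr_setU _ _ _) _; [exact: measurable_grid_bad..|].
  apply: lerD; [move: m1l|move: m2l]; move: (p * _)%N; near: L;
    exact: near_grid_bad.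
have hP1 : forall M : nat, L `^ (1 + eps) <= (p * M)%:R ->
  forall w, ~ grid_bad L (p * M) w -> forall a b, (b < q)%N ->
  Psi P Z L w (cell a b) = (gcount L M a b w)%:R%:E.
  by near: L; exact: near_Psi_cell.
have hP2 : forall M : nat, L `^ (1 + 2^-1) <= (p * M)%:R ->
  forall w, ~ grid_bad L (p * M) w -> forall a b, (b < q)%N ->
  Psi P Z L w (cell a b) = (gcount L M a b w)%:R%:E.
  by near: L; exact: near_Psi_cell.
have same w : ~ B w -> X M1 w = X M2 w.
  move=> nB; apply: eq_bigr => a _; apply: eq_bigr => b _; congr (_ ^+ _).
  apply/eqP; rewrite -(eqr_nat R); apply/eqP/EFin_inj.
  have c1 : Psi P Z L w (cell a b) = (gcount L M1 a b w)%:R%:E.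
    have nB1 : ~ grid_bad L (p * M1) w by move=> h; apply: nB; left.
    exact: hP1.
  have c2 : Psi P Z L w (cell a b) = (gcount L M2 a b w)%:R%:E.
    have nB2 : ~ grid_bad L (p * M2) w by move=> h; apply: nB; right.
    exact: hP2.
  by rewrite -c1 c2.
have X01 M w : 0 <= X M w <= 1 by exact: prod_expr01.
have d1 : `|Ex P (X M1) - Ex P (X M2)| <= tol / 4 + tol / 4.
  rewrite -ExB//; apply: le_trans (Ex_norm _ (bmeasB (bX M1) (bX M2))) _.
  apply: le_trans PB; rewrite -Ex_indic//; apply: le_Ex => [||w].
  - by apply: bmeas_norm; exact: bmeasB.
  - exact: bmeas_indic.
  - rewrite indicE; have [Bw|Bw] := pselect (B w).
      rewrite mem_set// mulr1n; have := X01 M1 w; have := X01 M2 w.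
      by move=> /andP[? ?] /andP[? ?]; rewrite ler_norml; apply/andP; split; lra.
    by rewrite same// subrr normr0.
have d2 : `|Ex P (X M1) - \prod_(J < p * M1) (1 - weighted_mean P Z (L / (p * M1)%:R) q
     (level L) (fun J b => sigma (J %/ M1)%N b) J)| <= tol / 4.
  have -> : X M1 = (fun w => \prod_(J < p * M1) (1 - weighted_exceed Z (L / (p * M1)%:R) q
     (level L) (fun J b => sigma (J %/ M1)%N b) J w)).
    by apply/funext => w; rewrite prod_gcount// muln_gt0 p0.
  have hs (J : 'I_(p * M1)) b : 0 <= sigma (J %/ M1)%N b <= 1 by exact: s01.
  have hA' : forall (T : nat) (s : 'I_T -> nat -> R),
    L `^ (1 + eps) <= T%:R <= (2 * p)%:R * L `^ (1 + eps) ->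
    (forall J b, 0 <= s J b <= 1) ->
    `|Ex P (fun v => \prod_J (1 - weighted_exceed Z (L / T%:R) q (level L) s J v)) -
      \prod_J (1 - weighted_mean P Z (L / T%:R) q (level L) s J)| <= tol / 4.
    by near: L.
  exact: hA'.
have d3 : `|\prod_(J < p * M1) (1 - weighted_mean P Z (L / (p * M1)%:R) q
     (level L) (fun J b => sigma (J %/ M1)%N b) J) - expR (- cell_mean q u p sigma)|
     <= tol / 4.
  have hM : forall M : nat, L `^ (1 + eps) <= (p * M)%:R ->
    `|\prod_(J < p * M) (1 - weighted_mean P Z (L / (p * M)%:R) q (level L)
       (fun J b => sigma (J %/ M)%N b) J) - expR (- cell_mean q u p sigma)| <= tol / 4.
    by near: L; exact: near_prod_mean.
  exact: hM.
rewrite distrC -[fun w => _]/(X M2).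
move: d1 d2 d3.
move: (Ex P (X M1)) (Ex P (X M2)) (\prod_(J < _) _) (expR _) => x1 x2 x3 x4.
rewrite !ler_norml => /andP[? ?] /andP[? ?] /andP[? ?]; apply/andP; split; lra.
Unshelve. all: by end_near.
Qed.

End fixed_columns.
End grid_counts.

(** * Laws from generating functions *)

(** In the tail from index m each term is z ^ j times the corresponding term of the series at x, and
    z ^ j is at most z ^ m. *)
Lemma expR_taylor_remainder {R : realType} (x z : R) m : 0 <= x -> 0 <= z <= 1 ->
  0 <= expR (x * z) - \sum_(j < m) (x * z) ^+ j / j`!%:R <= z ^+ m * expR x.
Proof.
move=> x0 /andP[z0 z1]; have xz0 : 0 <= x * z by rewrite mulr_ge0.
have ser n y : series (exp_coeff y) n = \sum_(j < n) y ^+ j / j`!%:R :> R.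
  by rewrite /series/= big_mkord.
have t0 j (y : R) : 0 <= y -> 0 <= y ^+ j / j`!%:R.
  by move=> y0; rewrite divr_ge0// exprn_ge0.
have part n (y : R) : 0 <= y -> \sum_(j < n) y ^+ j / j`!%:R <= expR y.
  move=> y0; rewrite -ser; apply: nondecreasing_cvgn_le; last exact: is_cvg_series_exp_coeff.
  apply/nondecreasing_seqP => k; rewrite !ser big_ord_recr/= lerDl; exact: t0.
rewrite subr_ge0 part//= lerBlDl.
apply: limr_le; first exact: is_cvg_series_exp_coeff.
near=> n; rewrite ser.
have mn : (m <= n)%N by near: n; exact: nbhs_infty_ge.
rewrite -(big_mkord predT (fun j => (x * z) ^+ j / j`!%:R)).
rewrite (@big_cat_nat _ _ _ m)//= big_mkord lerD2l.
apply: (@le_trans _ _ (z ^+ m * \sum_(m <= j < n) x ^+ j / j`!%:R)).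
  rewrite mulr_sumr; apply: ler_sum_nat => j /andP[mj _].
  rewrite exprMn mulrAC mulrC ler_wpM2r ?t0//.
  by rewrite ler_wiXn2l.
rewrite ler_wpM2l ?exprn_ge0//; apply: le_trans (part n x x0).
rewrite -(big_mkord predT (fun j => x ^+ j / j`!%:R)) (@big_cat_nat _ _ _ m 0 n)//=.
by rewrite lerDr sumr_ge0// => j _; exact: t0.
Unshelve. all: by end_near.
Qed.

Section laws_of_counts.
Context d (Om : measurableType d) {R : realType} (P : probability Om R).

Definition mcount (V : Om -> nat) := forall k, measurable [set w | V w = k].

Lemma bmeas_count (V : Om -> nat) (f : nat -> R) : mcount V ->
  (exists M, forall k, `|f k| <= M) -> bmeas (fun w => f (V w)).
Proof.
move=> mV [M fM]; split; last by exists M.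
move=> _ Y mY; rewrite setTI.
have -> : (fun w => f (V w)) @^-1` Y = \bigcup_(k in [set k | Y (f k)]) [set w | V w = k].
  by apply/seteqP; split=> [w Yw|w [k Yk /= Vk]]; [exists (V w)|rewrite /= Vk].
exact: bigcup_measurable.
Qed.

Lemma bmeas_eq_count (V : Om -> nat) m : mcount V -> bmeas (fun w => (V w == m)%:R : R).
Proof.
move=> mV; apply: (bmeas_count (f := fun k => (k == m)%:R)) => //.
by exists 1 => k; case: eqP => _; rewrite ?normr1 ?normr0.
Qed.

Lemma bmeas_pow_count (V : Om -> nat) (z : R) : mcount V -> 0 <= z <= 1 ->
  bmeas (fun w => z ^+ V w).
Proof.
move=> mV /andP[z0 z1]; apply: (bmeas_count (f := fun k => z ^+ k)) => //.
by exists 1 => k; rewrite ger0_norm ?exprn_ge0// exprn_ile1.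
Qed.

Definition poisson_mass (lam : R) (m : nat) : R := expR (- lam) * lam ^+ m / m`!%:R.

(** Induction on m: once the masses below m converge, the generating function minus their terms,
    divided by z ^ m, is the mass at m up to an error of order z, and z is arbitrary. The weight U
    stands for the other coordinates, so that the lemma applies to one coordinate at a time. *)
Lemma law_of_generating_function (I : Type) (F : set_system I) (FF : ProperFilter F)
    (U : I -> Om -> R) (V : I -> Om -> nat) (A lam : R) :
  (forall t, bmeas (U t)) -> (forall t w, 0 <= U t w <= 1) ->
  (forall t, mcount (V t)) -> 0 <= A -> 0 <= lam ->
  (forall z, 0 <= z <= 1 ->
    Ex P (fun w => U t w * z ^+ V t w) @[t --> F] --> A * expR (- (lam * (1 - z)))) ->
  forall m, Ex P (fun w => U t w * (V t w == m)%:R) @[t --> F] --> A * poisson_mass lam m.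
Proof.
move=> bU U01 mV A0 lam0 hz; elim/ltn_ind => m ih.
apply/cvgrPdist_le => tol tol0.
(* The remainders after index m are at most z ^ m.+1 before the limit and A * z ^ m.+1 in the limit;
   this z makes their sum at most half of z ^ m * tol. *)
pose z := Num.min 1 (tol / (2 * (1 + A))).
have A1 : 0 < 1 + A by lra.
have z0 : 0 < z by rewrite lt_min ltr01 divr_gt0// mulr_gt0.
have z1 : z <= 1 by rewrite ge_min lexx.
have z01 : 0 <= z <= 1 by rewrite (ltW z0).
have zt : (1 + A) * z <= tol / 2.
  have : z <= tol / (2 * (1 + A)) by rewrite ge_min lexx orbT.
  rewrite -(ler_pM2l A1) => /le_trans; apply.
  by rewrite le_eqVlt; apply/orP; left; apply/eqP; field; rewrite gt_eqF.
have zm0 : 0 < z ^+ m by rewrite exprn_gt0.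
pose x (j : nat) t := Ex P (fun w => U t w * (V t w == j)%:R).
pose qj j := A * poisson_mass lam j.
(* The other half is shared by the generating function and the m lower masses. *)
pose eps := z ^+ m * (tol / 2) / (m.+1)%:R.
have eps0 : 0 < eps by rewrite divr_gt0// mulr_gt0// divr_gt0.
have bx j t : bmeas (fun w => U t w * (V t w == j)%:R).
  by apply: bmeasM => //; exact: bmeas_eq_count.
have bz t : bmeas (fun w => U t w * z ^+ V t w).
  by apply: bmeasM => //; exact: bmeas_pow_count.
have dec t : let e := Ex P (fun w => U t w * z ^+ V t w) in
    0 <= e - \sum_(j < m.+1) z ^+ j * x j t <= z ^+ m.+1.
  have -> : \sum_(j < m.+1) z ^+ j * x j t =
      Ex P (fun w => \sum_(j < m.+1) z ^+ j * (U t w * (V t w == j)%:R)).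
    rewrite Ex_sum; first by apply: eq_bigr => j _; rewrite ExZ.
    by move=> j _; exact: bmeasZ.
  have bs : bmeas (fun w => \sum_(j < m.+1) z ^+ j * (U t w * (V t w == j)%:R)).
    by apply: bmeas_sum => j _; exact: bmeasZ.
  rewrite /= -ExB//.
  have pt w : 0 <= U t w * z ^+ V t w -
      \sum_(j < m.+1) z ^+ j * (U t w * (V t w == j)%:R) <= z ^+ m.+1.
    have /andP[u0 u1] := U01 t w.
    have [Vm|Vm] := ltnP (V t w) m.+1.
      rewrite (bigD1 (Ordinal Vm))//= eqxx mulr1 big1 ?addr0; last first.
        move=> j jV; rewrite (_ : (V t w == j) = false) ?mulr0//.
        by apply/negbTE; apply: contra jV => /eqP jV; apply/eqP/val_inj.
      by rewrite mulrC subrr lexx exprn_ge0// ltW.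
    rewrite big1 ?subr0; last first.
      move=> j _; rewrite (_ : (V t w == j) = false) ?mulr0//.
      by apply/negbTE; rewrite gtn_eqF// (leq_trans (ltn_ord j)).
    rewrite mulr_ge0 ?exprn_ge0 ?(ltW z0)//=.
    apply: (@le_trans _ _ (1 * z ^+ V t w)); first by rewrite ler_wpM2r ?exprn_ge0 ?(ltW z0).
    by rewrite mul1r ler_wiXn2l// ltW.
  apply/andP; split; first by apply: Ex_ge0 => w; case/andP: (pt w).
  rewrite -[leRHS](@Ex_cst _ _ _ P); apply: le_Ex => [||w].
  - exact: bmeasB.
  - exact: bmeas_cst.
  - by case/andP: (pt w).
have lim : 0 <= A * expR (- (lam * (1 - z))) - \sum_(j < m.+1) z ^+ j * qj j <= A * z ^+ m.+1.
  have /andP[r0 r1] := @expR_taylor_remainder _ lam z m.+1 lam0 z01.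
  have -> : A * expR (- (lam * (1 - z))) - \sum_(j < m.+1) z ^+ j * qj j =
      A * expR (- lam) * (expR (lam * z) - \sum_(j < m.+1) (lam * z) ^+ j / j`!%:R).
    rewrite [RHS]mulrBr; congr (_ - _).
      by rewrite -mulrA -expRD; congr (_ * expR _); ring.
    rewrite mulr_sumr; apply: eq_bigr => j _; rewrite /qj /poisson_mass exprMn.
    by field; rewrite gt_eqF// ltr0n fact_gt0.
  have Ae0 : 0 <= A * expR (- lam) by rewrite mulr_ge0// expR_ge0.
  apply/andP; split; first exact: mulr_ge0.
  apply: (le_trans (ler_wpM2l Ae0 r1)).
  have -> : A * expR (- lam) * (z ^+ m.+1 * expR lam) =
    A * z ^+ m.+1 * (expR (- lam) * expR lam) by ring.
  by rewrite -expRD addNr expR0 mulr1.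
have fin : \forall t \near F, forall j : 'I_m, `|qj j - x j t| <= eps.
  apply: filter_forall => j.
  by move/cvgrPdist_le : (ih j (ltn_ord j)); exact.
near=> t.
have he : `|A * expR (- (lam * (1 - z))) - Ex P (fun w => U t w * z ^+ V t w)| <= eps.
  by near: t; move/cvgrPdist_le : (hz z z01); exact.
have hj : forall j : 'I_m, `|qj j - x j t| <= eps by near: t.
have := dec t; rewrite /=; move: lim he.
set e := Ex P _; set ee := A * expR _.
rewrite !big_ord_recr/=.
have hs : `|\sum_(j < m) z ^+ j * qj j - \sum_(j < m) z ^+ j * x j t| <= m%:R * eps.
  rewrite -sumrB; apply: le_trans (ler_norm_sum _ _ _) _.
  apply: (@le_trans _ _ (\sum_(j < m) eps)).
    apply: ler_sum => j _; rewrite -mulrBr normrM; apply: le_trans (hj j).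
    by rewrite ler_piMl// ger0_norm ?exprn_ge0 ?(ltW z0)// exprn_ile1// ltW.
  by rewrite sumr_const card_ord -[leLHS]mulr_natl.
move: hs; set s1 := \sum_(j < m) _; set s2 := \sum_(j < m) _.
rewrite -/(qj m) -/(x m t) => hs lim he hd.
have e1 : eps + m%:R * eps = z ^+ m * (tol / 2).
  by rewrite -{1}[eps]mul1r -mulrDl nat1r /eps mulrC divfK.
have main : z ^+ m * `|qj m - x m t| <= z ^+ m * tol.
  rewrite -[z ^+ m in leLHS]gtr0_norm// -normrM mulrBr.
  have zz : (1 + A) * z ^+ m.+1 <= z ^+ m * (tol / 2).
    have -> : (1 + A) * z ^+ m.+1 = z ^+ m * ((1 + A) * z) by rewrite exprS; ring.
    by rewrite ler_pM2l.
  rewrite -/(qj m) in lim *.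
  move: hs lim he hd e1 zz; rewrite !ler_norml.
  move: (z ^+ m * qj m) (z ^+ m * x m t) (m%:R * eps) => a1 a2 a3.
  move=> /andP[? ?] /andP[? ?] /andP[? ?] /andP[? ?] ? ?.
  by apply/andP; split; lra.
by rewrite -(ler_pM2l zm0).
Unshelve. all: by end_near.
Qed.

(* The coordinates are turned one after the other from powers into indicators. *)
Lemma joint_law_of_generating_function (J : finType) (I : Type) (F : set_system I)
    (FF : ProperFilter F) (V : I -> J -> Om -> nat) (lam : J -> R) :
  (forall t j, mcount (V t j)) -> (forall j, 0 <= lam j) ->
  (forall z : J -> R, (forall j, 0 <= z j <= 1) ->
    Ex P (fun w => \prod_j z j ^+ V t j w) @[t --> F] -->
      \prod_j expR (- (lam j * (1 - z j)))) ->
  forall m : J -> nat, Ex P (fun w => \prod_j (V t j w == m j)%:R) @[t --> F] -->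
      \prod_j poisson_mass (lam j) (m j).
Proof.
move=> mV lam0 hz m.
pose phi (r : seq J) (z : J -> R) t j w : R :=
  if j \in r then (V t j w == m j)%:R else z j ^+ V t j w.
pose psi (r : seq J) (z : J -> R) j : R :=
  if j \in r then poisson_mass (lam j) (m j) else expR (- (lam j * (1 - z j))).
have bphi r z t j : (forall j, 0 <= z j <= 1) -> bmeas (phi r z t j).
  move=> z01; rewrite /phi; case: (j \in r); first exact: bmeas_eq_count.
  exact: bmeas_pow_count.
have phi01 r z t j w : (forall j, 0 <= z j <= 1) -> 0 <= phi r z t j w <= 1.
  move=> z01; rewrite /phi; case: (j \in r).
    by case: eqP => _; rewrite ?lexx ?ler01.
  by case/andP: (z01 j) => ? ?; rewrite exprn_ge0//= exprn_ile1.
have psi0 r z j : 0 <= psi r z j.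
  rewrite /psi; case: ifP => _; last exact: expR_ge0.
  by rewrite /poisson_mass divr_ge0// mulr_ge0 ?expR_ge0// exprn_ge0.
have main r : forall z, (forall j, 0 <= z j <= 1) ->
    Ex P (fun w => \prod_j phi r z t j w) @[t --> F] --> \prod_j psi r z j.
  elim: r => [|i r ih] z z01.
    exact: hz.
  have [ir|ir] := boolP (i \in r).
    have e j : (j \in i :: r) = (j \in r).
      by rewrite inE; case: eqP => [->|//]; rewrite ir.
    have -> : \prod_j psi (i :: r) z j = \prod_j psi r z j.
      by apply: eq_bigr => j _; rewrite /psi e.
    have -> : (fun t => Ex P (fun w => \prod_j phi (i :: r) z t j w)) =
        (fun t => Ex P (fun w => \prod_j phi r z t j w)).
      apply/funext => t; congr (Ex P _); apply/funext => w.
      by apply: eq_bigr => j _; rewrite /phi e.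
    exact: ih.
  pose U t w := \prod_(j | j != i) phi r z t j w.
  have other j : j != i -> (j \in i :: r) = (j \in r).
    by move=> ji; rewrite inE (negbTE ji).
  have UE t w : \prod_j phi (i :: r) z t j w = U t w * (V t i w == m i)%:R.
    rewrite (bigD1 i)//= {1}/phi inE eqxx/= mulrC; congr (_ * _).
    by apply: eq_bigr => j ji; rewrite /phi other.
  have -> : \prod_j psi (i :: r) z j =
     (\prod_(j | j != i) psi r z j) * poisson_mass (lam i) (m i).
    rewrite (bigD1 i)//= {1}/psi inE eqxx/= mulrC; congr (_ * _).
    by apply: eq_bigr => j ji; rewrite /psi other.
  under eq_fun do under eq_fun do rewrite UE.
  apply: (@law_of_generating_function _ F FF U (fun t => V t i)) => //.
  - by move=> t; apply: bmeas_prod => j _; exact: bphi.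
  - move=> t w; rewrite prodr_ge0 ?prodr_ile1// => j _; first exact: phi01.
    by case/andP: (phi01 r z t j w z01).
  - exact: prodr_ge0.
  move=> y y01; pose z' j := if j == i then y else z j.
  have z'01 j : 0 <= z' j <= 1 by rewrite /z'; case: ifP.
  have := ih z' z'01.
  have -> : \prod_j psi r z' j =
     (\prod_(j | j != i) psi r z j) * expR (- (lam i * (1 - y))).
    rewrite (bigD1 i)//= {1}/psi (negbTE ir) {1}/z' eqxx mulrC; congr (_ * _).
    by apply: eq_bigr => j ji; rewrite /psi /z' (negbTE ji).
  rewrite (_ : (fun t => Ex P (fun w => \prod_j phi r z' t j w)) =
    (fun t => Ex P (fun w => U t w * y ^+ V t i w)))//.
  apply/funext => t; congr (Ex P _); apply/funext => w.
  rewrite (bigD1 i)//= {1}/phi (negbTE ir) {1}/z' eqxx mulrC; congr (_ * _).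
  by apply: eq_bigr => j ji; rewrite /phi /z' (negbTE ji).
have := main (enum J) (fun=> 0) (fun=> ltac:(by rewrite lexx ler01)).
have -> : \prod_j psi (enum J) (fun=> 0) j = \prod_j poisson_mass (lam j) (m j).
  by apply: eq_bigr => j _; rewrite /psi mem_enum.
rewrite (_ : (fun t => Ex P (fun w => \prod_j phi (enum J) (fun=> 0) t j w)) =
    (fun t => Ex P (fun w => \prod_j (V t j w == m j)%:R)))//.
apply/funext => t; congr (Ex P _); apply/funext => w.
by apply: eq_bigr => j _; rewrite /phi mem_enum.
Qed.

End laws_of_counts.

(** * Dyadic cells *)

Lemma integral_expRN {R : realType} (a : R) :
  (\int[lebesgue_measure]_(y in `]a, +oo[) (expR (- y))%:E = (expR (- a))%:E)%E.
Proof.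
have cE (x : R) : {for x, continuous (fun y : R => expR (- y))}.
  by apply: continuous_comp; [exact: opp_continuous|exact: continuous_expR].
rewrite integral_itv_obnd_cbnd; last first.
  by apply/measurable_EFinP; apply: measurableT_comp => //; exact: measurable_expR.
rewrite (@ge0_continuous_FTC2y _ _ (fun y => - expR (- y)) _ 0)//.
- by rewrite EFinN oppeK add0e.
- by apply: continuous_subspaceT => x; exact: cE.
- rewrite -oppr0; apply: cvgN; exact: cvgr_expR.
- by apply: cvgN; apply/cvg_at_right_filter; exact: cE.
- move=> z _; rewrite derive1_comp// derive1N// derive1_id mulN1r derive1_comp// derive1E.
  have /funeqP -> := @derive_expR R.
  by rewrite derive1N// derive1_id mulrN1 opprK.
Qed.

(** * Intensity of rectangular cells *)

Section cell_intensity.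
Context {R : realType}.
Variables (q : nat) (tau : nat -> R).
Hypothesis tau_nd : forall b c, (b <= c < q)%N -> tau b <= tau c.
Variable p : nat.
Hypothesis p0 : (0 < p)%N.
Local Notation u := (level_rate q tau).

Let height_itv b : interval R :=
  if (b.+1 < q)%N then `]tau b, tau b.+1] else `]tau b, +oo[.

Let integral_height b : (b < q)%N ->
  (\int[lebesgue_measure]_(y in [set` height_itv b]) (expR (- y))%:E =
   (u b - u b.+1)%:E)%E.
Proof.
move=> bq; rewrite /height_itv /level_rate bq.
case: ifPn => b1; last by rewrite subr0 integral_expRN.
have bb : tau b <= tau b.+1 by apply: tau_nd; rewrite leqnSn.
have mE (A : set R) : measurable_fun A (fun y : R => (expR (- y))%:E).
  by apply/measurable_EFinP; apply: measurableT_comp => //; exact: measurable_expR.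
have := integral_expRN (tau b).
have -> : (`]tau b, +oo[ = `]tau b, tau b.+1] `|` `]tau b.+1, +oo[ :> set R)%classic.
  by apply: itv_bndbnd_setU; rewrite bnd_simp.
rewrite ge0_integral_setU//=; last first.
  rewrite disj_set2E; apply/eqP; rewrite -subset0 => y [/=].
  by rewrite !in_itv/= andbT => /andP[_ y1]; rewrite ltNge y1.
  exact: mE.
rewrite integral_expRN => h.
by move: (congr1 (fun t => t - (expR (- tau b.+1))%:E)%E h); rewrite addeK// EFinB.
Qed.

Let cell_preimage a b : (a < p)%N ->
  [set x : R * R | (0 <= x.1 <= 1)%R /\ cell q tau p a b (x.1, x.2%:E)] =
  xcell p a `*` [set` height_itv b].
Proof.
move=> ap; have p0' : 0 < p%:R :> R by rewrite ltr0n.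
apply/seteqP; split=> -[x y] /=.
  move=> [_ [xa [y1 y2]]]; split=> //=; rewrite /height_itv.
  move: y1; rewrite lte_fin => y1.
  by case: ifPn => b1; rewrite /= in_itv/= y1//=; have := y2 b1; rewrite lee_fin.
move=> [xa yb]; split; last first.
  split=> //=; move: yb; rewrite /height_itv.
  case: ifPn => b1 /=; rewrite in_itv/= ?andbT.
    by move=> /andP[y1 y2]; split=> // _; rewrite lee_fin.
  by move=> yb; split=> //; rewrite (negbTE b1).
move: xa; rewrite /xcell /= in_itv/= => /andP[x1 x2].
rewrite (le_trans _ x1) ?divr_ge0//=.
have : x <= a.+1%:R / p%:R by move: x2; case: (_ != _); [exact: ltW|].
by move=> /le_trans; apply; rewrite ler_pdivrMr// mul1r ler_nat.
Qed.

Let measure_xcell a : (a < p)%N -> (lebesgue_measure (xcell p a : set R) = (p%:R^-1)%:E)%E.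
Proof.
move=> ap; have p0' : 0 < p%:R :> R by rewrite ltr0n.
rewrite /xcell lebesgue_measure_itv/= lte_fin ltr_pM2r ?invr_gt0// ltr_nat ltnSn.
by rewrite -EFinB -mulrBl -natr1 addrC addKr mul1r.
Qed.

(** By Tonelli, the width 1 / p times the mass of the height interval. The top cells contain height
    +oo, which [intensity] does not see. *)
Lemma intensity_cell a b : (a < p)%N -> (b < q)%N ->
  intensity (cell q tau p a b) = ((u b - u b.+1) / p%:R)%:E.
Proof.
move=> ap bq; rewrite /intensity cell_preimage//.
have mA : measurable (xcell p a : set R) by exact: measurable_itv.
have mY : measurable ([set` height_itv b] : set R) by exact: measurable_itv.
pose f (z : R * R) : \bar R := (\1_(xcell p a) z.1 * (\1_[set` height_itv b] z.2 * expR (- z.2)))%:E.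
rewrite integral_mkcond.
have -> : ((fun z : R * R => (expR (- z.2))%:E) \_ (xcell p a `*` [set` height_itv b])) = f.
  apply/funext => -[x y]; rewrite patchE /f /= !indicE.
  have [xa|xa] := pselect (xcell p a x); last first.
    rewrite (memNset xa) mul0r memNset// => -[]//.
  have [yb|yb] := pselect ([set` height_itv b] y); last first.
    rewrite (memNset yb) mul0r mulr0 memNset// => -[]//.
  by rewrite (mem_set xa) (mem_set yb) !mul1r mem_set.
have mf : measurable_fun setT f.
  apply/measurable_EFinP; apply: measurable_funM.
    by apply: measurableT_comp => //; exact: measurable_indic.
  apply: measurable_funM.
    by apply: measurableT_comp => //; exact: measurable_indic.
  apply: measurableT_comp; first exact: measurable_expR.
  by apply: measurableT_comp.
have f0 z : (0 <= f z)%E.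
  by rewrite /f lee_fin !mulr_ge0 ?expR_ge0// indicE.
rewrite fubini_tonelli1//= /fubini_F.
have mE (A : set R) : measurable_fun A (fun y : R => (expR (- y))%:E).
  by apply/measurable_EFinP; apply: measurableT_comp => //; exact: measurable_expR.
under eq_integral => x _.
  have -> : (\int[lebesgue_measure]_y f (x, y) = (\1_(xcell p a) x)%:E * (u b - u b.+1)%:E)%E.
    rewrite -(integral_height bq) [in RHS]integral_mkcond.
    rewrite -ge0_integralZl//.
    - apply: eq_integral => y _; rewrite /f /= EFinM; congr (_ * _)%E.
      rewrite patchE indicE; case: (_ \in _); by rewrite ?mul1r ?mul0r.
    - by apply/(measurable_restrictT _ _).1; [exact: mY|exact: mE].
    - by move=> y _; rewrite patchE; case: ifP => // _; rewrite lee_fin expR_ge0.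
  over.
rewrite ge0_integralZr//=; last 2 first.
- by apply/measurable_EFinP; exact: measurable_indic.
- have := integral_height bq => <-; apply: integral_ge0 => y _; rewrite lee_fin; exact: expR_ge0.
rewrite integral_indic// setIT [X in (X * _)%E](measure_xcell ap) -EFinM.
by rewrite mulrC.
Qed.

End cell_intensity.

(** * The dyadic partition of the state space *)

Section dyadic_cells.
Context {R : realType}.
Implicit Types (n a b : nat) (x : R) (y : \bar R).

(** The interval ]-1, 1] of contracted heights splits into 2 * 2 ^ n pieces of length 2 ^ (- n); the
    lowest one, which accumulates at -oo, is left out. *)
Definition dyadic_levels n : nat := (2 ^ n.+1).-1.
Local Notation q := dyadic_levels.

(* Heights are equidistant in the coordinate [contract y], the one defining the
   topology of the extended line. *)
Definition dyadic_height n b : R := fine (expand (-1 + b.+1%:R / (2 ^ n)%:R)).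
Local Notation tau := dyadic_height.

Definition dyadic_index n : finType := ('I_(2 ^ n) * 'I_(q n))%type.

Definition dyadic_cell n (j : dyadic_index n) : set (R * \bar R) :=
  cell (q n) (tau n) (2 ^ n) j.1 j.2.

(** The union of the cells of level n. These sets increase to the state space, and every compact
    subset of it lies in one of them. *)
Definition upper_set n : set (R * \bar R) :=
  [set z | 0 <= z.1 <= 1 /\ -1 + (2 ^ n)%:R^-1 < contract z.2].

Let p0 n : 0 < (2 ^ n)%:R :> R.
Proof. by rewrite ltr0n expn_gt0. Qed.

Let qE n : (q n).+1 = (2 * 2 ^ n)%N.
Proof. by rewrite /q prednK ?expn_gt0// expnS. Qed.

Let height_lt1 n b : (b < q n)%N -> `|-1 + b.+1%:R / (2 ^ n)%:R| < 1 :> R.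
Proof.
move=> bq; rewrite ltr_norml ltrDl divr_gt0//= addrC ltrBlDl -[1 + 1]/(2%:R) ltr_pdivrMr//.
by rewrite -natrM ltr_nat -qE.
Qed.

Lemma contract_dyadic_height n b : (b < q n)%N ->
  contract (tau n b)%:E = -1 + b.+1%:R / (2 ^ n)%:R.
Proof.
move=> bq; rewrite /tau fine_expand ?height_lt1// expandK//.
by rewrite inE ltW// height_lt1.
Qed.

Lemma dyadic_height_nd n b c : (b <= c < q n)%N -> tau n b <= tau n c.
Proof.
move=> /andP[bc cq]; rewrite -lee_fin -le_contract !contract_dyadic_height ?(leq_ltn_trans bc)//.
by rewrite lerD2l ler_pM2r ?invr_gt0// ler_nat.
Qed.

Lemma dyadic_levels_gt0 n : (0 < q n)%N.
Proof. by rewrite -ltnS qE (@leq_mul 2 1)// expn_gt0. Qed.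

Lemma dyadic_cellP n (j : dyadic_index n) (z : R * \bar R) :
  dyadic_cell j z <-> xcell (2 ^ n) j.1 z.1 /\
    -1 + j.2.+1%:R / (2 ^ n)%:R < contract z.2 <= -1 + j.2.+2%:R / (2 ^ n)%:R.
Proof.
case: j z => a b [x y] /=; have bq := ltn_ord b.
have yb : ((tau n b)%:E < y)%E = (-1 + b.+1%:R / (2 ^ n)%:R < contract y).
  by rewrite -contract_dyadic_height// lt_contract.
split=> [[xa [/=]]|[xa /andP[y1 y2]]].
  rewrite yb => y1 y2; split=> //; rewrite y1/=.
  have [b1|b1] := ltnP b.+1 (q n).
    by rewrite -contract_dyadic_height// le_contract y2.
  (* In the top class the upper end is 1, the contraction of +oo, so the bound holds for every
     height. *)
  have -> : b.+2 = (2 * 2 ^ n)%N by rewrite -qE; apply/eqP; rewrite eqSS eqn_leq b1 andbT.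
  rewrite natrM mulfK ?gt_eqF// -[2%:R]/(1 + 1) addKr.
  by have := contract_le1 y; rewrite ler_norml => /andP[].
split=> //; split=> /=; first by rewrite yb.
by move=> b1; rewrite -le_contract contract_dyadic_height.
Qed.

Lemma xcell_bounds p a x : (a < p)%N -> xcell p a x ->
  [/\ a%:R / p%:R <= x, x <= a.+1%:R / p%:R & 0 <= x <= 1].
Proof.
move=> ap; have p' : 0 < p%:R :> R by rewrite ltr0n (leq_ltn_trans _ ap).
rewrite /xcell /= in_itv/= => /andP[x1 x2].
have x3 : x <= a.+1%:R / p%:R by move: x2; case: (_ != _); [exact: ltW|].
split=> //; rewrite (le_trans _ x1) ?divr_ge0//=.
by rewrite (le_trans x3)// ler_pdivrMr// mul1r ler_nat.
Qed.

Lemma dyadic_cell_upper n (j : dyadic_index n) : dyadic_cell j `<=` upper_set n.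
Proof.
move=> z /dyadic_cellP[xa /andP[y1 _]]; have [_ _ x01] := xcell_bounds (ltn_ord _) xa.
split=> //; apply: le_lt_trans y1.
by rewrite lerD2l -[X in X <= _]mul1r ler_pM2r ?invr_gt0// ler1n.
Qed.

Lemma upper_set_state n : upper_set n `<=` state_space.
Proof.
move=> [x y] [/= x01 y1]; split=> //=.
by apply/eqP => yoo; move: y1; rewrite yoo /= gtrDl invr_lt0 ltNge ltW.
Qed.

Lemma dyadic_cell_exists n z : upper_set n z -> exists j : dyadic_index n, dyadic_cell j z.
Proof.
case: z => x y [/= /andP[x0 x1] y1].
have [a xa] : exists a : 'I_(2 ^ n), xcell (2 ^ n) a x.
  have [-> |xn1] := eqVneq x 1.
    have l : ((2 ^ n).-1 < 2 ^ n)%N by rewrite prednK ?expn_gt0.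
    exists (Ordinal l); rewrite /xcell /= in_itv/= prednK ?expn_gt0// eqxx/=.
    by rewrite divff ?gt_eqF//= lexx andbT ler_pdivrMr// mul1r ler_nat leq_pred.
  have x1' : x < 1 by rewrite lt_neqAle xn1.
  have xp0 : 0 <= x * (2 ^ n)%:R by rewrite mulr_ge0.
  have /andP[t1 t2] := truncn_itv xp0.
  have l : (Num.truncn (x * (2 ^ n)%:R) < 2 ^ n)%N.
    by rewrite -(ltr_nat R) (le_lt_trans t1)// gtr_pMl.
  exists (Ordinal l); rewrite /xcell /= in_itv/= ler_pdivrMr// t1/=.
  by case: (_ != _); rewrite /= ?ltr_pdivlMr// ?ler_pdivlMr// ltW.
set c := (contract y + 1) * (2 ^ n)%:R.
have c1 : 1 < c.
  by rewrite /c -ltr_pdivrMr// mul1r -ltrBlDr addrC.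
have c2 : c <= (2 * 2 ^ n)%:R.
  rewrite natrM ler_pM2r// -[2%:R]/(1 + 1) lerD2r.
  by have := contract_le1 y; rewrite ler_norml => /andP[].
(* Height classes are open below and closed above, so m is one less than the ceiling of c. *)
have [m m1 m2] : exists2 m : nat, m%:R < c & c <= m.+1%:R.
  have ex : exists m : nat, c <= m%:R.
    by exists (Num.truncn c).+1; apply/ltW; exact: truncnS_gt.
  case: (ex_minnP ex) => -[|k] ck kmin; first by move: ck; rewrite leNgt (lt_trans _ c1).
  exists k => //; rewrite ltNge; apply/negP => /kmin; by rewrite ltnn.
have m0 : (0 < m)%N by rewrite -(ltr_nat R) -(ltrD2r 1) add0r natr1 (lt_le_trans c1).
have mq : (m.-1 < q n)%N by rewrite -ltnS prednK// qE -(ltr_nat R) (lt_le_trans m1).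
exists (a, Ordinal mq); apply/dyadic_cellP; split=> //=.
by rewrite prednK// addrC ltrBlDr ltr_pdivrMr// m1/= addrC -lerBlDr opprK ler_pdivlMr.
Qed.

Lemma dyadic_cell_inj n (i j : dyadic_index n) z :
  dyadic_cell i z -> dyadic_cell j z -> i = j.
Proof.
case: i j => [a b] [a' b'] /dyadic_cellP[/= xa /andP[y1 y2]] /dyadic_cellP[/= xa' /andP[y3 y4]].
have bb : forall c c' : nat, -1 + c.+1%:R / (2 ^ n)%:R < contract z.2 ->
    contract z.2 <= -1 + c'.+2%:R / (2 ^ n)%:R -> (c <= c')%N.
  move=> c c' h /(lt_le_trans h).
  by rewrite ltrD2l ltr_pM2r ?invr_gt0// ltr_nat ltnS.
have aa : forall c c' : nat, (c' < 2 ^ n)%N -> xcell (2 ^ n) c z.1 -> xcell (2 ^ n) c' z.1 ->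
    (c' <= c)%N.
  move=> c c' cn xc; rewrite /xcell /= in_itv/= => /andP[x1 x2].
  rewrite leqNgt; apply/negP => cc'; move: xc.
  have c1 : c.+1 != (2 ^ n)%N.
    by rewrite neq_ltn (leq_ltn_trans cc').
  rewrite /xcell /= in_itv /= c1 /= => /andP[_ /(le_lt_trans x1)].
  by rewrite ltr_pM2r ?invr_gt0// ltr_nat ltnS leqNgt cc'.
congr pair; apply/val_inj/eqP; rewrite eqn_leq /=.
  by rewrite (aa _ _ (ltn_ord _) xa' xa) (aa _ _ (ltn_ord _) xa xa').
by rewrite (bb _ _ y1 y4) (bb _ _ y3 y2).
Qed.

Lemma measurable_dyadic_cell n (j : dyadic_index n) : measurable (dyadic_cell j).
Proof.
rewrite /dyadic_cell /cell; apply: measurableX; first exact: measurable_itv.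
have -> : ycell (q n) (tau n) j.2 = [set` Interval (BRight (tau n j.2)%:E)
    (if (j.2.+1 < q n)%N then BRight (tau n j.2.+1)%:E else +oo%O)].
  by apply/seteqP; split=> y; rewrite /ycell /= in_itv/=; case: ifP => jq /=;
    rewrite ?andbT; [move=> [-> /(_ erefl)->]|move=> []|move=> /andP[]|].
exact: emeasurable_itv.
Qed.

Lemma measure_dyadic_cells (mu : {measure set (R * \bar R) -> \bar R}) n
    (Q : pred (dyadic_index n)) :
  mu (\bigcup_(j in [set` Q]) dyadic_cell j) = (\sum_(j | Q j) mu (dyadic_cell j))%E.
Proof.
rewrite measure_fin_bigcup//.
- rewrite -(@bigfs _ _ _ _ (index_enum (dyadic_index n))) ?index_enum_uniq// => i _.
  by rewrite mem_index_enum.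
- by move=> i j _ _ [z [iz jz]]; exact: dyadic_cell_inj iz jz.
- by move=> j _; exact: measurable_dyadic_cell.
Qed.

Lemma upper_setE n : upper_set n = \bigcup_(j in [set: dyadic_index n]) dyadic_cell j.
Proof.
apply/seteqP; split=> [z /dyadic_cell_exists[j jz]|z [j _]]; first by exists j.
exact: dyadic_cell_upper.
Qed.

Lemma measurable_upper_set n : measurable (upper_set n).
Proof.
rewrite upper_setE; apply: fin_bigcup_measurable => [|j _]; first exact: finite_finset.
exact: measurable_dyadic_cell.
Qed.

Lemma upper_set_cells (mu : {measure set (R * \bar R) -> \bar R}) n :
  mu (upper_set n) = (\sum_(j : dyadic_index n) mu (dyadic_cell j))%E.
Proof.
rewrite upper_setE -measure_dyadic_cells; congr (mu _).
by apply: eq_bigcupl; split.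
Qed.

Lemma upper_set_nd m n : (m <= n)%N -> upper_set m `<=` upper_set n.
Proof.
move=> mn z [z1 z2]; split=> //; apply: le_lt_trans z2.
by rewrite lerD2l lef_pV2 ?posrE// ler_nat leq_pexp2l.
Qed.

Lemma state_upper_set : state_space = \bigcup_n upper_set n.
Proof.
apply/seteqP; split=> [[x y] /= [x01 yoo]|z [n _]]; last exact: upper_set_state.
have y1 : 0 < contract y + 1.
  rewrite -ltrBlDr add0r lt_neqAle eq_sym contract_eqN1 yoo/=.
  by have := contract_le1 y; rewrite ler_norml => /andP[].
have [n nb] : exists n : nat, (contract y + 1)^-1 < n%:R.
  by exists (Num.truncn (contract y + 1)^-1).+1; exact: truncnS_gt.
exists n => //; split; first by move: x01; rewrite /= in_itv.
rewrite addrC ltrBlDr invf_plt ?posrE//= (lt_trans nb)// ltr_nat.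
exact: ltn_expl.
Qed.

Lemma measurable_state_space : measurable (state_space : set (R * \bar R)).
Proof.
by rewrite state_upper_set; apply: bigcupT_measurable => n; exact: measurable_upper_set.
Qed.

End dyadic_cells.

Lemma dyadic_cell_state {R : realType} n (j : dyadic_index n) :
  dyadic_cell (R := R) j `<=` state_space.
Proof. by move=> z jz; apply: upper_set_state; exact: dyadic_cell_upper jz. Qed.

(** * Vaguely continuous functionals *)

(** An ultrafilter contains each set or its complement, so a cluster point is a limit. A single
    ultrafilter serves all coordinates at once, in place of diagonal subsequences. *)
Lemma ultra_cvg_compact (I : Type) (U : set_system I) (UU : UltraFilter U)
    (T : topologicalType) (K : set T) (s : I -> T) :
  compact K -> (forall i, K (s i)) -> exists2 p, K p & s i @[i --> U] --> p.
Proof.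
move=> cK sK; have FK : (s @ U) K by apply: nearW.
have [p [Kp clp]] := cK (s @ U) _ FK.
exists p => // V Vp; have [//|nV] := in_ultra_setVsetC (s @^-1` V) UU.
by have [x []] := clp (~` V) V nV Vp.
Qed.

Lemma ultra_cvg_itv {R : realType} (I : Type) (U : set_system I) (UU : UltraFilter U)
    (a b : R) (s : I -> R) : (forall i, a <= s i <= b) ->
  exists2 l, a <= l <= b & s i @[i --> U] --> l.
Proof.
move=> sab; have [i|l] := ultra_cvg_compact UU (@segment_compact R a b) (s := s).
  by rewrite /= in_itv/=; exact: sab.
by rewrite /= in_itv/=; exists l.
Qed.

Section test_functions.
Context {R : realType}.
Local Notation T := (R * \bar R)%type.
Implicit Types (f : T -> R) (x c : R).

Lemma cvg_contract (I : Type) (F : set_system I) (FF : Filter F) (y : I -> \bar R) (l : \bar R) :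
  y i @[i --> F] --> l <-> contract (y i) @[i --> F] --> contract l.
Proof.
split=> [/cvg_ballP h|/cvgrPdist_lt h]; [apply/cvgrPdist_lt => e e0; exact: h|].
by apply/cvg_ballP => e e0; exact: h.
Qed.

Lemma cvg_dyadic : ((2 ^ n)%:R^-1 : R) @[n --> \oo] --> (0 : R).
Proof.
under eq_fun do rewrite natrX -exprVn.
by apply: cvg_expr; rewrite ger0_norm ?invr_ge0// invf_lt1 ?ltr1n.
Qed.

(** Points of K outside every upper set would converge, along an ultrafilter, to a point of K at
    height -oo, which is not in the state space. *)
Lemma compact_upper_set (K : set T) : compact K -> K `<=` state_space ->
  exists k, K `<=` upper_set k.
Proof.
move=> cK sK; apply: contrapT => /forallNP nK.
have [z zK] : {z : nat -> T & forall k, K (z k) /\ ~ upper_set k (z k)}.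
  apply: (@choice _ _ (fun k z => K z /\ ~ upper_set k z)) => k.
  by apply: contrapT => /forallNP h; apply: (nK k) => z Kz; have /not_andP[//|/contrapT] := h z.
have [U [UU sU]] := @ultraFilterLemma nat \oo _.
have [p Kp zp] := ultra_cvg_compact UU cK (fun k => (zK k).1).
have /cvg_contract cp : (z i).2 @[i --> U] --> p.2.
  exact: (cvg_comp _ _ zp cvg_snd).
have [/= _] := sK _ Kp; apply/negP; rewrite negbK -contract_eqN1 eq_le; apply/andP; split; last first.
  by have := contract_le1 p.2; rewrite ler_norml => /andP[].
have : -1 + (2 ^ i)%:R^-1 @[i --> U] --> (-1 : R).
  rewrite -[X in _ --> X]addr0; apply: cvgD; first exact: cvg_cst.
  exact: (cvg_trans (cvg_app _ sU) cvg_dyadic).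
move=> dy; apply: (ler_cvg_to cp dy); apply: nearW => i; have [Kz nz] := zK i.
rewrite leNgt; apply/negP => cz; apply: nz; split=> //.
by have [] := sK _ Kz; rewrite /= in_itv.
Qed.

Lemma test_function_support f : test_function f ->
  exists k, forall z, state_space z -> ~ upper_set k z -> f z = 0.
Proof.
move=> [_ [K [cK sK fK]]]; have [k Kk] := compact_upper_set cK sK.
by exists k => z sz nz; apply: fK => // /Kk.
Qed.

(* [f] in the coordinates [(x, contract y)], extended by [0] to [y = -oo]. *)
Definition contracted f x c : R := if -1 < c then f (x, expand c) else 0.

Lemma contractedE f z : state_space z -> contracted f z.1 (contract z.2) = f z.
Proof.
case: z => x y [_ /= yoo]; rewrite /contracted lt_neqAle eq_sym contract_eqN1 yoo/=.
by have := contract_le1 y; rewrite ler_norml => /andP[-> _]; rewrite contractK.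
Qed.

Lemma contracted_state x c : 0 <= x <= 1 -> -1 < c -> state_space (x, expand c).
Proof.
by move=> x01 c1; split; rewrite /= ?in_itv//= expand_eqNoo -ltNge.
Qed.

Lemma contracted_low f k x c : (forall z, state_space z -> ~ upper_set k z -> f z = 0) ->
  0 <= x <= 1 -> c <= -1 + (2 ^ k)%:R^-1 -> contracted f x c = 0.
Proof.
move=> fk x01 ck; rewrite /contracted; case: ltP => // c1.
apply: fk; first exact: contracted_state.
move=> [_ /=]; rewrite expandK ?ltNge ?ck// inE ler_norml (ltW c1)/= (le_trans ck)//.
have : (2 ^ k)%:R^-1 <= 1 :> R by rewrite invf_le1 ?ltr0n ?expn_gt0// ler1n expn_gt0.
by rewrite addrC lerBlDr => /le_trans; apply; rewrite lerDl.
Qed.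

(** When c is at most -1, the points eventually lie below the support, where the value is 0;
    otherwise [expand] transports the continuity of f. So the extension by 0 is continuous down to
    height -oo. *)
Lemma cvg_contracted (I : Type) (F : set_system I) (FF : ProperFilter F) f (xs cs : I -> R) x c :
  test_function f -> (forall i, 0 <= xs i <= 1) -> (forall i, cs i <= 1) ->
  xs i @[i --> F] --> x -> cs i @[i --> F] --> c ->
  contracted f (xs i) (cs i) @[i --> F] --> contracted f x c.
Proof.
move=> tf xs01 cs1 xsx csc; have [c1|c1] := leP c (-1).
  have [k fk] := test_function_support tf.
  rewrite {2}/contracted ltNge c1/=; apply: (@cvg_near_cst _ _ _ _ _ FF).
  have : -1 + (2 ^ k)%:R^-1 > c by rewrite (le_lt_trans c1)// ltrDl invr_gt0 ltr0n expn_gt0.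
  move=> /(cvgr_lt _ csc); apply: filterS => i ci.
  exact: (contracted_low fk (xs01 i) (ltW ci)).
have x01 : 0 <= x <= 1.
  apply/andP; split.
    by apply: (cvgr_to_ge xsx); apply: nearW => i; have /andP[] := xs01 i.
  by apply: (cvgr_to_le xsx); apply: nearW => i; have /andP[] := xs01 i.
have c2 : `|c| <= 1.
  by rewrite ler_norml (ltW c1)/=; apply: (cvgr_to_le csc); exact: nearW.
have /subspace_continuousP/(_ _ (contracted_state x01 c1)) fc := tf.1.
rewrite {2}/contracted c1; apply: cvg_trans fc => V /= [[W1 W2] [/= xW1 cW2] WV].
have c3 : F [set i | -1 < cs i] by exact: (cvgr_gt _ csc).
have yc : expand (cs i) @[i --> F] --> expand c.
  apply/cvg_contract; rewrite expandK//.
  apply: cvg_trans csc; apply: near_eq_cvg; apply: filterS c3 => i ci.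
  by rewrite expandK// inE ler_norml cs1 ltW.
have F1 : F [set i | W1 (xs i)] by exact: xsx xW1.
have F2 : F [set i | W2 (expand (cs i))] by exact: yc cW2.
suff F3 : F [set i | V (contracted f (xs i) (cs i))] by exact: F3.
apply: filterS (filterI c3 (filterI F1 F2)) => i [ci [z1 z2]] /=.
by rewrite /contracted ci; apply: WV; [split|exact: contracted_state].
Qed.

Lemma dyadic_cell_diameter n (j : dyadic_index n) (z z' : T) :
  dyadic_cell j z -> dyadic_cell j z' ->
  `|z.1 - z'.1| <= (2 ^ n)%:R^-1 /\ `|contract z.2 - contract z'.2| <= (2 ^ n)%:R^-1.
Proof.
move=> /dyadic_cellP[xa /andP[y1 y2]] /dyadic_cellP[xa' /andP[y3 y4]].
have [x1 x2 _] := xcell_bounds (ltn_ord _) xa.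
have [x1' x2' _] := xcell_bounds (ltn_ord _) xa'.
split; rewrite ler_distl.
  move: x1 x2 x1' x2'.
  rewrite -[j.1.+1%:R]natr1 !(mulrDl _ 1) mul1r; clear=> *; apply/andP; split; lra.
move: y1 y2 y3 y4.
rewrite -[j.2.+2%:R]natr1 !(mulrDl _ 1) mul1r; clear=> *; apply/andP; split; lra.
Qed.

Lemma cvg_dyadic_close (U : set_system nat) (UU : ProperFilter U) (v v' : nat -> R) (l : R) :
  \oo `<=` U -> (forall n, `|v n - v' n| <= (2 ^ n)%:R^-1) ->
  v i @[i --> U] --> l -> v' i @[i --> U] --> l.
Proof.
move=> sU vv vl; have d0 := cvg_trans (cvg_app _ sU) cvg_dyadic.
rewrite -[l]subr0 (_ : v' = v \- (v \- v')); last first.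
  by apply/funext => i /=; rewrite opprB addrC subrK.
apply: cvgB => //; apply/norm_cvg0P.
apply: (squeeze_cvgr _ (cvg_cst (0 : R)) d0); apply: nearW => i.
by rewrite normr_ge0 /=; exact: vv.
Qed.

(** K is the state space minus the countably many dyadic cells that miss it: a point in no such cell
    shares cells of all high levels with points of K, and these converge to it. *)
Lemma measurable_compact (K : set T) : compact K -> K `<=` state_space -> measurable K.
Proof.
move=> cK sK.
have -> : K = state_space `\` \bigcup_n \bigcup_(j in [set j : dyadic_index n |
    dyadic_cell j `&` K = set0]) dyadic_cell j.
  apply/seteqP; split=> [z Kz|z [sz nz]].
    split; first exact: sK.
    by move=> [n _ [j jK jz]]; have : (dyadic_cell j `&` K) z by []; rewrite jK.
  have : state_space z by []; rewrite state_upper_set => -[m _ mz].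
  have [s sP] : {s : nat -> T & forall n, K (s n) /\ `|z.1 - (s n).1| <= (2 ^ n)%:R^-1 /\
      `|contract z.2 - contract (s n).2| <= (2 ^ n)%:R^-1}.
    apply: (@choice _ _ (fun n s => K s /\ `|z.1 - s.1| <= (2 ^ n)%:R^-1 /\
      `|contract z.2 - contract s.2| <= (2 ^ n)%:R^-1)) => n.
    have [j jz] := dyadic_cell_exists (upper_set_nd (leq_maxl m n) mz).
    have /eqP/set0P[p [jp Kp]] : dyadic_cell j `&` K <> set0.
      by move=> jK; apply: nz; exists (maxn m n) => //; exists j.
    have [d1 d2] := dyadic_cell_diameter jz jp; exists p; split=> //.
    have n2 : (2 ^ maxn m n)%:R^-1 <= (2 ^ n)%:R^-1 :> R.
      by rewrite lef_pV2 ?posrE ?ltr0n ?expn_gt0// ler_nat leq_pexp2l ?leq_maxr.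
    by split; [exact: le_trans d1 n2|exact: le_trans d2 n2].
  have [U [UU sU]] := @ultraFilterLemma nat \oo _.
  have [p Kp sp] := ultra_cvg_compact UU cK (fun k => (sP k).1).
  have c1 : (s i).1 @[i --> U] --> z.1.
    by apply: (cvg_dyadic_close _ sU _ (cvg_cst z.1)) => n; have [_ []] := sP n.
  have c2 : contract (s i).2 @[i --> U] --> contract z.2.
    by apply: (cvg_dyadic_close _ sU _ (cvg_cst (contract z.2))) => n; have [_ []] := sP n.
  have p1 : (s i).1 @[i --> U] --> p.1 by exact: (cvg_comp _ _ sp cvg_fst).
  have p2 : contract (s i).2 @[i --> U] --> contract p.2.
    by apply/cvg_contract; exact: (cvg_comp _ _ sp cvg_snd).
  have e1 : z.1 = p.1 by apply: (cvg_unique _ c1 p1); exact: norm_hausdorff.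
  have e2 : contract z.2 = contract p.2 by apply: (cvg_unique _ c2 p2); exact: norm_hausdorff.
  by rewrite (surjective_pairing z) e1 (contract_inj e2) -surjective_pairing.
apply: measurableD; first exact: measurable_state_space.
apply: bigcupT_measurable => n; apply: fin_bigcup_measurable => [|j _].
  exact: finite_finset.
exact: measurable_dyadic_cell.
Qed.

(** Two points of a failing pair in ever smaller cells converge along an ultrafilter to the same
    coordinates, where the extension of f is continuous. *)
Lemma test_function_oscillation f (eps : R) : test_function f -> 0 < eps ->
  exists n0, forall n, (n0 <= n)%N -> forall (j : dyadic_index n) z z',
    dyadic_cell j z -> dyadic_cell j z' -> `|f z - f z'| <= eps.
Proof.
move=> tf eps0; apply: contrapT => /forallNP nf.
have cs n (j : dyadic_index n) (z : T) : dyadic_cell j z -> state_space z.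
  by move=> /dyadic_cell_upper/upper_set_state.
have [s sP] : {s : nat -> T * T & forall n, [/\ state_space (s n).1, state_space (s n).2,
    `|(s n).1.1 - (s n).2.1| <= (2 ^ n)%:R^-1,
    `|contract (s n).1.2 - contract (s n).2.2| <= (2 ^ n)%:R^-1 &
    eps < `|f (s n).1 - f (s n).2| ]}.
  apply: (@choice _ _ (fun n s => [/\ state_space s.1, state_space s.2,
    `|s.1.1 - s.2.1| <= (2 ^ n)%:R^-1,
    `|contract s.1.2 - contract s.2.2| <= (2 ^ n)%:R^-1 &
    eps < `|f s.1 - f s.2| ])) => n0.
  have /existsNP[n /not_implyP[nn0 /existsNP[j /existsNP[z /existsNP[z' h]]]]] := nf n0.
  have /not_implyP[jz /not_implyP[jz' /negP]] := h; rewrite -ltNge => fzz.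
  have n2 : (2 ^ n)%:R^-1 <= (2 ^ n0)%:R^-1 :> R.
    by rewrite lef_pV2 ?posrE ?ltr0n ?expn_gt0// ler_nat leq_pexp2l.
  have [d1 d2] := dyadic_cell_diameter jz jz'.
  exists (z, z'); split=> //=; [exact: cs jz|exact: cs jz'| |]; exact: le_trans n2.
have [U [UU sU]] := @ultraFilterLemma nat \oo _.
have [x _ zx] : exists2 l : R, 0 <= l <= 1 & (s i).1.1 @[i --> U] --> l.
  by apply: ultra_cvg_itv => i; have [[/= + _] _ _ _ _] := sP i; rewrite in_itv.
have [c _ zc] : exists2 l : R, -1 <= l <= 1 & contract (s i).1.2 @[i --> U] --> l.
  by apply: ultra_cvg_itv => i; have := contract_le1 (s i).1.2; rewrite ler_norml.
have s1 n : state_space (s n).1 by have [] := sP n.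
have s2 n : state_space (s n).2 by have [] := sP n.
have zx' : (s i).2.1 @[i --> U] --> x by apply: cvg_dyadic_close zx => // n; have [] := sP n.
have zc' : contract (s i).2.2 @[i --> U] --> c by apply: cvg_dyadic_close zc => // n; have [] := sP n.
have cf (s' : nat -> T) : (forall n, state_space (s' n)) -> (s' i).1 @[i --> U] --> x ->
    contract (s' i).2 @[i --> U] --> c -> f (s' i) @[i --> U] --> contracted f x c.
  move=> ss zx0 zc0; under eq_fun do rewrite -contractedE//.
  apply: (cvg_contracted (@ultra_proper _ _ UU) tf) => // i.
    by have [] := ss i; rewrite /= in_itv.
  by have := contract_le1 (s' i).2; rewrite ler_norml => /andP[].
have f1 := cf _ s1 zx zc.
have f2 := cf _ s2 zx' zc'.
have f0 : f (s i).1 - f (s i).2 @[i --> U] --> (0 : R).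
  by rewrite -[X in _ --> X](subrr (contracted f x c)); apply: cvgB.
have /filter_ex[n] : \forall i \near U, `|0 - (f (s i).1 - f (s i).2)| < eps.
  by move/cvgrPdist_lt: f0; exact.
by rewrite sub0r normrN ltNge; have [_ _ _ _ /ltW ->] := sP n.
Qed.

End test_functions.

(** * Step functions on dyadic cells *)

Section dyadic_approximation.
Context {R : realType}.
Local Notation T := (R * \bar R)%type.
Implicit Types (f : T -> R) (mu : {measure set T -> \bar R}).

Let p0 n : 0 < (2 ^ n)%:R :> R.
Proof. by rewrite ltr0n expn_gt0. Qed.

(** The left and upper ends in the coordinates (x, contract y). Cells are closed on these sides, so
    the corner belongs to its cell. *)
Definition corner n (j : dyadic_index n) : R * R :=
  (j.1%:R / (2 ^ n)%:R, -1 + j.2.+2%:R / (2 ^ n)%:R).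

Definition representative n (j : dyadic_index n) : T := ((corner j).1, expand (corner j).2).

Lemma corner_bounds n (j : dyadic_index n) :
  0 <= (corner j).1 <= 1 /\ -1 < (corner j).2 <= 1.
Proof.
rewrite /= divr_ge0//= ler_pdivrMr// mul1r ler_nat (ltnW (ltn_ord _))//; split=> //.
rewrite ltrDl divr_gt0//= addrC lerBlDl -[1 + 1]/(2%:R) ler_pdivrMr//.
by rewrite -natrM ler_nat -expnS -[X in (_ <= X)%N]prednK ?expn_gt0// ltnS.
Qed.

Lemma contract_representative n (j : dyadic_index n) :
  contract (representative j).2 = (corner j).2.
Proof.
have [_ /andP[c1 c2]] := corner_bounds j.
by rewrite /= expandK// inE ler_norml c2 ltW.
Qed.

Lemma representative_in n (j : dyadic_index n) : dyadic_cell j (representative j).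
Proof.
apply/dyadic_cellP; rewrite contract_representative /= lexx ltrD2l ltr_pM2r ?invr_gt0//.
rewrite ltr_nat ltnSn; split=> //; rewrite /xcell /= in_itv/= lexx/=.
have lt : j.1%:R / (2 ^ n)%:R < j.1.+1%:R / (2 ^ n)%:R :> R.
  by rewrite ltr_pM2r ?invr_gt0// ltr_nat.
by case: (_ != _) => //=; exact: ltW.
Qed.

Definition step n f (z : T) : R :=
  \sum_(j : dyadic_index n) f (representative j) * \1_(dyadic_cell j) z.

Lemma step_cell n f (j : dyadic_index n) z : dyadic_cell j z ->
  step n f z = f (representative j).
Proof.
move=> jz; rewrite /step (bigD1 j)//= indicE mem_set// mulr1 big1 ?addr0// => i ij.
rewrite indicE memNset ?mulr0// => iz; move: ij; rewrite (dyadic_cell_inj iz jz).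
by rewrite eqxx.
Qed.

Lemma step_lower n f z : ~ upper_set n z -> step n f z = 0.
Proof.
move=> nz; rewrite /step big1// => j _; rewrite indicE memNset ?mulr0//.
by move/dyadic_cell_upper.
Qed.

(** Passing from z to the corner of its cell can raise the height by up to 2 ^ (- n), so the error
    may reach slightly below the support of f: hence k.+1 in place of k. *)
Lemma step_close f k eps : test_function f -> 0 < eps ->
  (forall z, state_space z -> ~ upper_set k z -> f z = 0) ->
  exists n0, forall n, (n0 <= n)%N -> forall z, state_space z ->
    `|f z - step n f z| <= eps * \1_(upper_set k.+1) z.
Proof.
move=> tf eps0 fk; have [n0 osc] := test_function_oscillation tf eps0.
exists (maxn n0 k.+1) => n; rewrite geq_max => /andP[nn0 nk] z sz.
have fk1 : ~ upper_set k.+1 z -> f z = 0 by move=> h; apply: fk => // /(upper_set_nd (leqnSn k)).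
have [nz|nz] := pselect (upper_set n z); last first.
  have nz1 : ~ upper_set k.+1 z by move=> /(upper_set_nd nk).
  by rewrite (step_lower _ nz) fk1// subr0 normr0 mulr_ge0// ltW.
have [j jz] := dyadic_cell_exists nz; rewrite (step_cell _ jz).
have [kz|kz] := pselect (upper_set k.+1 z); rewrite indicE.
  by rewrite mem_set// mulr1; apply: (osc n nn0 j) => //; exact: representative_in.
rewrite memNset// mulr0 fk1// fk ?subr0 ?normr0//.
  exact: (upper_set_state (dyadic_cell_upper (representative_in j))).
move=> [_]; apply/negP; rewrite -leNgt contract_representative.
have zk : contract z.2 <= -1 + (2 ^ k.+1)%:R^-1.
  by rewrite leNgt; apply/negP => h; apply: kz; split=> //; case: nz.
have /dyadic_cellP[_ /andP[y1 _]] := jz.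
have n2 : (2 ^ n)%:R^-1 <= (2 ^ k.+1)%:R^-1 :> R.
  by rewrite lef_pV2 ?posrE ?ltr0n ?expn_gt0// ler_nat leq_pexp2l.
have k2 : (2 ^ k)%:R^-1 = 2 * (2 ^ k.+1)%:R^-1 :> R.
  by rewrite expnS natrM invfM mulrA divff ?mul1r.
move: (lt_le_trans y1 zk) n2 => /=.
rewrite k2 -[j.2.+2%:R]natr1 (mulrDl _ 1) mul1r; clear; lra.
Qed.

Lemma measurable_step n f (D : set T) : measurable_fun D (step n f).
Proof.
rewrite /step; apply: measurable_sum => j; apply: measurable_funM => //.
by apply/measurable_funTS; apply: measurable_indic; exact: measurable_dyadic_cell.
Qed.

Lemma measurable_test_function f : test_function f -> measurable_fun state_space f.
Proof.
move=> tf; apply: (@measurable_fun_cvg _ _ _ _ (fun n => step n f)).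
  by move=> n; exact: measurable_step.
move=> z sz; apply/cvgrPdist_le => e e0.
have [k fk] := test_function_support tf.
have [n0 h] := step_close tf e0 fk; exists n0 => // n /= nn0.
by rewrite (le_trans (h n nn0 z sz))// ler_piMr ?(ltW e0)// indicE; case: (_ \in _).
Qed.

(** Integer counts under bounds that depend on the level only: this family of measures plays the
    role of a compact set. *)
Definition counts_le (N : nat -> nat) mu := forall n (j : dyadic_index n),
  exists2 m : nat, (m <= N n)%N & mu (dyadic_cell j) = m%:R%:E.

Definition upper_bound (N : nat -> nat) n : nat := (#|dyadic_index n| * N n)%N.

Lemma counts_le_upper N mu n : counts_le N mu ->
  (mu (upper_set n) <= (upper_bound N n)%:R%:E)%E.
Proof.
move=> muN; rewrite upper_set_cells (le_trans (lee_sum _ (g := fun=> (N n)%:R%:E) _))//.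
  by move=> j _; have [m mN ->] := muN n j; rewrite lee_fin ler_nat.
by rewrite sumEFin big_const iter_addr addr0 -mulrnA mulnC lee_fin cardT -cardE.
Qed.

Lemma counts_le_locally_finite N mu : counts_le N mu -> locally_finite mu.
Proof.
move=> muN K cK sK; have [k Kk] := compact_upper_set cK sK.
apply: (@le_lt_trans _ _ (mu (upper_set k))); last first.
  by rewrite (le_lt_trans (counts_le_upper k muN))// ltry.
apply: le_measure => //; rewrite inE; last exact: measurable_upper_set.
exact: measurable_compact.
Qed.

Lemma integrable_finite_indic mu (A D : set T) : measurable A -> measurable D ->
  (mu A < +oo)%E -> mu.-integrable D (EFin \o \1_A).
Proof.
move=> mA mD muA; apply/integrableP; split.
  by apply/measurable_EFinP; apply/measurable_funTS; exact: measurable_indic.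
rewrite (eq_integral (fun x => (\1_A x)%:E)); last first.
  by move=> t _; rewrite /= ger0_norm.
rewrite integral_indic//; apply: le_lt_trans muA.
by apply: le_measure => //; rewrite inE//; exact: measurableI.
Qed.

Lemma integral_step N mu f n k eps : counts_le N mu -> 0 < eps -> test_function f ->
  (forall z, state_space z -> `|f z - step n f z| <= eps * \1_(upper_set k) z) ->
  `|\int[mu]_(z in state_space) f z -
    \sum_(j : dyadic_index n) fine (mu (dyadic_cell j)) * f (representative j)|
  <= eps * (upper_bound N k)%:R.
Proof.
move=> muN eps0 tf fs; have mD := @measurable_state_space R.
have cfin (j : dyadic_index n) : (mu (dyadic_cell j) < +oo)%E.
  by have [m _ ->] := muN n j; rewrite ltry.
have ufin : (mu (upper_set k) < +oo)%E.
  by rewrite (le_lt_trans (counts_le_upper k muN))// ltry.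
pose t (j : dyadic_index n) (z : T) : R := f (representative j) * \1_(dyadic_cell j) z.
have int_term (j : dyadic_index n) : mu.-integrable state_space (EFin \o t j).
  rewrite (_ : _ \o _ = (fun z => (f (representative j))%:E * (\1_(dyadic_cell j) z)%:E)%E).
    apply: integrableZl => //; apply: integrable_finite_indic => //.
    exact: measurable_dyadic_cell.
  by apply/funext => z /=; rewrite EFinM.
have int_step : mu.-integrable state_space (EFin \o step n f).
  rewrite (_ : _ \o _ = (fun z => \sum_(j : dyadic_index n) (EFin \o t j) z)%E).
    exact: integrable_sum.
  by apply/funext => z; rewrite /= /step -sumEFin.
have int_ub : mu.-integrable state_space (EFin \o (fun z => eps * \1_(upper_set k) z)).
  rewrite (_ : _ \o _ = (fun z => eps%:E * (\1_(upper_set k) z)%:E)%E).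
    apply: integrableZl => //; apply: integrable_finite_indic => //.
    exact: measurable_upper_set.
  by apply/funext => z /=; rewrite EFinM.
pose h z := f z - step n f z.
have mh : measurable_fun state_space h.
  by apply: measurable_funB; [exact: measurable_test_function|exact: measurable_step].
have int_h : mu.-integrable state_space (EFin \o h).
  apply: le_integrable int_ub => //; first exact/measurable_EFinP.
  move=> z sz /=; rewrite lee_fin [X in _ <= X]ger0_norm ?fs//.
  by rewrite mulr_ge0 ?(ltW eps0)// indicE.
have -> : \int[mu]_(z in state_space) f z =
    \int[mu]_(z in state_space) step n f z + \int[mu]_(z in state_space) h z.
  rewrite -RintegralD//; apply: eq_Rintegral => z _.
  by rewrite /h addrC subrK.
have -> : \int[mu]_(z in state_space) step n f z =
    \sum_(j : dyadic_index n) fine (mu (dyadic_cell j)) * f (representative j).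
  rewrite /Rintegral /step.
  under eq_integral do rewrite -sumEFin.
  rewrite integral_sum// -sum_fine => [|j _]; last exact: (integrable_fin_num _ (int_term j)).
  apply: eq_bigr => j _; under eq_integral do rewrite EFinM.
  rewrite integralZl//; last first.
    by apply: integrable_finite_indic => //; exact: measurable_dyadic_cell.
  rewrite integral_indic//; last exact: measurable_dyadic_cell.
  rewrite setIidl; last by move=> z /dyadic_cell_upper/upper_set_state.
  have [m _ ->] := muN n j; by rewrite mulrC.
rewrite addrAC subrr add0r (le_trans (le_normr_Rintegral _ _))//.
apply: (@le_trans _ _ (\int[mu]_(z in state_space) (eps * \1_(upper_set k) z))).
  apply: le_Rintegral => //; first exact: integrable_norm.
rewrite RintegralZl//; last first.
  by apply: integrable_finite_indic => //; exact: measurable_upper_set.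
rewrite ler_wpM2l ?(ltW eps0)// /Rintegral integral_indic//; last exact: measurable_upper_set.
rewrite setIidl; last exact: upper_set_state.
rewrite -lee_fin fineK ?counts_le_upper//.
by rewrite ge0_fin_numE.
Qed.

End dyadic_approximation.

(** * Atoms listed by decreasing height *)

Section limit_measure.
Context {R : realType}.
Local Notation T := (R * \bar R)%type.
Variable N : nat -> nat.
Implicit Types (f : T -> R) (mu : {measure set T -> \bar R}).
Local Notation B k := (upper_bound N k.+1).

Definition cell_count mu n (j : dyadic_index n) : nat :=
  Num.truncn (fine (mu (dyadic_cell j))).

Lemma cell_countE mu n (j : dyadic_index n) : counts_le N mu ->
  mu (dyadic_cell j) = (cell_count mu j)%:R%:E.
Proof. by move=> muN; rewrite /cell_count; have [m _ ->] := muN n j; rewrite /= natrK. Qed.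

Section corners.
Variables (n : nat) (m : dyadic_index n -> nat).

(* The highest corners come first, so that for fixed [i] the [i]-th corner is in
   a fixed compact set or irrelevant to a given test function. *)
Definition corners : seq (R * R) :=
  sort (fun z z' => z'.2 <= z.2)
    (flatten [seq nseq (m j) (corner j) | j <- enum (dyadic_index n)]).

(** The default height -1 stands for -oo, where extended test functions vanish, so that padding
    contributes nothing. *)
Definition corner_at i : R * R := nth (0, -1) corners i.

Lemma big_corners (g : R * R -> R) :
  \sum_(z <- corners) g z = \sum_(j : dyadic_index n) (m j)%:R * g (corner j).
Proof.
rewrite /corners (perm_big _ (introT permPl (perm_sort _ _)))/= big_flatten big_map.
rewrite big_enum/=; apply: eq_bigr => j _.
by rewrite big_nseq iter_addr addr0 mulr_natl.
Qed.

Lemma count_corners (Q : pred (R * R)) :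
  count Q corners = (\sum_(j | Q (corner j)) m j)%N.
Proof.
rewrite /corners count_sort count_flatten sumnE 2!big_map big_enum/= [RHS]big_mkcond.
by apply: eq_bigr => j _; rewrite count_nseq; case: (Q _); rewrite ?mul1n ?mul0n.
Qed.

Lemma corner_at_bounds i : 0 <= (corner_at i).1 <= 1 /\ -1 <= (corner_at i).2 <= 1.
Proof.
rewrite /corner_at; have [ni|ni] := ltnP i (size corners); last first.
  by rewrite nth_default//= !lexx ler01 ge0_cp.
have : nth (0, -1) corners i \in corners by exact: mem_nth.
rewrite mem_sort => /flattenP[l /mapP[j _ ->]] /nseqP[-> _].
by have [? /andP[/ltW -> ->]] := corner_bounds (R := R) j.
Qed.

Lemma corner_at_low (t : R) b i : -1 <= t -> (count (fun z => (t < z.2)%R) corners <= b)%N ->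
  (b <= i)%N -> (corner_at i).2 <= t.
Proof.
move=> t1 cb bi; rewrite /corner_at; have [ni|ni] := ltnP i (size corners); last first.
  by rewrite nth_default.
rewrite leNgt; apply/negP => ti.
have srt : sorted (fun z z' : R * R => z'.2 <= z.2) corners.
  by apply: sort_sorted => z z'; exact: le_total.
have : (i.+1 <= count (fun z => (t < z.2)%R) corners)%N.
  rewrite -(cat_take_drop i.+1 corners) count_cat (leq_trans _ (leq_addr _ _))//.
  have -> : count (fun z => (t < z.2)%R) (take i.+1 corners) = i.+1.
    rewrite -[RHS](size_takel ni); apply/eqP; rewrite -all_count.
    apply/(all_nthP (0, -1)) => k; rewrite size_takel// ltnS => ki.
    rewrite nth_take// (lt_le_trans ti)//.
    apply: (sorted_leq_nth _ _ (0, -1) srt) => //.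
    - by move=> z z1 z2 h1 h2; exact: le_trans h2 h1.
    - by rewrite inE (leq_ltn_trans ki).
  by [].
by rewrite leqNgt ltnS (leq_trans cb bi).
Qed.

End corners.

(** A corner above -1 + 2 ^ (- k) belongs to a cell inside the upper set of level k.+1, whose mass
    bounds the number of such corners independently of n. *)
Lemma corner_at_upper mu n k i : counts_le N mu -> (k < n)%N -> (B k <= i)%N ->
  (corner_at (cell_count mu (n := n)) i).2 <= -1 + (2 ^ k)%:R^-1.
Proof.
move=> muN kn; apply: corner_at_low; first by rewrite lerDl invr_ge0.
rewrite count_corners -(ler_nat R) -lee_fin.
apply: le_trans (counts_le_upper k.+1 muN).
rewrite natr_sum -sumEFin (eq_bigr (fun j => mu (dyadic_cell j))); last first.
  by move=> j _; rewrite cell_countE.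
rewrite -measure_dyadic_cells; apply: le_measure; rewrite ?inE.
- apply: fin_bigcup_measurable => [|j _]; first exact: finite_finset.
  exact: measurable_dyadic_cell.
- exact: measurable_upper_set.
move=> z [j /= kj jz]; have [z1 _] := dyadic_cell_upper jz; split=> //.
have /dyadic_cellP[_ /andP[y1 _]] := jz; apply: le_lt_trans y1.
have n2 : (2 ^ n)%:R^-1 <= (2 ^ k.+1)%:R^-1 :> R.
  by rewrite lef_pV2 ?posrE ?ltr0n ?expn_gt0// ler_nat leq_pexp2l.
have k2 : (2 ^ k)%:R^-1 = 2 * (2 ^ k.+1)%:R^-1 :> R.
  by rewrite expnS natrM invfM mulrA divff ?mul1r.
move: kj n2; rewrite unfold_in k2 -[j.2.+2%:R]natr1 (mulrDl _ 1) mul1r; clear; lra.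
Qed.

(** The number of terms on the right depends on k only, so that a limit in n can be taken term by
    term. *)
Lemma sum_representatives mu n k f : counts_le N mu -> (k < n)%N ->
  (forall z, state_space z -> ~ upper_set k z -> f z = 0) ->
  \sum_(j : dyadic_index n) fine (mu (dyadic_cell j)) * f (representative j) =
  \sum_(i < B k) contracted f (corner_at (cell_count mu (n := n)) i).1
                              (corner_at (cell_count mu (n := n)) i).2.
Proof.
move=> muN kn fk; set m := cell_count mu (n := n).
transitivity (\sum_(z <- corners m) contracted f z.1 z.2).
  rewrite big_corners; apply: eq_bigr => j _; rewrite (cell_countE _ muN); congr (_ * _).
  rewrite -contract_representative -[(corner j).1]/(representative j).1 contractedE//.
  exact: (upper_set_state (dyadic_cell_upper (representative_in j))).
rewrite (big_nth (0, -1)) -(big_mkord xpredT (fun i => contracted f (corner_at m i).1 (corner_at m i).2)).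
have low i : (B k <= i)%N -> contracted f (corner_at m i).1 (corner_at m i).2 = 0.
  move=> ki; apply: (contracted_low fk); first by have [] := corner_at_bounds m i.
  exact: corner_at_upper.
have trunc a b : (a <= b)%N ->
    (forall i, (a <= i)%N -> contracted f (corner_at m i).1 (corner_at m i).2 = 0) ->
    \sum_(0 <= i < b) contracted f (corner_at m i).1 (corner_at m i).2 =
    \sum_(0 <= i < a) contracted f (corner_at m i).1 (corner_at m i).2.
  move=> ab F0; rewrite (@big_cat_nat _ _ _ a)//= -[RHS]addr0; congr (_ + _).
  by rewrite big_nat_cond big1// => i; rewrite andbT => /andP[ai _]; exact: F0.
have [le|/ltnW le] := leqP (size (corners m)) (B k); last exact: trunc low.
apply/esym/trunc => // i si.
by rewrite /corner_at nth_default//= /contracted ltxx.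
Qed.

End limit_measure.

Lemma Rintegral_msum_dirac {R : realType} d (T : measurableType d) (D : set T)
    (f : T -> R) (a : nat -> T) n : measurable D -> measurable_fun D f ->
  \int[msum (fun i => dirac (a i) : {measure set T -> \bar R}) n]_(z in D) f z =
  \sum_(i < n) \1_D (a i) * f (a i).
Proof.
move=> mD mf; have mef : measurable_fun D (EFin \o f) by exact/measurable_EFinP.
have part (g : T -> \bar R) (h : T -> R) : (forall z, g z = (h z)%:E) ->
    (forall z, 0 <= h z) -> measurable_fun D g ->
    (\int[msum (fun i => dirac (a i) : {measure set T -> \bar R}) n]_(z in D) g z =
    (\sum_(i < n) \1_D (a i) * h (a i))%:E)%E.
  move=> gh h0 mg; rewrite ge0_integral_measure_sum//; last by move=> z _; rewrite gh lee_fin.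
  rewrite -sumEFin; apply: eq_bigr => i _.
  by rewrite integral_dirac// gh diracE indicE -EFinM.
rewrite /Rintegral integralE.
have fn z : ((EFin \o f)^\- z = (Num.max (- f z) 0)%:E)%E.
  by rewrite funenegE EFin_max.
have fp z : ((EFin \o f)^\+ z = (Num.max (f z) 0)%:E)%E.
  by rewrite funeposE EFin_max.
rewrite (part _ _ fp)//; last 2 first.
- by move=> z; rewrite le_max lexx orbT.
- exact: measurable_funepos.
rewrite (part _ _ fn)//; last 2 first.
- by move=> z; rewrite le_max lexx orbT.
- exact: measurable_funeneg.
rewrite -EFinB /= -sumrB; apply: eq_bigr => i _; rewrite -mulrBr; congr (_ * _).
have /orP[h|h] := le_total 0 (f (a i)).
  have h' : - f (a i) <= 0 by rewrite oppr_le0.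
  by rewrite (max_l h) (max_r h') subr0.
have h' : 0 <= - f (a i) by rewrite oppr_ge0.
by rewrite (max_r h) (max_l h') sub0r opprK.
Qed.

(** * The measure of the limiting atoms *)

Section limit_measure.
Context {R : realType}.
Local Notation T := (R * \bar R)%type.
Variables (x c : nat -> R).
Hypotheses (x01 : forall i, 0 <= x i <= 1) (c1 : forall i, -1 <= c i <= 1).
Variable b : nat -> nat.
Hypothesis cb : forall k i, (b k <= i)%N -> c i <= -1 + (2 ^ k)%:R^-1.

Let point i : T := (x i, expand (c i)).

(** Atoms with c i = -1 sit at height -oo, outside the state space. By [cb] only the first b k atoms
    can meet the upper set of level k. *)
Definition limit_measure : {measure set T -> \bar R} :=
  mseries (fun i => dirac (x i, expand (c i)) : {measure set T -> \bar R}) 0.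

Let contract_point i : contract (point i).2 = c i.
Proof. by rewrite expandK// inE ler_norml. Qed.

Let limit_measure_upper k (A : set T) : A `<=` upper_set k ->
  limit_measure A = msum (fun i => dirac (point i) : {measure set T -> \bar R}) (b k) A.
Proof.
move=> Ak.
have -> : limit_measure A = (\sum_(0 <= i <oo) (\d_(point i) A : \bar R))%E by [].
rewrite (@nneseries_split _ _ 0 (b k))// add0n eseries0 ?adde0.
  by rewrite big_mkord.
move=> i ki _; rewrite diracE memNset// => /Ak[_].
by apply/negP; rewrite -leNgt contract_point; exact: cb.
Qed.

Lemma limit_measure_locally_finite : locally_finite limit_measure.
Proof.
move=> K cK sK; have [k Kk] := compact_upper_set cK sK.
rewrite (limit_measure_upper Kk).
rewrite -[X in (X < _)%E]/(\sum_(i < b k) (\d_(point i) K : \bar R))%E.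
by apply: lte_sum_pinfty => i _; rewrite diracE ltry.
Qed.

Lemma integral_limit_measure (f : T -> R) k : test_function f ->
  (forall z, state_space z -> ~ upper_set k z -> f z = 0) ->
  \int[limit_measure]_(z in state_space) f z = \sum_(i < b k) contracted f (x i) (c i).
Proof.
move=> tf fk; have mU := @measurable_upper_set R k.
have sU : (upper_set k : set T) `<=` state_space by exact: upper_set_state.
transitivity (\int[limit_measure]_(z in upper_set k) f z).
  rewrite -[in RHS](setIidr sU) [RHS]Rintegral_mkcondr; apply: eq_Rintegral => z.
  rewrite inE patchE => sz; case: ifPn => //; rewrite notin_setE => nz.
  exact: fk.
rewrite {1}/Rintegral (eq_measure_integral
  (msum (fun i => dirac (point i) : {measure set T -> \bar R}) (b k))); last first.
  by move=> A _; exact: limit_measure_upper.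
rewrite -[LHS]/(Rintegral _ _ _) Rintegral_msum_dirac//; last first.
  by apply: measurable_funS (measurable_test_function tf) => //; exact: measurable_state_space.
apply: eq_bigr => i _; rewrite indicE.
have [ui|ui] := pselect (upper_set k (point i)).
  rewrite mem_set// mul1r -[in LHS]contractedE; last exact: sU.
  by rewrite contract_point.
rewrite memNset// mul0r; apply/esym/(contracted_low fk) => //.
rewrite leNgt; apply/negP => h; apply: ui; split; first exact: x01.
by rewrite contract_point.
Qed.

End limit_measure.

(** Otherwise each level n has a pair of measures with equal counts on which F differs by more than
    eps. Step functions of level n do not distinguish the two, so integrals of test functions have
    the same limit along both sequences, the integral against the measure of limiting atoms, and F
    would be discontinuous there. *)
Lemma vaguely_continuous_counts {R : realType}
    (F : {measure set (R * \bar R) -> \bar R} -> R) (N : nat -> nat) (eps : R) :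
  vaguely_continuous F -> 0 < eps ->
  exists n, forall mu nu, counts_le N mu -> counts_le N nu ->
    (forall j : dyadic_index n, mu (dyadic_cell j) = nu (dyadic_cell j)) ->
    `|F mu - F nu| <= eps.
Proof.
move=> cF eps0; apply: contrapT => /forallNP nF.
pose measureT := {measure set (R * \bar R) -> \bar R}.
have [s sP] : {s : nat -> measureT * measureT & forall n, [/\ counts_le N (s n).1,
    counts_le N (s n).2, forall j : dyadic_index n, (s n).1 (dyadic_cell j) = (s n).2 (dyadic_cell j) &
    eps < `|F (s n).1 - F (s n).2| ]}.
  apply: (@choice _ _ (fun n (s : measureT * measureT) => [/\ counts_le N s.1,
    counts_le N s.2, forall j : dyadic_index n, s.1 (dyadic_cell j) = s.2 (dyadic_cell j) &
    eps < `|F s.1 - F s.2| ])) => n.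
  have /existsNP[mu /existsNP[nu /not_implyP[h1 /not_implyP[h2 /not_implyP[h3 h4]]]]] := nF n.
  by exists (mu, nu); split=> //; rewrite ltNge; apply/negP.
have [U [UU sU]] := @ultraFilterLemma nat \oo _.
have UP : ProperFilter U by exact: ultra_proper.
pose at_ n i := corner_at (R := R) (cell_count (s n).1 (n := n)) i.
pose lim1 i (l : R) := 0 <= l <= 1 /\ (at_ n i).1 @[n --> U] --> l.
have [x xP] : {x : nat -> R & forall i, lim1 i (x i)}.
  apply: (@choice _ _ lim1) => i.
  have [n|l] := ultra_cvg_itv UU (a := 0) (b := 1) (s := fun n => (at_ n i).1).
    by have [] := @corner_at_bounds R _ (cell_count (s n).1 (n := n)) i.
  by exists l.
pose lim2 i (l : R) := -1 <= l <= 1 /\ (at_ n i).2 @[n --> U] --> l.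
have [c cP] : {c : nat -> R & forall i, lim2 i (c i)}.
  apply: (@choice _ _ lim2) => i.
  have [n|l] := ultra_cvg_itv UU (a := -1) (b := 1) (s := fun n => (at_ n i).2).
    by have [] := @corner_at_bounds R _ (cell_count (s n).1 (n := n)) i.
  by exists l.
pose b k := upper_bound N k.+1.
have nearU k : \forall n \near U, (k < n)%N by apply: sU; exact: nbhs_infty_gt.
have cb k i : (b k <= i)%N -> c i <= -1 + (2 ^ k)%:R^-1.
  move=> ki; apply: (cvgr_to_le (cP i).2); apply: filterS (nearU k) => n kn.
  by have [h _ _ _] := sP n; exact: (corner_at_upper h kn ki).
have x01 i : 0 <= x i <= 1 by have [] := xP i.
have c1 i : -1 <= c i <= 1 by have [] := cP i.
have lfM := limit_measure_locally_finite x c1 cb.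
set M := limit_measure x c in lfM.
have ltr02 : 0 < 2 :> R by [].
have [n [f [eta [tf eta0 FM]]]] := cF M lfM (eps / 2) (divr_gt0 eps0 ltr02).
have cvg_int g : test_function g -> \forall n \near U, forall mu : measureT,
    counts_le N mu -> (forall j : dyadic_index n, (s n).1 (dyadic_cell j) = mu (dyadic_cell j)) ->
    `|\int[mu]_(p in state_space) g p - \int[M]_(p in state_space) g p| < eta.
  move=> tg.
  have [k gk] := test_function_support tg.
  (* Half of eta pays for the step approximation, whose error is this number times at most b k, and
     the other half for the limit of the finite sum. *)
  have e0 : 0 < eta / (2 * (b k).+1%:R) by rewrite divr_gt0// mulr_gt0.
  have [n0 gstep] := step_close tg e0 gk.
  have nn0 : \forall n \near U, (n0 <= n)%N by apply: sU; exact: nbhs_infty_ge.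
  have lim_sum : \sum_(i < b k) contracted g (at_ n i).1 (at_ n i).2 @[n --> U] -->
      \sum_(i < b k) contracted g (x i) (c i).
    apply: cvg_big; first exact: add_continuous.
    move=> i _; apply: cvg_contracted => //; [| |exact: (xP i).2|exact: (cP i).2].
      by move=> m; have [] := @corner_at_bounds R _ (cell_count (s m).1 (n := m)) i.
    by move=> m; have [_ /andP[]] := @corner_at_bounds R _ (cell_count (s m).1 (n := m)) i.
  move/cvgrPdist_lt: lim_sum => /(_ _ (divr_gt0 eta0 ltr02)).
  apply: filterS3 nn0 (nearU k) => m mn0 km lim_m mu muN smu.
  have [s1 _ _ _] := sP m.
  rewrite (integral_limit_measure x01 c1 cb tg gk).
  have := integral_step muN e0 tg (gstep m mn0).
  have -> : \sum_(j : dyadic_index m) fine (mu (dyadic_cell j)) * g (representative j) =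
      \sum_(i < b k) contracted g (at_ m i).1 (at_ m i).2.
    by rewrite -(sum_representatives s1 km gk); apply: eq_bigr => j _; rewrite smu.
  move=> h; apply: le_lt_trans (ler_distD (\sum_(i < b k) contracted g (at_ m i).1 (at_ m i).2) _ _) _.
  rewrite [ltRHS]splitr ler_ltD//; last by rewrite distrC.
  apply: le_trans h _; rewrite invfM !mulrA -[leLHS]mulrA.
rewrite ler_piMr ?divr_ge0 ?(ltW eta0)//.
  by rewrite mulrC ler_pdivrMr// mul1r ler_nat.
have /filter_ex[m mP] := filter_forall (@filter_filter _ _ UP) (fun i => cvg_int (f i) (tf i)).
have [s1 s2 s12] := sP m; rewrite ltNge => /negP; apply.
have lf mu : counts_le N mu -> locally_finite mu by exact: counts_le_locally_finite.
have F1 : `|F (s m).1 - F M| < eps / 2 by apply: FM; [exact: lf|move=> i; exact: mP].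
have F2 : `|F (s m).2 - F M| < eps / 2 by apply: FM; [exact: lf|move=> i; exact: mP].
apply: le_trans (ler_distD (F M) _ _) _; rewrite distrC in F2.
by rewrite [leRHS]splitr lerD// ltW.
Qed.

(** * Convergence in distribution *)

(* The library's integral is defined for all functions, as the difference of the
   suprema of the integrals of simple functions below the positive and negative
   parts; it is monotone without measurability. *)
Lemma le_integral_pointwise d (T : measurableType d) (R : realType)
    (mu : {measure set T -> \bar R}) (f g : T -> \bar R) :
  (forall w, f w <= g w)%E -> (\int[mu]_w f w <= \int[mu]_w g w)%E.
Proof.
have mono (f1 f2 : T -> \bar R) : (forall w, 0 <= f1 w)%E -> (forall w, f1 w <= f2 w)%E ->
    (\int[mu]_w f1 w <= \int[mu]_w f2 w)%E.
  move=> f10 f12; have f20 w : (0 <= f2 w)%E by exact: le_trans (f10 w) (f12 w).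
  rewrite !ge0_integralTE//; apply: ge_ereal_sup => _ [h /= hf <-].
  by apply: ereal_sup_ubound; exists h => // w; exact: le_trans (hf w) (f12 w).
move=> fg; rewrite integralE [leRHS]integralE; apply: leeB; apply: mono => w.
- exact: funepos_ge0.
- by rewrite !funeposE ge_max !le_max fg lexx orbT.
- exact: funeneg_ge0.
- by rewrite !funenegE ge_max !le_max leeN2 fg lexx orbT.
Qed.

Section expectation_sandwich.
Context d (Om : measurableType d) {R : realType} (P : probability Om R).

(** No measurability is asked of f, which will be a functional of a random measure. Its integral
    lies between those of g - h and g + h, with h equal to eps plus 2 C on the exceptional event. *)
Lemma expectation_sandwich (f g : Om -> R) (C eps delta : R) (A : set Om) :
  0 <= C -> 0 <= eps -> bmeas g -> (forall w, `|f w| <= C) -> (forall w, `|g w| <= C) ->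
  measurable A -> pr P A <= delta -> (forall w, ~ A w -> `|f w - g w| <= eps) ->
  exists2 r : R, ('E_P[f] = r%:E)%E & `|r - Ex P g| <= eps + 2 * C * delta.
Proof.
move=> C0 eps0 bg fC gC mA PA fg.
pose h w : R := eps + 2 * C * \1_A w.
have bh : bmeas h.
  by apply: bmeasD; [exact: bmeas_cst|apply: bmeasZ; exact: bmeas_indic].
have fgh w : `|f w - g w| <= h w.
  rewrite /h indicE; have [Aw|nAw] := pselect (A w); last first.
    by rewrite memNset// mulr0 addr0; exact: fg.
  rewrite mem_set// mulr1 (le_trans (ler_normB _ _))// mulr_natl mulr2n.
  by rewrite (le_trans (lerD (fC w) (gC w)))// lerDr.
have EE k : bmeas k -> (\int[P]_w (k w)%:E = (Ex P k)%:E)%E.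
  by move=> bk; rewrite /Ex /Rintegral fineK// (integrable_fin_num _ (bmeas_integrable P bk)).
have Eh : Ex P h <= eps + 2 * C * delta.
  rewrite ExD ?ExZ ?Ex_cst ?Ex_indic//; [|exact: bmeas_indic|exact: bmeas_cst|].
    by rewrite lerD2l ler_wpM2l// mulr_ge0.
  by apply: bmeasZ; exact: bmeas_indic.
have up : (\int[P]_w (f w)%:E <= (Ex P g + Ex P h)%:E)%E.
  rewrite -ExD// -EE; last exact: bmeasD.
  apply: le_integral_pointwise => w; rewrite lee_fin -lerBlDl.
  exact: le_trans (ler_norm _) (fgh w).
have lo : ((Ex P g - Ex P h)%:E <= \int[P]_w (f w)%:E)%E.
  rewrite -ExB// -EE; last exact: bmeasB.
  apply: le_integral_pointwise => w; rewrite lee_fin lerBlDl -lerBlDr.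
  by apply: le_trans (fgh w); rewrite distrC; exact: ler_norm.
have fin : (\int[P]_w (f w)%:E)%E \is a fin_num.
  by rewrite fin_numE; apply/andP; split; apply/eqP => e; move: up lo; rewrite e.
exists (fine (\int[P]_w (f w)%:E)%E); first by rewrite unlock fineK.
rewrite ler_distl; move: up lo; rewrite -(fineK fin) !lee_fin => up lo.
by apply/andP; split; lra.
Qed.

End expectation_sandwich.

Section small_events.
Context d (Om : measurableType d) {R : realType} (P : probability Om R).

Lemma pr_nonincreasing_tail (A : nat -> set Om) (eps : R) : (forall k, measurable (A k)) ->
  (forall k l, (k <= l)%N -> A l `<=` A k) -> (forall w, exists k, ~ A k w) -> 0 < eps ->
  exists k, pr P (A k) <= eps.
Proof.
move=> mA niA A0 eps0.
have cap0 : \bigcap_k A k = set0.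
  by apply/seteqP; split=> // w Aw; have [k] := A0 w; apply; exact: Aw.
have : (P \o A) k @[k --> \oo] --> P (\bigcap_k A k).
  apply: nonincreasing_cvg_mu => //; first by rewrite (le_lt_trans (probability_le1 _ (mA 0)))// ltry.
    exact: bigcapT_measurable.
  by move=> k l kl; apply/subsetPset; exact: niA.
rewrite cap0 measure0 => /fine_cvgP[_] /cvgrPdist_le /(_ _ eps0) [k _ /(_ k (leqnn k))].
by rewrite sub0r normrN ger0_norm /=; [exists k|exact: fine_ge0].
Qed.

Lemma pr_bigcup_half (A : nat -> set Om) (eps : R) : 0 <= eps ->
  (forall k, measurable (A k)) -> (forall k, pr P (A k) <= eps / (2 ^ k.+1)%:R) ->
  measurable (\bigcup_k A k) /\ pr P (\bigcup_k A k) <= eps.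
Proof.
move=> eps0 mA PA; have mU : measurable (\bigcup_k A k) by exact: bigcupT_measurable.
split=> //; rewrite -lee_fin -prE//.
apply: (le_trans (measure_sigma_subadditive _ mA mU (@subset_refl _ _))) => /=.
have lim : (\sum_(0 <= k <oo) (eps / (2 ^ (k + 1))%:R)%:E)%E = (eps / 2 ^+ 0)%:E.
  by apply/cvg_lim => //; exact: cvg_geometric_eseries_half.
rewrite expr0 divr1 in lim; rewrite -lim.
by apply: lee_nneseries => // k _; rewrite (prE P)// lee_fin addn1; exact: PA.
Qed.

End small_events.

Lemma poisson_mass_sum {R : realType} (lam : R) :
  \sum_(k < K) poisson_mass lam k @[K --> \oo] --> (1 : R).
Proof.
have -> : (fun K => \sum_(k < K) poisson_mass lam k) =
    (fun K => expR (- lam) * series (exp_coeff lam) K).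
  apply/funext => K; rewrite /series /= big_mkord mulr_sumr; apply: eq_bigr => k _.
  by rewrite /poisson_mass /exp_coeff /= mulrA.
have e1 : expR (- lam) * expR lam = 1 by rewrite -expRD addNr expR0.
rewrite -[X in _ --> X]e1; apply: cvgM; first exact: cvg_cst.
exact: is_cvg_series_exp_coeff.
Qed.

(** Each Poisson law has total mass 1, and distributing the product of partial sums gives the sum
    over tables with entries at most K. *)
Lemma poisson_mass_product {R : realType} (J : finType) (lam : J -> R) (eps : R) : 0 < eps ->
  exists K : nat, 1 - eps <= \sum_(m : {ffun J -> 'I_K.+1}) \prod_j poisson_mass (lam j) (m j).
Proof.
move=> eps0.
have : \prod_j \sum_(k < K) poisson_mass (lam j) k @[K --> \oo] --> \prod_(j : J) (1 : R).
  apply: cvg_big; first exact: mul_continuous.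
  by move=> j _; exact: poisson_mass_sum.
rewrite big1// => /cvgrPdist_le/(_ _ eps0)[K _ /(_ K.+1 (leqnSn K))] /=.
rewrite ler_distlC => /andP[h _]; exists K; apply: le_trans h _.
by rewrite bigA_distr_bigA.
Qed.

Lemma pr_disjoint_sum d (Om : measurableType d) {R : realType} (P : probability Om R)
    (I : finType) (A : I -> set Om) : (forall i, measurable (A i)) ->
  (forall i j w, A i w -> A j w -> i = j) ->
  measurable (\bigcup_(i in [set: I]) A i) /\
  pr P (\bigcup_(i in [set: I]) A i) = \sum_i pr P (A i).
Proof.
move=> mA dA.
have mU : measurable (\bigcup_(i in [set: I]) A i).
  by apply: fin_bigcup_measurable => //; exact: finite_finset.
split=> //; rewrite -Ex_indic//.
have -> : \1_(\bigcup_(i in [set: I]) A i) = (fun w => \sum_i \1_(A i) w : R).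
  apply/funext => w; rewrite indicE; have [[i _ Aw]|nA] := pselect ((\bigcup_(i in [set: I]) A i) w).
    rewrite mem_set; last by exists i.
    rewrite (bigD1 i)//= indicE mem_set// big1 ?addr0// => j ji.
    by rewrite indicE memNset// => Aj; move: ji; rewrite (dA _ _ _ Aw Aj) eqxx.
  rewrite memNset// big1// => j _; rewrite indicE memNset// => Aj; apply: nA.
  by exists j.
rewrite Ex_sum; first by apply: eq_bigr => i _; exact: Ex_indic.
by move=> i _; exact: bmeas_indic.
Qed.

Section count_indicators.
Context d (Om : measurableType d) {R : realType} (J : finType).
Variables (V : J -> Om -> nat) (m : J -> nat).

Lemma indic_counts : \1_[set w | forall j, V j w = m j] =
  (fun w => \prod_j (V j w == m j)%:R : R).
Proof.
apply/funext => w; rewrite indicE; have [h|h] := pselect (forall j, V j w = m j).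
  by rewrite mem_set// big1// => j _; rewrite h eqxx.
rewrite memNset//; have /existsNP[j /eqP/negbTE jm] := h.
by rewrite (bigD1 j)//= jm mul0r.
Qed.

Lemma measurable_counts : (forall j, mcount (V j)) -> measurable [set w | forall j, V j w = m j].
Proof.
move=> mV; have -> : [set w | forall j, V j w = m j] =
    \bigcap_(j in [set: J]) [set w | V j w = m j].
  by apply/seteqP; split=> w h => [j _|j]; [exact: h|exact: (h j)].
by apply: fin_bigcap_measurable => [|j _]; [exact: finite_finset|exact: mV].
Qed.

End count_indicators.

(** * Joint laws of the dyadic counts *)

Section dyadic_laws.
Context {R : realType}.

Definition dyadic_rate n (j : dyadic_index n) : R :=
  fine (intensity (dyadic_cell (R := R) j)).

Lemma dyadic_rateE n (j : dyadic_index n) : dyadic_rate j =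
  (level_rate (dyadic_levels n) (dyadic_height n) j.2 -
   level_rate (dyadic_levels n) (dyadic_height n) j.2.+1) / (2 ^ n)%:R /\
  intensity (dyadic_cell j) = (dyadic_rate j)%:E.
Proof.
rewrite /dyadic_rate /dyadic_cell intensity_cell//; last by rewrite expn_gt0.
by move=> b c; exact: dyadic_height_nd.
Qed.

Let rate_ge0 n (j : dyadic_index n) : 0 <= dyadic_rate j.
Proof.
have [-> _] := dyadic_rateE j; rewrite divr_ge0// subr_ge0.
have [jq|jq] := ltnP j.2.+1 (dyadic_levels n).
  by apply: level_rate_ni; [exact: dyadic_height_nd|rewrite leqnSn].
by rewrite [X in X <= _]/level_rate ltnNge jq /= ltW// level_rate_gt0.
Qed.

Section gaps.
Context {d : measure_display} {Omega : measurableType d}.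
Variables (P : probability Omega R) (Z : Omega -> set R).
Hypotheses (hZ : point_process Z) (hstat : stationary P Z).
Hypotheses (h1 : gap_decay P Z) (h2 : regularity P Z) (h3 : splitting P Z)
  (h5 : absence_of_clustering P Z).

Definition dyadic_count n L (j : dyadic_index n) (w : Omega) : nat :=
  vcount P Z (dyadic_levels n) (dyadic_height n) (2 ^ n) L j.1 j.2 w.

Arguments dyadic_count : simpl never.

Lemma mcount_dyadic n L (j : dyadic_index n) : mcount (dyadic_count L j).
Proof.
move=> k; have [mf _] := bmeas_gcount P hZ (dyadic_levels n) (dyadic_height n) (2 ^ n) L
  (fine_mesh 2^-1 L) j.1 j.2.
have := mf measurableT [set k%:R] (measurable_set1 _); rewrite setTI.
rewrite (_ : _ @^-1` _ = [set w | dyadic_count L j w = k])//.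
apply/seteqP; split=> w /=; first by move/eqP; rewrite eqr_nat => /eqP.
by move=> <-.
Qed.

Definition count_event n L (m : dyadic_index n -> nat) : set Omega :=
  [set w | forall j, dyadic_count L j w = m j].

Lemma measurable_count_event n L (m : dyadic_index n -> nat) : measurable (count_event L m).
Proof. by apply: measurable_counts => j; exact: mcount_dyadic. Qed.

Lemma count_event_law n (m : dyadic_index n -> nat) :
  pr P (count_event L m) @[L --> +oo] --> \prod_j poisson_mass (dyadic_rate j) (m j).
Proof.
have -> : (fun L => pr P (count_event L m)) =
    (fun L => Ex P (fun w => \prod_j (dyadic_count L j w == m j)%:R)).
  by apply/funext => L; rewrite -indic_counts Ex_indic//; exact: measurable_count_event.
apply: (joint_law_of_generating_function (J := dyadic_index n) _ (V := fun L j => dyadic_count L j)).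
- by move=> L j; exact: mcount_dyadic.
- by move=> j; exact: rate_ge0.
move=> z z01.
(* The weights must be indexed by all pairs of integers; outside the table the value 0 gives the
   factor 1. *)
pose sigma a b : R := if insub a is Some a' then
  if insub b is Some b' then 1 - z (a', b') else 0 else 0.
have sE (j : dyadic_index n) : sigma j.1 j.2 = 1 - z j.
  by case: j => a b; rewrite /sigma /= !valK.
have s01 a b : 0 <= sigma a b <= 1.
  rewrite /sigma; case: insubP => [a' _ _|_]; last by rewrite lexx ler01.
  case: insubP => [b' _ _|_]; last by rewrite lexx ler01.
  by have /andP[z0 z1] := z01 (a', b'); rewrite subr_ge0 z1 gerBl.
have := vcount_generating_function hZ hstat h1 h2 h3 h5 (dyadic_levels_gt0 n)
  (@dyadic_height_nd R n) (p := 2 ^ n) _ s01.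
rewrite expn_gt0 => /(_ isT).
rewrite (_ : (fun L => _) = (fun L => Ex P (fun w => \prod_j z j ^+ dyadic_count L j w))); last first.
  apply/funext => L; congr (Ex P _); apply/funext => w.
  rewrite (pair_big predT predT)/=; apply: eq_bigr => j _.
  by rewrite sE subKr.
rewrite (_ : expR _ = \prod_j expR (- (dyadic_rate j * (1 - z j))))//.
rewrite -expR_sum sumrN /cell_mean (pair_big predT predT)/=; congr (expR (- _)).
by apply: eq_bigr => j _; rewrite sE mulrC; have [<- _] := dyadic_rateE j.
Qed.

Lemma near_dyadic_count n tol : 0 < tol -> \forall L \near +oo,
  exists A : set Omega, [/\ measurable A, pr P A <= tol & forall w, ~ A w ->
    forall j : dyadic_index n, Psi P Z L w (dyadic_cell j) = (dyadic_count L j w)%:R%:E].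
Proof.
move=> tol0; have half : 0 < (2^-1 : R) <= 2^-1 by rewrite invr_gt0 ltr0n lexx.
have q0 := dyadic_levels_gt0 n; have tau_nd := @dyadic_height_nd R n.
near=> L.
exists (grid_bad P Z (dyadic_levels n) (dyadic_height n) L (2 ^ n * fine_mesh 2^-1 L)).
have L1 : 1 <= L by [].
have /andP[mesh _] : L `^ (1 + 2^-1) <= (2 ^ n * fine_mesh 2^-1 L)%:R <=
    (2 * 2 ^ n)%:R * L `^ (1 + 2^-1) by apply: fine_meshP => //; rewrite expn_gt0.
split; first exact: measurable_grid_bad.
  have h : forall T : nat, L `^ (1 + 2^-1) <= T%:R ->
      pr P (grid_bad P Z (dyadic_levels n) (dyadic_height n) L T) <= tol.
    by near: L; exact: near_grid_bad.
  exact: h.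
move=> w nw j.
have h : forall M : nat, L `^ (1 + 2^-1) <= (2 ^ n * M)%:R -> forall w : Omega,
    ~ grid_bad P Z (dyadic_levels n) (dyadic_height n) L (2 ^ n * M) w ->
    forall a b : nat, (b < dyadic_levels n)%N ->
    Psi P Z L w (cell (dyadic_levels n) (dyadic_height n) (2 ^ n) a b) =
    (gcount P Z (dyadic_levels n) (dyadic_height n) (2 ^ n) L M a b w)%:R%:E.
  by near: L; exact: near_Psi_cell.
exact: h.
Unshelve. all: by end_near. Qed.

End gaps.
End dyadic_laws.

Section poisson_cells.
Context {R : realType} d (Om : measurableType d) (P : probability Om R).
Variable X : Om -> {measure set (R * \bar R) -> \bar R}.
Hypothesis hX : poisson_point_process P X.

Definition cells_event n (m : dyadic_index n -> nat) : set Om :=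
  [set w | forall j, X w (dyadic_cell j) = (m j)%:R%:E].

Lemma measurable_cells_event n (m : dyadic_index n -> nat) : measurable (cells_event m).
Proof.
have [_ mX _] := hX.
have -> : cells_event m =
    \bigcap_(j in [set: dyadic_index n]) [set w | X w (dyadic_cell j) = (m j)%:R%:E].
  by apply/seteqP; split=> w h => [j _|j]; [exact: h|exact: (h j)].
apply: fin_bigcap_measurable => [|j _]; first exact: finite_finset.
have := mX _ (measurable_dyadic_cell j) (@dyadic_cell_state R n j) measurableT [set (m j)%:R%:E] (emeasurable_set1 _).
by rewrite setTI.
Qed.

Lemma cells_event_law n (m : dyadic_index n -> nat) :
  pr P (cells_event m) = \prod_j poisson_mass (dyadic_rate j) (m j).
Proof.
have [_ _ lX] := hX.
pose C (i : 'I_#|dyadic_index n|) : set (R * \bar R) := dyadic_cell (enum_val i).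
have hC i : [/\ measurable (C i), C i `<=` state_space & (intensity (C i) < +oo)%E].
  split; [exact: measurable_dyadic_cell|exact: dyadic_cell_state|].
  by rewrite /C; have [_ ->] := dyadic_rateE (R := R) (enum_val i); rewrite ltry.
have tC : trivIset setT C.
  by move=> i k _ _ [z [iz kz]]; apply: enum_val_inj; exact: dyadic_cell_inj iz kz.
have := lX _ C (fun i => m (enum_val i)) hC tC.
rewrite (_ : [set w | _] = cells_event m); last first.
  apply/seteqP; split=> w h => [j|i]; last exact: h.
  by have /= := h (enum_rank j); rewrite /C enum_rankK.
rewrite /pr => -> /=.
by rewrite [RHS](reindex (@enum_val _ [pred _ : dyadic_index n | true])) //; apply/onW_bij/enum_val_bij.
Qed.

Lemma cells_tight n eps : 0 < eps -> exists K : nat, exists A : set Om,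
  [/\ measurable A, pr P A <= eps & forall w, ~ A w -> forall j : dyadic_index n,
    exists2 k : nat, (k <= K)%N & X w (dyadic_cell j) = k%:R%:E].
Proof.
move=> eps0; have [K hK] := poisson_mass_product (dyadic_rate (R := R) (n := n)) eps0.
pose E (m : {ffun dyadic_index n -> 'I_K.+1}) := cells_event (fun j => m j : nat).
have mE m : measurable (E m) by exact: measurable_cells_event.
have [|mU prU] := pr_disjoint_sum P mE.
  move=> m m' w h h'; apply/ffunP => j; apply/val_inj/eqP.
  by rewrite -(eqr_nat R) -eqe -h -h'.
exists K, (~` \bigcup_(m in [set: {ffun dyadic_index n -> 'I_K.+1}]) E m); split.
- exact: measurableC.
- rewrite pr_setC// prU lerBlDl -lerBlDr; apply: le_trans hK _.
  by apply: ler_sum => m _; rewrite cells_event_law.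
move=> w; rewrite /setC/= => /contrapT[m _ Em] j.
by exists (m j); [rewrite -ltnS|exact: Em].
Qed.

End poisson_cells.

(** * Bounds on the counts uniform in L *)

Section gaps_tight.
Context {R : realType} {d : measure_display} {Omega : measurableType d}.
Variables (P : probability Omega R) (Z : Omega -> set R).
Hypotheses (hZ : point_process Z) (hstat : stationary P Z).
Hypotheses (h1 : gap_decay P Z) (h2 : regularity P Z) (h3 : splitting P Z)
  (h5 : absence_of_clustering P Z).

Let finZ L w : finite_set (Z w `&` `[0, L]).
Proof. by have [h _] := hZ; exact: h. Qed.

Lemma size_points_le L L' w : L <= L' -> (size (points Z L w) <= size (points Z L' w))%N.
Proof.
move=> LL; apply: fsubset_leq_card; rewrite -fset_set_sub; [|exact: finZ|exact: finZ].
move=> z [Zz]; rewrite /= !in_itv/= => /andP[-> zL]; split=> //=.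
exact: le_trans zL LL.
Qed.

Lemma points_tight L eps : 0 < eps -> exists k : nat,
  measurable [set w | (k < size (points Z L w))%N] /\
  pr P [set w | (k < size (points Z L w))%N] <= eps.
Proof.
move=> eps0; have [_ mZ] := hZ.
have m k : measurable [set w | (k < size (points Z L w))%N].
  have := mZ _ (measurable_itv `[0, L]) measurableT _ (emeasurable_itv `]k%:R%:E, +oo[).
  rewrite setTI (_ : _ @^-1` _ = [set w | (k < size (points Z L w))%N])//.
  apply/seteqP; split=> w /=; rewrite /counting asboolT ?in_itv/= ?andbT; try exact: finZ;
    by rewrite lte_fin ltr_nat.
have [k l kl w|w|k pk] := pr_nonincreasing_tail P m _ _ eps0.
- exact: leq_ltn_trans.
- by exists (size (points Z L w)); rewrite /= ltnn.
by exists k.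
Qed.

(** For large L the limit law bounds the counts; for the remaining L the number of points in
    [0, L0 + 1] does. The bound has to hold for every L because the threshold L0 depends on the
    level, while all levels are bounded together in [tight]. *)
Lemma Psi_tight n eps : 0 < eps -> exists K : nat, forall L, exists A : set Omega,
  [/\ measurable A, pr P A <= eps & forall w, ~ A w -> forall j : dyadic_index n,
    exists2 k : nat, (k <= K)%N & Psi P Z L w (dyadic_cell j) = k%:R%:E].
Proof.
move=> eps0; have e4 : 0 < eps / 4 by rewrite divr_gt0.
have [K hK] := poisson_mass_product (dyadic_rate (R := R) (n := n)) e4.
pose E L (m : {ffun dyadic_index n -> 'I_K.+1}) := count_event P Z L (fun j => m j : nat).
have mE L m : measurable (E L m) by exact: measurable_count_event.
have dE L m m' w : E L m w -> E L m' w -> m = m'.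
  by move=> h h'; apply/ffunP => j; apply/ord_inj; rewrite -(h j) -(h' j).
have lim : \sum_m pr P (E L m) @[L --> +oo] -->
    \sum_(m : {ffun dyadic_index n -> 'I_K.+1}) \prod_j poisson_mass (dyadic_rate j) (m j).
  apply: cvg_big; first exact: add_continuous.
  by move=> m _; exact: count_event_law.
have nearE : \forall L \near +oo, 1 - eps / 2 <= \sum_m pr P (E L m).
  have lt : 1 - eps / 2 < \sum_(m : {ffun dyadic_index n -> 'I_K.+1})
      \prod_j poisson_mass (dyadic_rate j) (m j) by apply: lt_le_trans hK; lra.
  by apply: filterS (cvgr_gt _ lim _ lt) => L /ltW.
have e2 : 0 < eps / 2 by rewrite divr_gt0.
have near_psi := near_dyadic_count hZ hstat h1 h2 n e2.
have [L0 [_ hL0]] := filterI nearE near_psi.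
have [k [mk pk]] := points_tight (L0 + 1) eps0.
exists (maxn K k) => L; have [LL0|LL0] := leP L (L0 + 1).
  exists [set w | (k < size (points Z (L0 + 1) w))%N]; split=> // w /negP; rewrite -leqNgt => kw j.
  rewrite Psi_count; eexists; last reflexivity.
  rewrite (leq_trans (count_size _ _))// (leq_trans (size_points_le w LL0))//.
  by rewrite (leq_trans kw)// leq_maxr.
have LL : L0 < L by rewrite (lt_trans _ LL0)// ltrDl.
have [EL [A [mA PA hA]]] := hL0 L LL.
have [mU prU] := pr_disjoint_sum P (mE L) (dE L).
exists (A `|` ~` \bigcup_(m in setT) E L m); split.
- by apply: measurableU => //; exact: measurableC.
- apply: le_trans (pr_setU _ mA (measurableC mU)) _; rewrite pr_setC// prU.
  by rewrite [leRHS]splitr lerD// lerBlDl -lerBlDr.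
move=> w /not_orP[nA /contrapT[m _ Em]] j; rewrite hA//.
by exists (m j); [rewrite leq_max -ltnS ltn_ord|rewrite (Em j)].
Qed.

End gaps_tight.

(** * Functionals reduced to tables of counts *)

Section functional_of_counts.
Context {R : realType}.
Local Notation measureT := {measure set (R * \bar R) -> \bar R}.
Variables (F : measureT -> R) (C : R) (N : nat -> nat) (n : nat) (eps : R).
Hypotheses (C0 : 0 <= C) (eps0 : 0 <= eps).
Hypothesis FC : forall mu, locally_finite mu -> `|F mu| <= C.
Hypothesis Fn : forall mu nu, counts_le N mu -> counts_le N nu ->
  (forall j : dyadic_index n, mu (dyadic_cell j) = nu (dyadic_cell j)) ->
  `|F mu - F nu| <= eps.

Local Notation count_table := {ffun dyadic_index n -> 'I_(N n).+1}.

(** F is evaluated at an arbitrary measure with these counts. By [Fn] the choice matters only up to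
    eps, and the same values serve both processes. *)
Definition count_value (m : count_table) : R :=
  if pselect (exists mu, counts_le N mu /\
      forall j, mu (dyadic_cell j) = (m j)%:R%:E) is left e
  then F (projT1 (cid e)) else 0.

Let count_value_le (m : count_table) : `|count_value m| <= C.
Proof.
rewrite /count_value; case: pselect => [e|_]; last by rewrite normr0.
by apply: FC; have [h _] := projT2 (cid e); exact: counts_le_locally_finite h.
Qed.

Let count_value_close (m : count_table) mu : counts_le N mu ->
  (forall j, mu (dyadic_cell j) = (m j)%:R%:E) -> `|F mu - count_value m| <= eps.
Proof.
move=> muN mum; rewrite /count_value; case: pselect => [e|ne]; last by exfalso; apply: ne; exists mu.
have [h1 h2] := projT2 (cid e).
by apply: Fn => // j; rewrite mum h2.
Qed.

(** Off A the functional is within eps of a function of the table of counts, and A costs at most 2 *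
    C * delta. *)
Lemma expectation_counts d (Om : measurableType d) (P : probability Om R)
    (X : Om -> measureT) (E : count_table -> set Om) (A : set Om) (delta : R) :
  (forall w, locally_finite (X w)) -> (forall m, measurable (E m)) ->
  (forall m m' w, E m w -> E m' w -> m = m') ->
  measurable A -> pr P A <= delta ->
  (forall w, ~ A w -> counts_le N (X w) /\
     forall m : count_table, (forall j, X w (dyadic_cell j) = (m j)%:R%:E) -> E m w) ->
  exists2 r : R, ('E_P[fun w => F (X w)] = r%:E)%E &
    `|r - \sum_m count_value m * pr P (E m)| <= eps + 2 * C * delta.
Proof.
move=> lX mE dE mA PA hA; pose g w := \sum_m count_value m * \1_(E m) w.
have gE m w : E m w -> g w = count_value m.
  move=> Em; rewrite /g (bigD1 m)//= indicE mem_set// mulr1 big1 ?addr0// => m' mm.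
  rewrite indicE memNset ?mulr0// => Em'; move: mm.
  by rewrite (dE _ _ _ Em Em') eqxx.
have bt m : bmeas (fun w => count_value m * \1_(E m) w).
  by apply: bmeasZ; exact: bmeas_indic.
have gC w : `|g w| <= C.
  have [[m Em]|nE] := pselect (exists m, E m w); first by rewrite (gE m).
  rewrite /g big1 ?normr0// => m _; rewrite indicE memNset ?mulr0// => Em.
  by apply: nE; exists m.
have -> : \sum_m count_value m * pr P (E m) = Ex P g.
  rewrite Ex_sum; last by move=> m _; exact: bt.
  by apply: eq_bigr => m _; rewrite ExZ ?Ex_indic//; exact: bmeas_indic.
apply: (expectation_sandwich _ _ _ _ gC mA PA) => //.
- by apply: bmeas_sum => m _; exact: bt.
- by move=> w; exact: FC.
move=> w nA; have [XN XE] := hA w nA.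
have [m hm] : exists m : count_table, forall j, X w (dyadic_cell j) = (m j)%:R%:E.
  exists [ffun j => inord (cell_count (X w) j)] => j; rewrite ffunE (cell_countE _ XN).
  have [k kN Xk] := XN n j; rewrite inordK//.
  have : k%:R%:E == (cell_count (X w) j)%:R%:E :> \bar R by rewrite -Xk (cell_countE j XN).
  by rewrite eqe eqr_nat => /eqP <-.
by rewrite (gE m) ?count_value_close//; exact: XE.
Qed.

End functional_of_counts.

Section convergence.
Context {R : realType} {d : measure_display} {Omega : measurableType d}.
Variables (P : probability Omega R) (Z : Omega -> set R).
Hypotheses (hZ : point_process Z) (hstat : stationary P Z).
Hypotheses (h1 : gap_decay P Z) (h2 : regularity P Z) (h3 : splitting P Z)
  (h5 : absence_of_clustering P Z).
Context {d' : measure_display} {Omega' : measurableType d'}.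
Variables (P' : probability Omega' R)
  (Pi : Omega' -> {measure set (R * \bar R) -> \bar R}).
Hypothesis hPi : poisson_point_process P' Pi.
Local Notation measureT := {measure set (R * \bar R) -> \bar R}.

Let Psi_locally_finite L w : locally_finite (Psi P Z L w).
Proof. by move=> K _ _; rewrite Psi_count ltry. Qed.

(** Level k is allowed the exceptional probability delta / 2 ^ k.+1, and the maximum of the two
    bounds serves both processes at once. *)
Let tight (delta : R) : 0 < delta -> exists N : nat -> nat,
  (forall L, exists A, [/\ measurable A, pr P A <= delta &
    forall w, ~ A w -> counts_le N (Psi P Z L w)]) /\
  exists A, [/\ measurable A, pr P' A <= delta &
    forall w, ~ A w -> counts_le N (Pi w)].
Proof.
move=> delta0; have dk k : 0 < delta / (2 ^ k.+1)%:R.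
  by rewrite divr_gt0// ltr0n expn_gt0.
have [N1 hN1] := choice (fun k => Psi_tight hZ hstat h1 h2 h3 h5 k (dk k)).
have [N2 hN2] := choice (fun k => cells_tight hPi k (dk k)).
exists (fun k => maxn (N1 k) (N2 k)); split.
  move=> L; have [A hA] := choice (fun k => hN1 k L).
  have [||mA PA] := pr_bigcup_half (P := P) (A := A) (ltW delta0).
  - by move=> k; have [] := hA k.
  - by move=> k; have [] := hA k.
  exists (\bigcup_k A k); split=> // w nA k j; have [_ _ h] := hA k.
  have [|m mN ->] := h w _ j; first by move=> Aw; apply: nA; exists k.
  by exists m => //; rewrite (leq_trans mN)// leq_maxl.
have [A hA] := choice hN2.
have [||mA PA] := pr_bigcup_half (P := P') (A := A) (ltW delta0).
- by move=> k; have [] := hA k.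
- by move=> k; have [] := hA k.
exists (\bigcup_k A k); split=> // w nA k j; have [_ _ h] := hA k.
have [|m mN ->] := h w _ j; first by move=> Aw; apply: nA; exists k.
by exists m => //; rewrite (leq_trans mN)// leq_maxr.
Qed.

Lemma gaps_expectation_close (F : measureT -> R) (C e : R) : vaguely_continuous F ->
  0 <= C -> (forall mu, locally_finite mu -> `|F mu| <= C) -> 0 < e ->
  exists2 r' : R, ('E_P'[fun w => F (Pi w)] = r'%:E)%E &
    \forall L \near +oo, exists2 r : R, ('E_P[fun w => F (Psi P Z L w)] = r%:E)%E & `|r - r'| <= e.
Proof.
move=> cF C0 FC e0.
(* The errors add up to less than e: e / 8 + e / 8 for the Poisson process, e / 8 + e / 4 for the
   gaps and e / 4 between the finite sums. *)
pose delta := e / (16 * (C + 1)).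
have delta0 : 0 < delta by rewrite divr_gt0// mulr_gt0// ltr_wpDl.
have Cdelta : 2 * C * (2 * delta) <= e / 4.
  have : C * delta <= e / 16.
    rewrite /delta invfM mulrCA ler_pM2l// mulrCA ler_piMr ?invr_ge0//.
    by rewrite ler_pdivrMr ?mul1r ?lerDl// ltr_wpDl.
  lra.
have Cdelta' : 2 * C * delta <= e / 8.
  by move: Cdelta; rewrite mulrCA; lra.
have [N [hN [A' [mA' PA' hA']]]] := tight delta0.
have e8 : 0 < e / 8 by rewrite divr_gt0.
have [n Fn] := vaguely_continuous_counts N cF e8.
have [lPi _ _] := hPi.
pose E' (m : {ffun dyadic_index n -> 'I_(N n).+1}) := cells_event Pi (fun j => m j : nat).
have mE' m : measurable (E' m) by exact: (measurable_cells_event hPi).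
have dE' m m' w : E' m w -> E' m' w -> m = m'.
  move=> h h'; apply/ffunP => j; apply/ord_inj/eqP.
  by rewrite -(eqr_nat R) -eqe -(h j) -(h' j).
have cE' w : ~ A' w -> counts_le N (Pi w) /\ forall m : {ffun dyadic_index n -> 'I_(N n).+1},
    (forall j, Pi w (dyadic_cell j) = (m j)%:R%:E) -> E' m w.
  by move=> nA; split; [exact: hA'|].
have [r' Er' r'E'] := expectation_counts C0 (ltW e8) FC Fn lPi mE' dE' mA' PA' cE'.
exists r' => //.
pose E L (m : {ffun dyadic_index n -> 'I_(N n).+1}) := count_event P Z L (fun j => m j : nat).
have lim : \sum_m count_value F m * pr P (E L m) @[L --> +oo] -->
    \sum_m count_value F m * pr P' (E' m).
  apply: cvg_big; first exact: add_continuous.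
  move=> m _; apply: cvgM; first exact: cvg_cst.
  by rewrite (cells_event_law hPi); exact: count_event_law.
have near_sum : \forall L \near +oo, `|\sum_m count_value F m * pr P (E L m) -
    \sum_m count_value F m * pr P' (E' m)| <= e / 4.
  have e4 : 0 < e / 4 by rewrite divr_gt0.
  move/cvgrPdist_le: lim => /(_ _ e4); apply: filterS => L.
  by rewrite distrC.
apply: filterS2 near_sum (near_dyadic_count hZ hstat h1 h2 n delta0) => L sumL [A0 [mA0 PA0 hA0]].
have [A [mA PA hA]] := hN L.
have mE m : measurable (E L m) by exact: measurable_count_event.
have dE m m' w : E L m w -> E L m' w -> m = m'.
  by move=> h h'; apply/ffunP => j; apply/ord_inj; rewrite -(h j) -(h' j).
have mA2 : measurable (A `|` A0) by exact: measurableU.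
have PA2 : pr P (A `|` A0) <= 2 * delta.
  by rewrite (le_trans (pr_setU _ mA mA0))// mulr_natl mulr2n lerD.
have cE w : ~ (A `|` A0) w -> counts_le N (Psi P Z L w) /\
    forall m : {ffun dyadic_index n -> 'I_(N n).+1},
    (forall j, Psi P Z L w (dyadic_cell j) = (m j)%:R%:E) -> E L m w.
  move=> /not_orP[nA nA0]; split=> [|m hm j]; first exact: hA.
  by apply/eqP; rewrite -(eqr_nat R) -eqe -hA0// hm.
have [r Er rE] := expectation_counts C0 (ltW e8) FC Fn (Psi_locally_finite L) mE dE mA2 PA2 cE.
exists r => //.
move: (\sum_m _) (\sum_m _) sumL rE r'E' => s s'.
rewrite !ler_distl => /andP[a1 a2] /andP[a3 a4] /andP[a5 a6].
by apply/andP; split; lra.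
Qed.

End convergence.

Theorem proposition5p3 (R : realType)
    (d : measure_display) (Omega : measurableType d) (P : probability Omega R)
    (Z : Omega -> set R)
    (hZ : point_process Z) (hstat : stationary P Z)
    (h1 : gap_decay P Z) (h2 : regularity P Z) (h3 : splitting P Z)
    (h4 : clustered_decoupling P Z) (h5 : absence_of_clustering P Z)
    (d' : measure_display) (Omega' : measurableType d')
    (P' : probability Omega' R)
    (Pi : Omega' -> {measure set (R * \bar R) -> \bar R})
    (hPi : poisson_point_process P' Pi) :
  cvg_vaguely_in_distribution P (Psi P Z) P' Pi.
Proof.
move=> F cF [C0 FC0].
have FC mu : locally_finite mu -> `|F mu| <= `|C0|.
  by move=> /FC0/le_trans; apply; exact: ler_norm.
have close e : 0 < e -> _ := gaps_expectation_close hZ hstat h1 h2 h3 h5 hPi cF (normr_ge0 C0) FC.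
(* The instance e = 1 only fixes the real value of the Poisson expectation, which is the same for
   all e. *)
have [r' Er' _] := close 1 ltr01; rewrite Er'.
have {}close e : 0 < e -> \forall L \near +oo,
    exists2 r : R, ('E_P[fun w => F (Psi P Z L w)] = r%:E)%E & `|r - r'| <= e.
  move=> e0; have [r2 Er2 h] := close e e0.
  by have -> : r' = r2 by apply: EFin_inj; rewrite -Er' -Er2.
apply: cvg_EFin; first by apply: filterS (close 1 ltr01) => L [r -> _].
apply/cvgrPdist_le => e e0; apply: filterS (close e e0) => L [r Er].
by rewrite /= Er distrC.
Qed.
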